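(* Let $k\ge 1$ and $i\ge 1$ be integers. The elements $L_1,\dots,L_k$, together with the scalars $c_s(j)$ ($s\in T(\Lambda_{k,i})$, $1\le j\le k$), form a separating family of JM-elements for the cellular algebra $TL_{(k,i)}$ with cell datum $(\Lambda_{k,i},T,C)$, $C(s,t)=G_{s,t}$ (for any choice of the partial order $\rhd$ on $T(\Lambda_{k,i})$).
   Context: Let $A$ be an indeterminate, work over the field $\mathbb{Q}(A)$, and put $\delta=-A^{2}-A^{-2}$. For $m,n\ge 0$ let $TL(m,n)$ be the vector space with basis the isotopy classes of crossingless diagrams (without closed loops) in a rectangle with $m$ marked points on the bottom and $n$ on the top. Diagrams are composed by stacking, $XY$ meaning $X$ on top of $Y$, each closed loop being removed at the cost of a factor $\delta$; $\otimes$ denotes horizontal juxtaposition; $\mathrm{id}_n$ is the identity diagram. $TL_n=TL(n,n)$ is the Temperley-Lieb algebra, generated by $1,e_1,\dots,e_{n-1}$ with $e_j^2=\delta e_j$, $e_je_{j\pm1}e_j=e_j$, $e_je_l=e_le_j$ for $|j-l|>1$. The map $X\mapsto X^*$, $TL(m,n)\to TL(n,m)$, is the $\mathbb{Q}(A)$-linear extension of reflecting diagrams in a horizontal line. The trace $\mathrm{tr}:TL_n\to\mathbb{Q}(A)$ sends a diagram to $\delta^{c}$, with $c$ the number of loops obtained by joining the $j$-th top point to the $j$-th bottom point for all $j$ by planar arcs outside the rectangle. The Jones-Wenzl idempotent $f_n\in TL_n$ is the unique nonzero idempotent with $e_jf_n=f_ne_j=0$ for all $1\le j\le n-1$ ($f_0$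 is the empty diagram). $\Delta_n=\mathrm{tr}(f_n)=(-1)^n\frac{A^{2n+2}-A^{-2n-2}}{A^2-A^{-2}}$. Colored Temperley-Lieb algebra: let $F=f_i^{\otimes k}\in TL_{ki}$. Then $TL_{(k,i)}=\{FXF: X\in TL_{ki}\}$, an algebra with identity $F$. Admissibility: a triple $(x,y,z)$ of non-negative integers is admissible if $x+y+z$ is even and $x\le y+z$, $y\le x+z$, $z\le x+y$. For $(x,y,z)$ admissible put $p=\frac{x+y-z}{2}$, $r=\frac{x+z-y}{2}$, $q=\frac{y+z-x}{2}$; the trivalent vertex is $V_{x,y}^{z}=f_z\,E\,(f_x\otimes f_y)\in TL(x+y,z)$, where $E\in TL(x+y,z)$ joins the last $p$ of the first $x$ bottom points to the first $p$ of the last $y$ bottom points by nested arcs, and the remaining $r+q=z$ bottom points to the top points without crossings. $\theta(x,y,z)=\mathrm{tr}\big(V_{x,y}^{z}(V_{x,y}^{z})^{*}\big)$. An $i$-admissible sequence of length $k$ is a sequence $s=(s_1,\dots,s_k)$ of non-negative integers with $s_1=i$ and $(s_{j-1},s_j,i)$ admissible for $1<j\le k$; its weight is $\omega(s)=s_k$. Define $v_s\in TL(ki,s_k)$ recursively by $v_{(i)}=f_i$, $v_{(s_1,\dots,s_m)}=V_{s_{m-1},i}^{s_m}(v_{(s_1,\dots,s_{m-1})}\otimes\mathrm{id}_i)$, and put $\eta(s)=\prod_{j=1}^{k-1}\frac{\theta(s_{j+1},s_j,i)}{\Delta_{s_{j+1}}}$ (nonzero). $\Lambda_{k,i}=\{ki-2j: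 j=0,\dots,\lfloor ki/2\rfloor\}$ with its natural order; for $\lambda\in\Lambda_{k,i}$, $T(\lambda)$ is the set of $i$-admissible sequences of length $k$ and weight $\lambda$, and $T(\Lambda_{k,i})=\bigcup_\lambda T(\lambda)$. For $s,t\in T(\lambda)$, $G_{s,t}=\frac{1}{\eta(s)}v_s^{*}v_t\in TL_{(k,i)}$. With $C(s,t)=G_{s,t}$, $(\Lambda_{k,i},T,C)$ is a cell datum for $TL_{(k,i)}$; its anti-isomorphism $*$ is the linear map with $G_{s,t}^*=G_{t,s}$. JM-elements of $TL_{(k,i)}$: in $TL_{ki}$ let $\sigma_m=A^{-1}\cdot 1+A\,e_m$ (a crossing of strands $m,m+1$). For $1\le m\le k-1$ let $\Sigma_m=\prod_{a=1}^{i}\big(\sigma_{mi+a-1}\sigma_{mi+a-2}\cdots\sigma_{(m-1)i+a}\big)$ (factors ordered left to right by increasing $a$), the crossing of the $m$-th and $(m+1)$-st groups of $i$ parallel strands. $L_1=F$ is the identity of $TL_{(k,i)}$ and, for $2\le j\le k$, $L_j=F\,\Sigma_{j-1}\cdots\Sigma_2\Sigma_1\Sigma_1\Sigma_2\cdots\Sigma_{j-1}\,F$ (the $j$-th colored strand winds once around the first $j-1$ colored strands). Scalars: $c_s(1)=1$ and $c_s(j)=(\lambda_{s_j}^{s_{j-1},i})^2$ for $2\le j\le k$, where $\lambda_a^{b,c}=(-1)^{(b+c-a)/2}A^{[b(b+2)+c(c+2)-a(a+2)]/2}$ for an admissible triple $(a,b,c)$. Separating family of JM-elements: let $B$ be a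 cellular algebra with cell datum $(\Lambda,T,C)$, basis $a^\lambda_{st}$, and a partial order $\rhd$ on $T(\Lambda)=\bigcup_\lambda T(\lambda)$. A family of JM-elements is a family $\{L_1,\dots,L_M\}$ of mutually commuting elements of $B$ with scalars $c_t(m)$ ($t\in T(\Lambda)$, $1\le m\le M$) such that $L_m^*=L_m$ and, for all $\lambda\in\Lambda$ and $s,t\in T(\lambda)$, $L_m a^\lambda_{st}\equiv c_s(m)a^\lambda_{st}+\sum_{u\in T(\lambda),\,u\rhd s}r_{s,u}a^\lambda_{ut}$ modulo $B^\lambda$ for some scalars $r_{s,u}$, where $B^\lambda$ is spanned by $\{a^\mu_{yz}:\mu>\lambda\}$. It is separating if whenever $s\rhd t$ in $T(\Lambda)$ there is some $m$ with $c_s(m)\ne c_t(m)$. *)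

(* Defs.v *)
From HB Require Import structures.
From mathcomp Require Import all_boot all_order all_algebra.
From mathcomp Require Import boolp classical_sets.
Set Implicit Arguments.
Unset Strict Implicit.
Unset Printing Implicit Defensive.
Import Order.TTheory GRing.Theory.
Local Open Scope ring_scope.

Definition K : fieldType := {fraction {poly rat}}.
Definition A : K := tofrac ('X : {poly rat}).
Definition delta : K := - A ^+ 2 - A ^- 2.

(** * Crossingless diagrams and the spaces TL(m,n) *)

(* Marked points of the rectangle: [inl a] is the a-th bottom point, [inr b]
   the b-th top point, both counted from the left starting at 0. *)
Definition pt (m n : nat) : finType := ('I_m + 'I_n)%type.

(* Rank of a marked point along the boundary circle: the bottom from left to
   right, then the top from right to left. *)
Definition pos m n (p : pt m n) : nat :=
  match p with inl a => a | inr b => (m + (n - b.+1))%N end.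

Definition crossingless m n (d : {ffun pt m n -> pt m n}) : bool :=
  [&& [forall p, d (d p) == p],
      [forall p, d p != p] &
      [forall p, forall q,
         ~~ [&& pos p < pos q, pos q < pos (d p) & pos (d p) < pos (d q)]%N]].

(* An isotopy class of crossingless diagrams without closed loops is the planar
   perfect matching of the marked points that it induces. *)
Definition diagram m n : finType := {d : {ffun pt m n -> pt m n} | crossingless d}.

Definition partner m n (d : diagram m n) : pt m n -> pt m n := val d.

Definition TL m n : vectType K := {ffun diagram m n -> K^o}.

(* The basis vector of the diagram all of whose arcs {p, q} satisfy [R p q]; it
   is used for relations [R] satisfied by exactly one diagram. *)
Definition basisTL m n (R : rel (pt m n)) : TL m n :=
  [ffun d : diagram m n => ([forall p, R p (partner d p)])%:R].

Definition castTL m n m' n' (em : m = m') (en : n = n') (X : TL m n) :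
  TL m' n' := let: erefl := em in let: erefl := en in X.

(** ** Composition *)

(* The graph obtained by stacking [x] on top of [y]; its vertices are the marked
   points of [x] ([inl]) and of [y] ([inr]). *)
Definition stack l m n (x : diagram m n) (y : diagram l m) :
    rel (pt m n + pt l m)%type := fun u v =>
  match u, v with
  | inl p, inl q => q == partner x p
  | inr p, inr q => q == partner y p
  | inl (inl a), inr (inr b) | inr (inr b), inl (inl a) => a == b
  | _, _ => false
  end.

Definition outer l m n (p : pt l n) : (pt m n + pt l m)%type :=
  match p with inl a => inr (inl a) | inr b => inl (inr b) end.

Definition stacked l m n (x : diagram m n) (y : diagram l m) (d : diagram l n) :=
  [forall p, forall q, (partner d p == q) ==
     ((p != q) && connect (stack x y) (outer m p) (outer m q))].

Definition loops l m n (x : diagram m n) (y : diagram l m) : nat :=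
  n_comp (stack x y)
    [pred u | ~~ [exists p : pt l n, connect (stack x y) u (outer m p)]].

(* [mulTL X Y] is XY, that is, X on top of Y. *)
Definition mulTL l m n (X : TL m n) (Y : TL l m) : TL l n :=
  [ffun d : diagram l n =>
     \sum_(x : diagram m n) \sum_(y : diagram l m | stacked x y d)
        (X x : K) * (Y y : K) * delta ^+ loops x y].

(** ** Juxtaposition, reflection, trace *)

Definition ptl m n m' n' (p : pt m n) : pt (m + m') (n + n') :=
  match p with inl a => inl (lshift m' a) | inr b => inr (lshift n' b) end.
Definition ptr m n m' n' (p : pt m' n') : pt (m + m') (n + n') :=
  match p with inl a => inl (rshift m a) | inr b => inr (rshift n b) end.

Definition juxtaposed m n m' n' (x : diagram m n) (y : diagram m' n')
    (d : diagram (m + m') (n + n')) : bool :=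
  [forall p, partner d (ptl m' n' p) == ptl m' n' (partner x p)] &&
  [forall p, partner d (ptr m n p) == ptr m n (partner y p)].

Definition tensTL m n m' n' (X : TL m n) (Y : TL m' n') :
    TL (m + m') (n + n') :=
  [ffun d : diagram (m + m') (n + n') =>
     \sum_(x : diagram m n) \sum_(y : diagram m' n' | juxtaposed x y d)
        (X x : K) * (Y y : K)].

Definition flip m n (p : pt m n) : pt n m :=
  match p with inl a => inr a | inr b => inl b end.

Definition reflTL m n (X : TL m n) : TL n m :=
  [ffun d : diagram n m =>
     \sum_(x : diagram m n | [forall p, partner d (flip p) == flip (partner x p)])
        (X x : K)].

Definition closure_loops n (d : diagram n n) : nat :=
  n_comp (fun p q : pt n n => (q == partner d p) || (q == flip p)) predT.

Definition trTL n (X : TL n n) : K :=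
  \sum_(d : diagram n n) (X d : K) * delta ^+ closure_loops d.

(** ** Identity, generators, Jones-Wenzl idempotents *)

Definition idTL n : TL n n := basisTL (fun p q : pt n n => q == flip p).

(* The generators are numbered from 1: [eTL n j] joins the points of ranks j-1
   and j (from 0) on the bottom, and likewise on the top. *)
Definition eTL n (j : nat) : TL n n :=
  basisTL (fun p q : pt n n => match p, q with
    | inl a, inl b | inr a, inr b =>
        ((a == j.-1 :> nat) && (b == j :> nat))
        || ((a == j :> nat) && (b == j.-1 :> nat))
    | inl a, inr b | inr b, inl a =>
        [&& a == b, a != j.-1 :> nat & a != j :> nat]
    end).

Definition is_jones_wenzl n (f : TL n n) : Prop :=
  [/\ f != 0, mulTL f f = f &
      forall j, (1 <= j < n)%N ->
        mulTL (eTL n j) f = 0 /\ mulTL f (eTL n j) = 0].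

Definition jw n : TL n n := xget 0 [set f | is_jones_wenzl f]%classic.

Definition Delta n : K := trTL (jw n).

(** * Trivalent vertices *)

Definition admissible (x y z : nat) : bool :=
  [&& ~~ odd (x + y + z), x <= y + z, y <= x + z & z <= x + y]%N.

Definition vertex_diagram (x y z : nat) : TL (x + y) z :=
  let p := (x + y - z)./2 in
  basisTL (fun u v : pt (x + y) z => match u, v with
    | inl a, inl b => (x - p <= a < x + p)%N && ((a + b).+1 == x.*2)%N
    | inl a, inr b | inr b, inl a =>
        ((a < x - p)%N && (b == a :> nat))
        || ((x + p <= a)%N && (a == b + p.*2 :> nat)%N)
    | inr _, inr _ => false
    end).

Definition vertex (x y z : nat) : TL (x + y) z :=
  mulTL (jw z) (mulTL (vertex_diagram x y z) (tensTL (jw x) (jw y))).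

Definition theta (x y z : nat) : K :=
  trTL (mulTL (vertex x y z) (reflTL (vertex x y z))).

(** * The colored Temperley-Lieb algebra *)

Fixpoint tens_pow i (X : TL i i) k : TL (k * i) (k * i) :=
  if k is k'.+1 then tensTL X (tens_pow X k') else idTL 0.

Definition Fki k i : TL (k * i) (k * i) := tens_pow (jw i) k.

Definition TLki k i : set (TL (k * i) (k * i)) :=
  [set Y | exists X, Y = mulTL (Fki k i) (mulTL X (Fki k i))]%classic.
Arguments TLki : clear implicits.

(* Sequences are indexed from 1, as in s = (s_1, ..., s_k). *)
Definition entry (s : seq nat) (j : nat) : nat := nth 0%N s j.-1.

Definition i_admissible i (s : seq nat) : bool :=
  [&& (0 < size s)%N, entry s 1 == i &
      all (fun j => admissible (entry s j.-1) (entry s j) i)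
          (index_iota 2 (size s).+1)].

Definition weight (s : seq nat) : nat := entry s (size s).

(* [vrec i s m] is v_(s_1, ..., s_m), for m >= 1 and s_1 = i. *)
Fixpoint vrec i (s : seq nat) (m : nat) : TL (m * i) (entry s m) :=
  match m with
  | 0 => 0
  | m'.+1 =>
    match m' return TL (m' * i) (entry s m') ->
                    TL (m'.+1 * i) (entry s m'.+1) with
    | 0 => fun _ =>
        if entry s 1 =P i is ReflectT e
        then castTL (esym (mul1n i)) (esym e) (jw i) else 0
    | m''.+1 => fun w =>
        castTL (esym (mulSnr m''.+1 i)) erefl
          (mulTL (vertex (entry s m''.+1) i (entry s m''.+2))
                 (tensTL w (idTL i)))
    end (vrec i s m')
  end.

Definition eta i (s : seq nat) : K :=
  \prod_(1 <= j < size s)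
     (theta (entry s j.+1) (entry s j) i / Delta (entry s j.+1)).

Definition Lambda_seq k i : seq nat :=
  [seq (k * i - j.*2)%N | j <- iota 0 ((k * i)./2).+1].

Definition Lambda k i := seq_sub (Lambda_seq k i).
HB.instance Definition _ k i := SubFinite.on (Lambda k i).
HB.instance Definition _ k i :=
  [SubChoice_isSubPOrder of Lambda k i by <: with Order.NatOrder.nat_display].

Lemma i_admissible_le i s j : i_admissible i s -> (entry s j <= size s * i)%N.
Proof.
move=> /and3P[s0 /eqP s1 /allP adm].
have bd m : (m < size s)%N -> (entry s m.+1 <= m.+1 * i)%N.
  elim: m => [|m IH] lt_m; first by rewrite s1 mul1n.
  have /adm/and4P[_ _ le_a _] : m.+2 \in index_iota 2 (size s).+1.
    by rewrite mem_index_iota.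
  by apply: leq_trans le_a _; rewrite /= mulSn addnC leq_add2l IH // ltnW.
case: (leqP (size s) j.-1) => [le_s|lt_s]; first by rewrite /entry nth_default.
have -> : entry s j = entry s j.-1.+1 by [].
by apply: leq_trans (bd _ lt_s) _; rewrite leq_mul2r lt_s orbT.
Qed.

(* T(l). The entries are bounded by k * i only in order to obtain a finite type;
   by [i_admissible_le] no sequence is lost. *)
Definition nats k i (s : k.-tuple 'I_(k * i).+1) : seq nat :=
  map (@nat_of_ord _) s.

Definition T k i (l : Lambda k i) : finType :=
  {s : k.-tuple 'I_(k * i).+1
     | i_admissible i (nats s) && (weight (nats s) == ssval l)}.
Arguments T : clear implicits.

Definition seqT k i (l : Lambda k i) (s : T k i l) : seq nat := nats (val s).

Lemma entry_seqT k i (l : Lambda k i) (s : T k i l) : entry (seqT s) k = ssval l.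
Proof.
case: s => s /= sP; case/andP: (sP) => _ /eqP; rewrite /weight /seqT /=.
by rewrite size_map size_tuple.
Qed.

Definition vT k i (l : Lambda k i) (s : T k i l) : TL (k * i) (ssval l) :=
  castTL erefl (entry_seqT s) (vrec i (seqT s) k).

Definition G k i (l : Lambda k i) (s t : T k i l) : TL (k * i) (k * i) :=
  (eta i (seqT s))^-1 *: mulTL (reflTL (vT s)) (vT t).
Arguments G : clear implicits.

(** * Jucys-Murphy elements *)

Definition sigma n (m : nat) : TL n n := A^-1 *: idTL n + A *: eTL n m.

Definition prodTL n (r : seq nat) (X : nat -> TL n n) : TL n n :=
  \big[@mulTL n n n / idTL n]_(a <- r) X a.

(* [iota x y] lists y consecutive integers from x on. *)
Definition Sigma k i (m : nat) : TL (k * i) (k * i) :=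
  prodTL (iota 1 i) (fun a =>
    prodTL (rev (iota (m.-1 * i + a) i)) (sigma (k * i))).

Definition JM k i (j : nat) : TL (k * i) (k * i) :=
  if j == 1%N then Fki k i else
  mulTL (Fki k i)
    (mulTL (prodTL (rev (iota 1 j.-1)) (Sigma k i))
      (mulTL (prodTL (iota 1 j.-1) (Sigma k i)) (Fki k i))).

Definition twist_coef (a b c : nat) : K :=
  (- 1) ^+ (b + c - a)./2 *
  A ^ (((b * (b + 2) + c * (c + 2))%N%:Z - (a * (a + 2))%N%:Z) %/ 2)%Z.

Definition JM_scalar i (s : seq nat) (j : nat) : K :=
  if j == 1%N then 1 else twist_coef (entry s j) (entry s j.-1) i ^+ 2.

(** * Cellular algebras and families of JM-elements *)

(* The algebras are carried by a subset [B] of an ambient vector space [V],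
   with a product [mul] defined on [V]. *)
Record is_algebra (F : fieldType) (V : vectType F) (mul : V -> V -> V)
    (B : set V) (one : V) : Prop := IsAlgebra {
  alg_sub0 : B 0;
  alg_subD : forall a x y, B x -> B y -> B (a *: x + y);
  alg_mul : forall x y, B x -> B y -> B (mul x y);
  alg_linl : forall a x y z, B x -> B y -> B z ->
    mul (a *: x + y) z = a *: mul x z + mul y z;
  alg_linr : forall a x y z, B x -> B y -> B z ->
    mul z (a *: x + y) = a *: mul z x + mul z y;
  alg_assoc : forall x y z, B x -> B y -> B z ->
    mul x (mul y z) = mul (mul x y) z;
  alg_one : B one;
  alg_mul1l : forall x, B x -> mul one x = x;
  alg_mul1r : forall x, B x -> mul x one = x
}.

Section Cellular.
Variables (F : fieldType) (V : vectType F) (mul : V -> V -> V) (B : set V).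
Variables (d : Order.disp_t) (Lam : finPOrderType d) (Tab : Lam -> finType).
Variable C : forall l, Tab l -> Tab l -> V.

Definition cell_family (p : {l : Lam & (Tab l * Tab l)%type}) : V :=
  C (tagged p).1 (tagged p).2.

(* The subspace B^l. *)
Definition cell_above (l : Lam) : {vspace V} :=
  (\sum_(p | (l < tag p)%O) <[cell_family p]>)%VS.

Record is_cell_datum (star : V -> V) : Prop := IsCellDatum {
  cell_free : free (codom cell_family);
  cell_span : forall x, B x <-> x \in <<codom cell_family>>%VS;
  cell_star_lin : forall a x y, B x -> B y ->
    star (a *: x + y) = a *: star x + star y;
  cell_star_mul : forall x y, B x -> B y ->
    star (mul x y) = mul (star y) (star x);
  cell_star : forall l (s t : Tab l), star (C s t) = C t s;
  cell_mul : forall x l (s : Tab l), B x -> exists r : Tab l -> F,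
    forall t, mul x (C s t) - \sum_u r u *: C u t \in cell_above l
}.

Definition allTab := {l : Lam & Tab l}.

Definition is_strict_order (X : Type) (gt : rel X) : Prop :=
  irreflexive gt /\ transitive gt.

(* [gt] is the strict order on T(Lambda); L and c are indexed by 1, ..., M. *)
Record is_JM_family (star : V -> V) (gt : rel allTab) (M : nat)
    (L : nat -> V) (c : allTab -> nat -> F) : Prop := IsJMFamily {
  JM_in : forall m, (1 <= m <= M)%N -> B (L m);
  JM_comm : forall m m', (1 <= m <= M)%N -> (1 <= m' <= M)%N ->
    mul (L m) (L m') = mul (L m') (L m);
  JM_star : forall m, (1 <= m <= M)%N -> star (L m) = L m;
  JM_triangular : forall m l, (1 <= m <= M)%N ->
    exists r : Tab l -> Tab l -> F, forall s t : Tab l,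
      mul (L m) (C s t)
      - (c (Tagged Tab s) m *: C s t
         + \sum_(u | gt (Tagged Tab u) (Tagged Tab s)) r s u *: C u t)
      \in cell_above l
}.

Definition is_separating (gt : rel allTab) (M : nat)
    (c : allTab -> nat -> F) : Prop :=
  forall s t, gt s t -> exists m, (1 <= m <= M)%N /\ c s m <> c t m.

End Cellular.

(* Main.v *)
From HB Require Import structures.
From mathcomp Require Import boolp classical_sets.
From mathcomp Require Import all_boot all_order all_algebra all_fingroup.
From mathcomp Require Import generic_quotient zify ring.
Require Import Defs.
Set Implicit Arguments.
Unset Strict Implicit.
Unset Printing Implicit Defensive.
Import Order.TTheory GRing.Theory Num.Theory.

(** The trace form tr(X Y^* ) is anisotropic over Q(A), since the Gram matrix of
    the diagrams has its top powers of delta on the diagonal. This gives the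
    Jones-Wenzl idempotent as the component of the identity orthogonal to the
    other diagrams, and the nonvanishing of Delta and theta. Consequently
    v_s v_t^* = 0 for s <> t and v_s v_s^* = c_s f_l with c_s <> 0, while the
    fusion rule f_x (x) f_y = sum_z (Delta_z / theta(x,y,z)) V^* V gives
    F = sum_s c_s^-1 v_s^* v_s. Thus TL_(k,i) is a direct sum of matrix algebras
    in which the G_{s,t} are rescaled matrix units.

    The full twist of n strands acts on f_z TL(n,z) by A^(6p - z(z-1)), where
    n = z + 2p, and the full twist of j groups of i strands is the product of
    those of the first j-1 groups and of the last one with the winding of the
    last group around the others. Comparing scalars, v_s L_j = c_s(j) v_s, hence
    L_j = sum_s (c_s(j) / c_s) v_s^* v_s is diagonal in the cellular basis.
    Finally the squares of the twist coefficients determine s_j from s_(j-1)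
    because A is not a root of unity. *)

(** Diagrams are matchings of boundary points, so stacking them is a graph computation: that a
    composite is again crossingless, that composition is associative and that loop exponents add up
    all need proof. Colourings do this work. A matching is non-crossing exactly when every colouring
    of its arcs by elements of square 1 in [S_3] has trivial boundary word, and this property is
    visibly inherited by composites. Two-colourings turn a diagram into a 0/1 matrix indexed by
    words; since the diagram and the power of 2 contributed by the loops can both be read off from a
    matrix product, identities of diagrams and of loop numbers are checked there. In the scalar
    A^(6p - z(z-1)), each cap that passes through a full twist frees two curls of value -A^3, whence
    A^6; on f_z the full twist has z(z-1) crossings, each acting as A^-1 because f_z kills the
    generators. The scalar c_s(j) is then obtained as a quotient of such monomials, so that no
    crossing is ever resolved at a trivalent vertex. *)

(** * Components of a graph made of two involutions *)

Section Dihedral.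
Variables (T : finType) (alpha beta : T -> T).
Hypotheses (alphaK : involutive alpha) (betaK : involutive beta).
Hypothesis alphaN : forall u, alpha u != u.

Let e : rel T := fun u v => (v == alpha u) || (v == beta u).
Let g := beta \o alpha.

Let g_inj : injective g.
Proof. exact: inj_comp (can_inj betaK) (can_inj alphaK). Qed.

Let g_beta u : g (beta (g u)) = beta u.
Proof. by rewrite /g /= betaK alphaK. Qed.

(** [beta] conjugates [g] to its inverse, so at a fixed point of [beta] it reflects the orbit of
    [g], exchanging the powers k and -k. *)
Lemma iter_dihedral k u : beta u = u -> iter k g (beta (iter k g u)) = u.
Proof.
move=> bu; elim: k => //= k IH; rewrite -/(g _).
by rewrite -iterS iterSr g_beta.
Qed.

(** By the dihedral relation both involutions permute the [g]-orbit of a fixed point of [beta], so a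
    path starting there never leaves it. *)
Lemma dihedral_orbit u v : beta u = u -> connect e u v -> fconnect g u v.
Proof.
move=> bu /connectP[p]; elim/last_ind: p v => [|p w IH] v /=.
  by move=> _ ->; apply: connect0.
rewrite rcons_path last_rcons => /andP[ep ew] ->.
have {IH} := IH _ ep erefl; set z := last _ _ in ew *.
move=> /iter_findex; set k := findex _ _ _ => zE.
have bz : fconnect g u (beta z).
  rewrite fconnect_sym //; have := fconnect_iter g k (beta z).
  by have -> : iter k g (beta z) = u by rewrite -zE iter_dihedral.
case/orP: ew => /eqP-> //.
have -> : alpha z = beta (g z) by rewrite /g /= betaK.
rewrite fconnect_sym //; have := fconnect_iter g k.+1 (beta (g z)).
by have -> : iter k.+1 g (beta (g z)) = u by rewrite -zE -iterS iter_dihedral.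
Qed.

Lemma dihedral_iter u k : connect e u (iter k g u).
Proof.
elim: k => [|k IH] /=; first exact: connect0.
apply: connect_trans IH _; apply: (@connect_trans _ _ (alpha (iter k g u))).
  by apply: connect1; rewrite /e eqxx.
by apply: connect1; rewrite /e eqxx orbT.
Qed.

(* The component of a fixed point [u] of [beta] is its [g]-orbit; it has even
   cardinality 2k since [alpha] has no fixed point, and [iter k g u] is its only
   other fixed point of [beta]. *)
Lemma dihedral_other_end u : beta u = u ->
  exists v, [/\ v != u, beta v = v, connect e u v &
    forall w, w != u -> beta w = w -> connect e u w -> w = v].
Proof.
move=> bu; set n := fingraph.order g u.
have iter0 k : 0 < k < n -> iter k g u != u.
  case/andP=> k0 kn; apply/eqP=> ku; have := findex_iter kn.
  by rewrite ku findex0 => k0'; rewrite -k0' in k0.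
have n0 : 0 < n by apply: fingraph.order_gt0.
have gn : iter n g u = u by apply: iter_order.
have inj_iter k : injective (iter k g).
  by elim: k => //= k IH a b /g_inj /IH.
have even_n : ~~ odd n.
  apply/negP=> on; have := odd_double_half n; rewrite on add1n.
  set k := n./2 => nE; set w := iter k g u.
  have aw : alpha w = beta (g w) by rewrite /g /= betaK.
  have h1 : iter k.+1 g (alpha w) = u.
    by rewrite aw -/w -iterS iter_dihedral.
  have h2 : iter k.+1 g w = u by rewrite /w -iterD addSn addnn nE.
  have : alpha w = w by apply: (inj_iter k.+1); rewrite h1 h2.
  by move/eqP; rewrite (negPf (alphaN _)).
have nE : n./2 + n./2 = n by rewrite addnn even_halfK.
have h0 : 0 < n./2 < n by lia.
exists (iter n./2 g u); split.
- exact: iter0.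
- by apply: (inj_iter n./2); rewrite iter_dihedral // -iterD nE gn.
- exact: dihedral_iter.
move=> w wu bw /(dihedral_orbit bu) uw.
have := findex_max uw; have := iter_findex uw; rewrite -/n.
set k := findex _ _ _ => wE kn.
have k0 : 0 < k by rewrite lt0n; apply: contraNneq wu => k0; rewrite -wE k0.
have : iter (k + k) g u = u by rewrite iterD wE -{1}bw -wE iter_dihedral.
case: (ltngtP (k + k) n) => [lt|gt|<-].
- by move/eqP; rewrite (negPf (iter0 _ _)) //; lia.
- have -> : k + k = (k + k - n) + n by lia.
  rewrite iterD gn => /eqP; rewrite (negPf (iter0 _ _)) //; lia.
- by rewrite addnn doubleK wE.
Qed.

End Dihedral.

(** * Counting unions of components *)

Section CountClosed.
Variables (T : finType) (e : rel T).
Hypothesis e_sym : symmetric e.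

Lemma connect_closed_set (A : {set T}) u v :
  (forall x y, e x y -> (x \in A) = (y \in A)) -> connect e u v ->
  (u \in A) = (v \in A).
Proof. by move=> clA /(closed_connect clA). Qed.

(** A closed set is a union of components, hence determined by the roots it contains, and any set of
    roots of [a] occurs. Applied to colourings, this turns a number of loops into a power of two. *)
Lemma card_closed_sets (a : pred T) :
  (forall x y, e x y -> a x = a y) ->
  #|[set A : {set T} | [forall x, (x \in A) ==> a x] &&
       [forall x, forall y, e x y ==> ((x \in A) == (y \in A))]]|
    = 2 ^ n_comp e a.
Proof.
move=> cl_a; have sym := sym_connect_sym e_sym.
set S := [set A | _]; set R := [set r | roots e r & a r].
have -> : n_comp e a = #|R|.
  by apply: eq_card => r; rewrite !inE.
have SP A : A \in S -> (forall x, x \in A -> a x) /\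
    (forall x y, connect e x y -> (x \in A) = (y \in A)).
  rewrite inE => /andP[/forallP sA /forallP cA]; split=> [x|x y].
    exact/implyP.
  apply: connect_closed_set => u v uv.
  by have /forallP/(_ v)/implyP/(_ uv)/eqP := cA u.
rewrite -card_powerset -(@card_in_imset _ _ (fun A => A :&: R)); last first.
  move=> A B /SP[sA cA] /SP[sB cB] /setP eAB; apply/setP=> x.
  rewrite (cA _ _ (connect_root e x)) (cB _ _ (connect_root e x)).
  have := eAB (fingraph.root e x); rewrite !inE roots_root //=.
  case ar: (a (fingraph.root e x)); first by rewrite !andbT.
  move=> _; transitivity false.
    by apply: contraFF ar => /sA.
  by apply/esym; apply: contraFF ar => /sB.
apply: eq_card => B; rewrite powersetE; apply/imsetP/idP => [[A _ ->]|sBR].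
  exact: subsetIr.
exists [set x | fingraph.root e x \in B].
  rewrite inE; apply/andP; split.
    apply/forallP=> x; apply/implyP; rewrite inE => /(subsetP sBR).
    rewrite inE => /andP[_ ar].
    by rewrite -[a x]/(x \in a) (closed_connect cl_a (connect_root e x)).
  apply/forallP=> x; apply/forallP=> y; apply/implyP=> exy; rewrite !inE.
  by rewrite (fingraph.rootP sym (connect1 exy)).
apply/setP=> x; rewrite !inE; apply/idP/idP.
  move=> xB; have := subsetP sBR _ xB; rewrite inE => /andP[rx ax].
  by rewrite (eqP rx) xB rx ax.
by case/andP=> xB /andP[/eqP rx _]; rewrite -rx.
Qed.

End CountClosed.

(** * Planarity tested by words in a group *)

Section PlanarWords.
Variable gT : finGroupType.
Local Open Scope group_scope.

(** An interval stable under the matching [f] splits at the partner of its first point into two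
    shorter stable intervals; once the letters between the two partners have product 1, the two
    equal letters cancel. *)
Lemma prod_noncrossing (N : nat) (f : nat -> nat) (c : nat -> gT) :
  (forall s, (s < N)%N ->
     [/\ (f s < N)%N, f (f s) = s, f s <> s, c (f s) = c s & c s * c s = 1]) ->
  (forall s t, s < t -> t < f s -> f s < f t -> t < N -> False)%N ->
  \prod_(0 <= s < N) c s = 1.
Proof.
move=> fP ncr.
suff closed_prod u v : (u <= v <= N)%N ->
    (forall s, u <= s < v -> u <= f s < v)%N -> \prod_(u <= s < v) c s = 1.
  apply: closed_prod; first by rewrite leqnn.
  by move=> s /andP[_ /fP[]].
move: {2}(v - u)%N (leqnn (v - u)%N) => k; elim: k u v => [|k IH] u v dk.
  by move=> ? _; rewrite big_geq //; lia.
case/andP=> uv vN cl; case: (ltnP u v) => [lt_uv|]; last first.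
  by move=> ?; rewrite big_geq.
have uN : (u < N)%N by lia.
have [wN fw fne cw cc] := fP _ uN; have /cl : (u <= u < v)%N by lia.
set w := f u in wN fw fne cw * => /andP[uw wv].
have lt_uw : (u < w)%N by lia.
rewrite big_ltn // (big_cat_nat (n:=w)) /=; [|lia|lia].
have in1 s : (u.+1 <= s < w -> u.+1 <= f s < w)%N.
  move=> sP; have /cl/andP[fs1 fs2] : (u <= s < v)%N by lia.
  have [_ ffs fss _ _] := fP s ltac:(lia).
  have ne1 : f s <> u by move=> h; move: ffs; rewrite h -/w; lia.
  have ne2 : f s <> w by move=> h; move: ffs; rewrite h fw; lia.
  case: (ltngtP (f s) w) => h; try lia.
  by case: (ncr u s) => //; try lia; rewrite -/w; lia.
have in2 s : (w.+1 <= s < v -> w.+1 <= f s < v)%N.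
  move=> sP; have /cl/andP[fs1 fs2] : (u <= s < v)%N by lia.
  have [_ ffs fss _ _] := fP s ltac:(lia).
  have ne1 : f s <> u by move=> h; move: ffs; rewrite h -/w; lia.
  have ne2 : f s <> w by move=> h; move: ffs; rewrite h fw; lia.
  case: (ltngtP (f s) w) => h; try lia.
  by case: (ncr u (f s)) => //; rewrite ?ffs -/w; lia.
by rewrite (big_ltn wv) !IH ?mul1g ?mulg1 ?cw //; lia.
Qed.

End PlanarWords.

Section Words.
Variable gT : finGroupType.
Local Open Scope group_scope.

Lemma prod_rev_ord n (x : 'I_n -> gT) : (forall b, x b * x b = 1) ->
  (\prod_(b < n) x (rev_ord b)) * \prod_(b < n) x b = 1.
Proof.
elim: n x => [|n IH] x xx; first by rewrite !big_ord0 mul1g.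
rewrite big_ord_recl [X in _ * X]big_ord_recr /=.
have -> : rev_ord (@ord0 n) = ord_max by apply: val_inj; rewrite /= subn1.
rewrite -mulgA (mulgA (\prod_(i < n) x (rev_ord _))).
have -> : \prod_(i < n) x (rev_ord (lift ord0 i)) =
    \prod_(i < n) x (widen_ord (leqnSn n) (rev_ord i)).
  by apply: eq_bigr => i _; congr x; apply: val_inj; rewrite /= /bump add1n subSS.
by rewrite (IH (fun i => x (widen_ord (leqnSn n) i))) // mul1g.
Qed.

Definition unpos m n (s : 'I_(m + n)) : pt m n :=
  match split s with inl a => inl a | inr b => inr (rev_ord b) end.

Lemma pos_ltn m n (p : pt m n) : (pos p < m + n)%N.
Proof. by case: p => a /=; have := ltn_ord a; lia. Qed.

Lemma unposK m n (s : 'I_(m + n)) : pos (unpos s) = s.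
Proof.
by rewrite /unpos; case: splitP => [a ->|b ->] //=; have := ltn_ord b; lia.
Qed.

Lemma pos_inj m n : injective (@pos m n).
Proof.
move=> [a|a] [b|b] /=; have := ltn_ord a; have := ltn_ord b => *;
  try lia; congr (_ _); apply: val_inj => /=; lia.
Qed.

Lemma posK m n (p : pt m n) : unpos (Ordinal (pos_ltn p)) = p.
Proof. by apply: pos_inj; rewrite unposK. Qed.

Definition at_pos T m n (x0 : T) (c : pt m n -> T) (s : nat) : T :=
  if insub s is Some s' then c (unpos s') else x0.

Lemma at_posE T m n (x0 : T) (c : pt m n -> T) p : at_pos x0 c (pos p) = c p.
Proof. by rewrite /at_pos insubT ?pos_ltn // => lt; rewrite -{2}(posK p); congr (c (unpos _)); apply: val_inj. Qed.

Lemma prod_at_pos m n (c : pt m n -> gT) :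
  \prod_(0 <= s < m + n) at_pos 1 c s =
  (\prod_(a < m) c (inl a)) * \prod_(b < n) c (inr (rev_ord b)).
Proof.
rewrite big_mkord big_split_ord /=; congr (_ * _); apply: eq_bigr => a _.
  by rewrite -[RHS](at_posE 1).
by rewrite -[RHS](at_posE 1) /=; congr at_pos; have := ltn_ord a; lia.
Qed.

(** The boundary runs through the top from right to left. Reversing a product of involutions inverts
    it, so a trivial boundary word means that the bottom word and the top word have the same
    product. *)
Lemma prod_at_pos1 m n (c : pt m n -> gT) : (forall p, c p * c p = 1) ->
  \prod_(0 <= s < m + n) at_pos 1 c s = 1 <->
  \prod_(a < m) c (inl a) = \prod_(b < n) c (inr b).
Proof.
move=> cc; rewrite prod_at_pos.
have := @prod_rev_ord n (fun b => c (inr b)) (fun b => cc _).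
move/eqP; rewrite -eq_invg_mul => /eqP <-; split=> [/eqP|->]; last exact: mulVg.
by rewrite -eq_invg_mul => /eqP <-; rewrite invgK.
Qed.

Lemma prod_nat_first u v s (c : nat -> gT) : (u <= s < v)%N ->
  (forall t, (u <= t < s)%N -> c t = 1) ->
  \prod_(u <= t < v) c t = c s * \prod_(s.+1 <= t < v) c t.
Proof.
case/andP=> us sv c1; rewrite (big_cat_nat (n:=s)) //=; last exact: ltnW.
by rewrite big_nat big1 // mul1g big_ltn.
Qed.

End Words.

(** Two non-commuting involutions: a crossing of arcs coloured by them reads abab along the
    boundary, which is not trivial. *)
Definition S3a : 'S_3 := tperm (inord 0) (inord 1).
Definition S3b : 'S_3 := tperm (inord 1) (inord 2).

Lemma S3ab : (S3a * S3b * S3a * S3b != 1)%g.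
Proof.
have ne (a b : nat) : (a < 3)%N -> (b < 3)%N -> a != b ->
    (inord a : 'I_3) != inord b.
  by move=> a3 b3; rewrite -val_eqE /= !inordK.
apply/eqP=> /permP/(_ (inord 0)); rewrite !permM perm1 /S3a /S3b.
rewrite tpermL tpermL [tperm (inord 0) _ _]tpermD ?ne // tpermR.
by move/eqP; rewrite (negPf (ne 1 0 _ _ _)).
Qed.

(** The non-crossing condition in a form that composes: for stacked diagrams the equalities of
    bottom and top products are simply chained along the common line. *)
Definition planar m n (d : pt m n -> pt m n) : Prop :=
  forall c : pt m n -> 'S_3, (forall p, c p * c p = 1)%g ->
    (forall p, c (d p) = c p) ->
    (\prod_(a < m) c (inl a) = \prod_(b < n) c (inr b))%g.

Section Crossingless.
Variables (m n : nat) (d : {ffun pt m n -> pt m n}).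

Lemma crossinglessP :
  reflect [/\ involutive d, forall p, d p != p &
             forall p q, (pos p < pos q)%N -> (pos q < pos (d p))%N ->
               (pos (d p) < pos (d q))%N -> False] (crossingless d).
Proof.
apply: (iffP and3P) => [[/forallP dd /forallP dN /forallP nc]|[dd dN nc]].
  split=> // p; first exact/eqP.
  by move=> q h1 h2 h3; have /forallP/(_ q) := nc p; rewrite h1 h2 h3.
split; apply/forallP => p //; first exact/eqP.
by apply/forallP => q; apply/negP => /and3P[]; exact: nc.
Qed.

Lemma crossingless_planar : crossingless d -> planar d.
Proof.
case/crossinglessP=> dd dN nc c cc cd; apply/prod_at_pos1 => //.
apply: (@prod_noncrossing _ _ (at_pos 0 (fun p => pos (d p)))).
  move=> s sN; rewrite -[s]/(nat_of_ord (Ordinal sN)) -unposK.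
  move: (unpos _) => p; rewrite !at_posE dd; split=> //.
  - exact: pos_ltn.
  - by move/pos_inj/eqP; rewrite (negPf (dN p)).
move=> s t st; case: (ltnP t (m + n)) => // tN.
have sN := ltn_trans st tN.
move: st; rewrite -[t]/(nat_of_ord (Ordinal tN)) -unposK.
rewrite -[s]/(nat_of_ord (Ordinal sN)) -unposK !at_posE.
by move=> h1 h2 h3 _; apply: nc h1 h2 h3.
Qed.

(** If the arcs of [p] and [q] crossed, colouring them by [S3a] and [S3b] and all other points
    trivially would give the boundary word abab. *)
Lemma planar_crossingless : involutive d -> (forall p, d p != p) ->
  planar d -> crossingless d.
Proof.
move=> dd dN pl; apply/crossinglessP; split=> // p q pq qdp dpdq.
pose c r := if (r == p) || (r == d p) then S3a
            else if (r == q) || (r == d q) then S3b else 1%g.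
have cc r : (c r * c r = 1)%g.
  by rewrite /c; case: ifP => _; [|case: ifP => _]; rewrite ?tperm2 ?mulg1.
have cd r : c (d r) = c r.
  have E x : (d r == x) || (d r == d x) = (r == x) || (r == d x).
    by rewrite (inj_eq (inv_inj dd)) -{1}[x]dd (inj_eq (inv_inj dd)) orbC.
  by rewrite /c !E.
have := pl c cc cd; rewrite -prod_at_pos1 // => {pl cd}.
have c1 s : (s < m + n)%N -> s <> pos p -> s <> pos (d p) -> s <> pos q ->
    s <> pos (d q) -> at_pos 1%g c s = 1%g.
  move=> sN; rewrite -[s]/(nat_of_ord (Ordinal sN)) -unposK at_posE /c.
  move: (unpos _) => r h1 h2 h3 h4.
  case: (r =P p) => [e|_]; first by case: h1; rewrite e.
  case: (r =P d p) => [e|_]; first by case: h2; rewrite e.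
  case: (r =P q) => [e|_]; first by case: h3; rewrite e.
  by case: (r =P d q) => [e|_]; first by case: h4; rewrite e.
have l1 := pos_ltn (d q).
rewrite (@prod_nat_first _ _ _ (pos p)); first last.
- by move=> t tP; apply: c1; lia.
- lia.
rewrite (@prod_nat_first _ _ _ (pos q)); first last.
- by move=> t tP; apply: c1; lia.
- lia.
rewrite (@prod_nat_first _ _ _ (pos (d p))); first last.
- by move=> t tP; apply: c1; lia.
- lia.
rewrite (@prod_nat_first _ _ _ (pos (d q))); first last.
- by move=> t tP; apply: c1; lia.
- lia.
rewrite big_nat big1 ?mulg1; last first.
  by move=> t tP; apply: c1; lia.
rewrite !at_posE /c !eqxx !orbT /=.
have -> : (q == p) = false by apply/eqP => h; move: pq; rewrite h; lia.
have -> : (q == d p) = false by apply/eqP => h; move: qdp; rewrite h; lia.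
have -> : (d q == p) = false by apply/eqP => h; move: qdp dpdq; rewrite h; lia.
have -> : (d q == d p) = false by apply/eqP => h; move: dpdq; rewrite h; lia.
by rewrite /= !mulgA => /eqP; rewrite (negPf S3ab).
Qed.

End Crossingless.

Section Diagram.
Variables (m n : nat) (d : diagram m n).

Lemma partnerK : involutive (partner d).
Proof. by case/crossinglessP: (valP d) => dd _ _; apply: dd. Qed.

Lemma partnerN p : partner d p != p.
Proof. by case/crossinglessP: (valP d) => _ dN _; apply: dN. Qed.

Lemma partner_noncrossing p q : pos p < pos q -> pos q < pos (partner d p) ->
  pos (partner d p) < pos (partner d q) -> False.
Proof. by case/crossinglessP: (valP d) => _ _; apply. Qed.

Lemma partner_planar : planar (partner d).
Proof. exact: crossingless_planar (valP d). Qed.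

End Diagram.

Lemma diagram_eqP m n (d d' : diagram m n) : partner d =1 partner d' -> d = d'.
Proof. by move=> e; apply/val_inj/ffunP. Qed.

Section MkDiagram.
Variables (m n : nat) (f : pt m n -> pt m n).
Hypotheses (fK : involutive f) (fN : forall p, f p != p) (fP : planar f).

Lemma finfun_crossingless : crossingless [ffun p => f p].
Proof.
apply: planar_crossingless => [p|p|c cc cf]; rewrite ?ffunE //.
by apply: fP => // p; rewrite -[RHS]cf ffunE.
Qed.

Definition mkdiagram : diagram m n := Sub _ finfun_crossingless.

Lemma partner_mk : partner mkdiagram =1 f.
Proof. by move=> p; rewrite /partner ffunE. Qed.

End MkDiagram.

(** * Composition of diagrams *)

Section Compose.
Variables (l m n : nat) (x : diagram m n) (y : diagram l m).
Let V : finType := (pt m n + pt l m)%type.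

(** The stacked graph is the union of two involutions: following an arc, which fixes no point, and
    crossing the glued line ([glue_flip]), which fixes exactly the outer points. The composite
    matches the two ends of each path component. *)
Definition arcs_flip (u : V) : V :=
  match u with inl p => inl (partner x p) | inr p => inr (partner y p) end.

Definition glue_flip (u : V) : V :=
  match u with
  | inl (inl a) => inr (inr a) | inr (inr a) => inl (inl a) | _ => u
  end.

Lemma arcs_flipK : involutive arcs_flip.
Proof. by case=> p /=; rewrite partnerK. Qed.

Lemma arcs_flipN u : arcs_flip u != u.
Proof.
by case: u => p; apply/eqP => -[]; apply/eqP; apply: partnerN.
Qed.

Lemma glue_flipK : involutive glue_flip.
Proof. by case=> [[]|[]]. Qed.

Let e : rel V := fun u v => (v == arcs_flip u) || (v == glue_flip u).

Lemma stack_sym : symmetric (stack x y).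
Proof.
have E (U : eqType) (f : U -> U) p q : involutive f -> (q == f p) = (p == f q).
  by move=> fK; rewrite -(inj_eq (inv_inj fK)) fK eq_sym.
by case=> [[a|a]|[a|a]] [[b|b]|[b|b]] //=; apply: E; apply: partnerK.
Qed.

Lemma stack_arcl p : stack x y (inl p) (inl (partner x p)).
Proof. by case: p => a /=. Qed.
Lemma stack_arcr p : stack x y (inr p) (inr (partner y p)).
Proof. by case: p => a /=. Qed.
Lemma stack_glue a : stack x y (inl (inl a)) (inr (inr a)).
Proof. by rewrite /=. Qed.

Lemma stack_connect : connect (stack x y) =2 connect e.
Proof.
move=> u v; apply/idP/idP; apply: connect_sub => {u v} u v.
  move=> h; apply: connect1; move: h; rewrite /e.
  by case: u v => [[a|a]|[a|a]] [[b|b]|[b|b]] //= /eqP->; rewrite eqxx ?orbT.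
case/orP=> /eqP->; first by apply: connect1; case: u => -[a|a] /=; rewrite eqxx.
by case: u => [[a|a]|[a|a]] /=; try exact: connect0; apply: connect1;
  rewrite /= eqxx.
Qed.

Lemma glue_outer (p : pt l n) : glue_flip (outer m p) = outer m p.
Proof. by case: p. Qed.

Lemma glue_outerP u : glue_flip u = u -> exists p, u = outer m p.
Proof.
case: u => [[a|a]|[a|a]] // _; first by exists (inr a).
by exists (inl a).
Qed.

Lemma outer_inj : injective (@outer l m n).
Proof. by move=> [a|a] [b|b] //= -[->]. Qed.

Lemma other_end (p : pt l n) : exists q, [/\ q != p,
  connect (stack x y) (outer m p) (outer m q) &
  forall r, r != p -> connect (stack x y) (outer m p) (outer m r) -> r = q].
Proof.
have [v [vp /glue_outerP[q vq] pv uniq_v]] :=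
  dihedral_other_end arcs_flipK glue_flipK arcs_flipN (glue_outer p).
subst v; exists q; split.
- by move: vp; rewrite (inj_eq outer_inj).
- by rewrite stack_connect.
move=> r rp pr; apply/outer_inj/uniq_v; rewrite ?glue_outer ?(inj_eq outer_inj) //.
by rewrite -stack_connect.
Qed.

Definition comp_partner (p : pt l n) : pt l n :=
  odflt p [pick q | (q != p) && connect (stack x y) (outer m p) (outer m q)].

Lemma comp_partnerP p q :
  (comp_partner p == q) =
  (p != q) && connect (stack x y) (outer m p) (outer m q).
Proof.
rewrite /comp_partner; have [q0 [q0p pq0 uq0]] := other_end p.
case: pickP => [q1 /andP[q1p pq1]|/(_ q0)]; last by rewrite q0p pq0.
rewrite /= (uq0 _ q1p pq1) [p == q]eq_sym; apply/eqP/andP => [<- //|[qp pq]].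
by rewrite (uq0 _ qp pq).
Qed.

Lemma comp_partnerN p : comp_partner p != p.
Proof. by rewrite comp_partnerP eqxx. Qed.

Lemma comp_partner_connect p :
  connect (stack x y) (outer m p) (outer m (comp_partner p)).
Proof. by have := eqxx (comp_partner p); rewrite comp_partnerP => /andP[]. Qed.

Lemma comp_partnerK : involutive comp_partner.
Proof.
move=> p; apply/eqP; rewrite comp_partnerP comp_partnerN /=.
by rewrite (sym_connect_sym stack_sym) comp_partner_connect.
Qed.

Section Colouring.
Variables (C : Type) (cx : pt m n -> C) (cy : pt l m -> C).
Hypotheses (cxP : forall p, cx (partner x p) = cx p).
Hypotheses (cyP : forall p, cy (partner y p) = cy p).
Hypothesis cxy : forall a, cx (inl a) = cy (inr a).

Definition stack_colour (u : V) : C := match u with inl p => cx p | inr p => cy p end.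

Lemma stack_colour_connect u v :
  connect (stack x y) u v -> stack_colour u = stack_colour v.
Proof.
case/connectP=> p + ->; elim: p u => //= w p IH u /andP[uw /IH <-].
case: u w uw => [[a|a]|[a|a]] [[b|b]|[b|b]] //= /eqP ->;
  by rewrite /= ?cxP ?cyP ?cxy.
Qed.

End Colouring.

(* A colouring of the arcs of the composite by involutions, each closed loop
   being given the trivial colour, colours both diagrams. *)
Lemma comp_partner_planar : planar comp_partner.
Proof.
move=> c cc cd.
pose col (u : V) : 'S_3 :=
  if [pick p | connect (stack x y) u (outer m p)] is Some p then c p else 1%g.
have sym := sym_connect_sym stack_sym.
have col_conn u v : connect (stack x y) u v -> col u = col v.
  move=> uv; rewrite /col; case: pickP => [p up|nu].
    case: pickP => [q vq|/(_ p)]; last by rewrite -(same_connect sym uv) up.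
    case: (altP (p =P q)) => [-> //|pq].
    rewrite -(cd p); congr c; apply/eqP; rewrite comp_partnerP pq /=.
    by rewrite -(same_connect sym up) (same_connect sym uv).
  by case: pickP => // q vq; have := nu q; rewrite (same_connect sym uv) vq.
have col_outer p : col (outer m p) = c p.
  rewrite /col; case: pickP => [q pq|/(_ p)]; last by rewrite connect0.
  case: (altP (p =P q)) => [-> //|pq'].
  by rewrite -(cd p); congr c; apply/esym/eqP; rewrite comp_partnerP pq'.
have colcol u : (col u * col u = 1)%g.
  by rewrite /col; case: pickP => [p _|_]; rewrite ?cc ?mulg1.
have px : (\prod_(a < m) col (inl (inl a)) = \prod_(b < n) col (inl (inr b)))%g.
  apply: (@partner_planar _ _ x (fun p => col (inl p))) => // p.
  by apply/col_conn; rewrite sym; apply/connect1/stack_arcl.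
have py : (\prod_(a < l) col (inr (inl a)) = \prod_(b < m) col (inr (inr b)))%g.
  apply: (@partner_planar _ _ y (fun p => col (inr p))) => // p.
  by apply/col_conn; rewrite sym; apply/connect1/stack_arcr.
transitivity (\prod_(a < l) col (inr (inl a)))%g.
  by apply: eq_bigr => a _; rewrite -col_outer.
rewrite py; transitivity (\prod_(b < n) col (inl (inr b)))%g.
  by rewrite -px; apply: eq_bigr => a _; apply/col_conn/connect1/stack_glue.
by apply: eq_bigr => a _; rewrite -col_outer.
Qed.

Definition comp : diagram l n :=
  mkdiagram comp_partnerK comp_partnerN comp_partner_planar.

Lemma partner_comp p q : (partner comp p == q) =
  (p != q) && connect (stack x y) (outer m p) (outer m q).
Proof. by rewrite partner_mk comp_partnerP. Qed.

Lemma stackedE d : stacked x y d = (d == comp).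
Proof.
apply/idP/eqP => [/forallP h|->].
  apply: diagram_eqP => p; apply/eqP.
  have /forallP/(_ (partner comp p))/eqP -> := h p.
  by rewrite -partner_comp.
by apply/forallP=> p; apply/forallP=> q; rewrite partner_comp.
Qed.

End Compose.

(** * Two-colourings *)

(* A diagram is recovered from the set of pairs of words colouring its marked
   points in such a way that all its arcs are monochromatic; composition becomes
   the multiplication of matrices indexed by words, each loop contributing a
   factor 2. *)

Definition colour m n (b t : seq bool) (p : pt m n) : bool :=
  match p with inl a => nth false b a | inr a => nth false t a end.

Definition sem m n (d : diagram m n) (b t : seq bool) : bool :=
  [&& size b == m, size t == n &
      [forall p, colour b t (partner d p) == colour b t p]].

Lemma semP m n (d : diagram m n) b t :
  reflect [/\ size b = m, size t = n &
             forall p, colour b t (partner d p) = colour b t p] (sem d b t).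
Proof.
apply: (iffP and3P) => [[/eqP ? /eqP ? /forallP h]|[-> -> h]].
  by split=> // p; apply/eqP.
by split=> //; apply/forallP=> p; apply/eqP.
Qed.

Fixpoint words n : seq (seq bool) :=
  if n is n'.+1 then map (cons false) (words n') ++ map (cons true) (words n')
  else [:: [::]].

Lemma mem_words n w : (w \in words n) = (size w == n).
Proof.
elim: n w => [|n IH] w /=; first by rewrite inE; case: w.
rewrite mem_cat; case: w => [|b w].
  by apply/negbTE; rewrite negb_or; apply/andP; split; apply/mapP => -[].
rewrite /= eqSS -IH; apply/orP/idP => [[] /mapP[v v_in [_ ->]] //|w_in].
by case: b; [right|left]; apply/mapP; exists w.
Qed.

Lemma uniq_words n : uniq (words n).
Proof.
elim: n => //= n IH; have cons_inj (b : bool) : injective (cons b) by move=> u v [].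
rewrite cat_uniq !(map_inj_uniq (cons_inj _)) IH andbT /=.
by apply/hasPn => _ /mapP[w _ ->]; apply/mapP => -[].
Qed.

Lemma words_tuple m : perm_eq (words m) (map val (enum {: m.-tuple bool})).
Proof.
apply: uniq_perm (uniq_words m) _ _.
  by rewrite (map_inj_uniq val_inj) enum_uniq.
move=> w; rewrite mem_words; apply/eqP/mapP => [sw|[t _ ->]]; last exact: size_tuple.
by exists (tcast sw (in_tuple w)); rewrite ?mem_enum //= val_tcast.
Qed.

Lemma sum_words m (F : seq bool -> nat) :
  \sum_(w <- words m) F w = \sum_(t : m.-tuple bool) F (val t).
Proof. by rewrite (perm_big _ (words_tuple m)) big_map big_enum. Qed.

Lemma sum_words_cat m n (F : seq bool -> nat) :
  \sum_(w <- words (m + n)) F w =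
   \sum_(u <- words m) \sum_(v <- words n) F (u ++ v).
Proof.
elim: m F => [|m IH] F; first by rewrite big_seq1.
by rewrite addSn /= !big_cat !big_map /= !IH.
Qed.

Lemma sum_words1 n (F : seq bool -> nat) w : size w = n ->
  (forall v, size v = n -> v <> w -> F v = 0) ->
  \sum_(v <- words n) F v = F w.
Proof.
move=> sw F0; rewrite (bigD1_seq w) ?uniq_words ?mem_words ?sw //=.
rewrite big_seq_cond big1 ?addn0 // => v; rewrite mem_words.
by case/andP=> /eqP sv /eqP; apply: F0.
Qed.

Section SemComp.
Variables (l m n : nat) (x : diagram m n) (y : diagram l m) (b t : seq bool).
Let V : finType := (pt m n + pt l m)%type.

Let vcol c (u : V) : bool :=
  match u with inl p => colour c t p | inr p => colour b c p end.

Let vcol_connect c u v : sem y b c -> sem x c t ->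
  connect (stack x y) u v -> vcol c u = vcol c v.
Proof.
move=> /semP[_ _ cy] /semP[_ _ cx].
exact: (stack_colour_connect (cx := colour c t) (cy := colour b c)).
Qed.

Let vcol_outer c p : vcol c (outer m p) = colour b t p.
Proof. by case: p. Qed.

Lemma sem_comp0 c : sem y b c -> sem x c t -> sem (comp x y) b t.
Proof.
move=> yc xc; case/semP: (yc) => sb _ _; case/semP: (xc) => _ st _.
apply/semP; split=> // p; rewrite -!(vcol_outer c).
apply: vcol_connect => //; rewrite (sym_connect_sym (stack_sym x y)).
by have := eqxx (partner (comp x y) p); rewrite partner_comp => /andP[].
Qed.

Let a : pred V := [pred u | ~~ [exists p : pt l n, connect (stack x y) u (outer m p)]].

Let S := [set A : {set V} | [forall x, (x \in A) ==> a x] &&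
       [forall u, forall v, stack x y u v ==> ((u \in A) == (v \in A))]].

Let cls c : {set V} := [set u | a u && vcol c u].

(** The boundary colours force the colour of every path component, so a compatible middle word is a
    free choice of one colour per closed loop; [cls] records the loop vertices coloured true. *)
Lemma sem_comp : \sum_(c <- words m) (sem y b c && sem x c t) =
  sem (comp x y) b t * 2 ^ loops x y.
Proof.
case: (boolP (sem (comp x y) b t)) => [d_bt|d_bt]; last first.
  rewrite big1 // => c _; apply/eqP; rewrite eqb0; apply: contra d_bt.
  by case/andP; apply: sem_comp0.
have sym := sym_connect_sym (stack_sym x y).
have a_conn u v : connect (stack x y) u v -> a u = a v.
  move=> uv; congr negb; apply: eq_existsb => p.
  by rewrite (same_connect sym uv).
rewrite mul1n /loops -(card_closed_sets (stack_sym x y)); last first.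
  by move=> u v uv; apply/a_conn/connect1.
rewrite -/S sum_words -big_mkcond /= sum1dep_card.
set W := [set c | _].
rewrite -(@card_in_imset _ _ (fun c : m.-tuple bool => cls c)); last first.
  move=> c c'; rewrite !inE => /andP[yc xc] /andP[yc' xc'] /setP ecc'.
  apply/eq_from_tnth => i.
  rewrite !(tnth_nth false) -[LHS]/(vcol c (inl (inl i))) -[RHS]/(vcol c' (inl (inl i))).
  have := ecc' (inl (inl i)); rewrite !inE.
  case: (boolP (a (inl (inl i)))) => [_ //|/negPn/existsP[p ip] _].
  by rewrite !(vcol_connect _ _ ip) // !vcol_outer.
apply: eq_card => A; apply/imsetP/idP => [[c cW ->]|AS].
  move: cW; rewrite !inE => /andP[yc xc]; apply/andP; split.
    by apply/forallP=> u; apply/implyP; rewrite inE => /andP[].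
  apply/forallP=> u; apply/forallP=> v; apply/implyP=> uv; rewrite !inE.
  by rewrite (a_conn _ _ (connect1 uv)) (vcol_connect yc xc (connect1 uv)).
move: AS; rewrite inE => /andP[/forallP Aa /forallP Ae].
have Aconn u v : connect (stack x y) u v -> (u \in A) = (v \in A).
  apply: connect_closed_set => u' v' uv; apply/eqP.
  by have /forallP/(_ v')/implyP/(_ uv) := Ae u'.
(* The colouring attached to a set [A] of loops: on a path component the colour of its ends, on a
   loop membership in [A]. *)
pose col u : bool := if [pick p | connect (stack x y) u (outer m p)] is Some p
  then colour b t p else u \in A.
case/semP: d_bt => sb st d_bt.
have col_conn u v : connect (stack x y) u v -> col u = col v.
  move=> uv; rewrite /col; case: pickP => [p up|nu].
    case: pickP => [q vq|/(_ p)]; last by rewrite -(same_connect sym uv) up.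
    case: (altP (p =P q)) => [-> //|pq].
    rewrite -(d_bt p); congr colour; apply/eqP; rewrite partner_comp pq /=.
    by rewrite -(same_connect sym up) (same_connect sym uv).
  case: pickP => [q vq|_]; last exact: Aconn.
  by have := nu q; rewrite (same_connect sym uv) vq.
have col_outer p : col (outer m p) = colour b t p.
  rewrite /col; case: pickP => [q pq|/(_ p)]; last by rewrite connect0.
  case: (altP (p =P q)) => [-> //|pq'].
  by rewrite -(d_bt p); congr colour; apply/esym/eqP; rewrite partner_comp pq'.
pose c := [tuple col (inl (inl i)) | i < m].
have cE (i : 'I_m) : nth false c i = col (inl (inl i)) by rewrite -tnth_nth tnth_mktuple.
have colE u : vcol c u = col u.
  case: u => [[i|i]|[i|i]]; rewrite [LHS]/=.
  - exact: cE.
  - exact: (esym (col_outer (inr i))).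
  - exact: (esym (col_outer (inl i))).
  - by rewrite cE; apply/col_conn/connect1/stack_glue.
exists c.
  rewrite inE; apply/andP; split; apply/semP; rewrite size_tuple; split=> // p.
    rewrite -![colour b c _]/(vcol c (inr _)) !colE.
    by apply: col_conn; rewrite sym; apply/connect1/stack_arcr.
  rewrite -![colour c t _]/(vcol c (inl _)) !colE.
  by apply: col_conn; rewrite sym; apply/connect1/stack_arcl.
apply/setP=> u; rewrite inE colE /col; case: pickP => [p up|nu].
  have -> : a u = false by apply/negbTE/negPn/existsP; exists p.
  by apply/negbTE/negP => /(implyP (Aa u)) /existsP; apply; exists p.
have -> // : a u by apply/existsP => -[p]; rewrite nu.
Qed.

End SemComp.

Definition word m (c : 'I_m -> bool) : seq bool := [tuple c a | a < m].

Lemma size_word m (c : 'I_m -> bool) : size (word c) = m.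
Proof. exact: size_tuple. Qed.

Lemma nth_word m (c : 'I_m -> bool) (a : 'I_m) : nth false (word c) a = c a.
Proof. by rewrite /word -tnth_nth tnth_mktuple. Qed.

Lemma colour_words m n (c : pt m n -> bool) p :
  colour (word (fun a => c (inl a))) (word (fun a => c (inr a))) p = c p.
Proof. by case: p => a; rewrite /= nth_word. Qed.

Lemma sem_words m n (d : diagram m n) (c : pt m n -> bool) :
  (forall p, c (partner d p) = c p) ->
  sem d (word (fun a => c (inl a))) (word (fun a => c (inr a))).
Proof.
move=> dc; apply/semP; split=> [||p]; rewrite ?size_word //.
by rewrite !colour_words.
Qed.

(** Tested on the colouring that separates the arc through [p] from all other points. *)
Lemma sem_arc m n (d : diagram m n) p q : p != q ->
  (forall b t, sem d b t -> colour b t p = colour b t q) -> partner d p = q.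
Proof.
move=> pq; pose c r := (r == p) || (r == partner d p).
have cd r : c (partner d r) = c r.
  by rewrite /c (inj_eq (inv_inj (partnerK d))) -{1}[p](partnerK d)
    (inj_eq (inv_inj (partnerK d))) orbC.
move/(_ _ _ (sem_words cd)); rewrite !colour_words /c eqxx /= eq_sym (negPf pq).
by move/esym/eqP.
Qed.

Lemma sem_inj m n (d d' : diagram m n) :
  (forall b t, sem d b t -> sem d' b t) -> d = d'.
Proof.
move=> dd'; apply: diagram_eqP => p; apply: sem_arc.
  by rewrite eq_sym partnerN.
by move=> b t /dd' /semP[_ _ ->].
Qed.

Lemma sem0 m n (d : diagram m n) : sem d (nseq m false) (nseq n false).
Proof.
apply/semP; rewrite !size_nseq; split=> // p.
by case: p (partner _ p) => [a|a] [b|b] /=; rewrite !nth_nseq !if_same.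
Qed.

(** The all-false colouring is compatible with every diagram, so at that entry the two powers of two
    can be compared. *)
Lemma sem_inj_expn m n (d d' : diagram m n) k k' :
  (forall b t, sem d b t * 2 ^ k = sem d' b t * 2 ^ k') -> d = d' /\ k = k'.
Proof.
move=> h; split.
  apply: sem_inj => b t db; have := h b t; rewrite db mul1n => hbt.
  by case: (sem d' b t) hbt => // /eqP; rewrite mul0n expn_eq0.
by have := h _ _; move/(_ (nseq m false) (nseq n false)); rewrite !sem0 !mul1n => /eqP;
  rewrite eqn_exp2l // => /eqP.
Qed.

(** The working tool for composites: one identity of 0/1 matrices yields the composite diagram and
    the number of loops at once. *)
Lemma comp_eqP l m n (x : diagram m n) (y : diagram l m) z k :
  (forall b t, \sum_(c <- words m) (sem y b c && sem x c t) = sem z b t * 2 ^ k) ->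
  comp x y = z /\ loops x y = k.
Proof. by move=> h; apply: sem_inj_expn => b t; rewrite -h -sem_comp. Qed.

(** Associativity of the matrix product: both sides count the pairs of intermediate words. *)
Lemma sem_compA k l m n (x : diagram m n) (y : diagram l m) (z : diagram k l) b t :
  \sum_(c <- words l) (sem z b c && sem (comp x y) c t) * 2 ^ loops x y =
  \sum_(c <- words m) (sem (comp y z) b c && sem x c t) * 2 ^ loops y z.
Proof.
transitivity (\sum_(c <- words l) \sum_(c' <- words m)
    sem z b c * sem y c c' * sem x c' t).
  apply: eq_bigr => c _; rewrite -mulnb -mulnA -sem_comp big_distrr /=.
  by apply: eq_bigr => c' _; rewrite -mulnb mulnA.
rewrite exchange_big; apply: eq_bigr => c' _.
rewrite -mulnb mulnAC -sem_comp big_distrl /=.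
by apply: eq_bigr => c _; rewrite -mulnb.
Qed.

Lemma compA k l m n (x : diagram m n) (y : diagram l m) (z : diagram k l) :
  comp (comp x y) z = comp x (comp y z) /\
  loops x y + loops (comp x y) z = loops y z + loops x (comp y z).
Proof.
apply: sem_inj_expn => b t; have := sem_compA x y z b t.
rewrite -!big_distrl /= !sem_comp -!mulnA -!expnD.
by rewrite [X in 2 ^ X]addnC [X in _ = _ * 2 ^ X]addnC.
Qed.

(** ** Identity, reflection, juxtaposition *)

Lemma flipK m n : cancel (@flip m n) (@flip n m).
Proof. by case. Qed.

Lemma flip_neq n (p : pt n n) : flip p != p.
Proof. by case: p. Qed.

Lemma flip_planar n : planar (@flip n n).
Proof. by move=> c cc cf; apply: eq_bigr => a _; rewrite -cf. Qed.

Definition did n : diagram n n := mkdiagram (@flipK n n) (@flip_neq n) (@flip_planar n).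

Lemma sem_did n b t : sem (did n) b t = (size b == n) && (b == t).
Proof.
apply/semP/andP => [[sb st h]|[/eqP sb /eqP <-]].
  rewrite sb; split=> //; apply/eqP/(@eq_from_nth _ false); rewrite sb // => i lt_i.
  by have := h (inr (Ordinal lt_i)); rewrite partner_mk.
by split=> // -[a|a]; rewrite partner_mk.
Qed.

Section DFlip.
Variables (m n : nat) (d : diagram m n).
Let f (p : pt n m) : pt n m := flip (partner d (flip p)).

Let fK : involutive f.
Proof. by move=> p; rewrite /f flipK partnerK flipK. Qed.
Let fN p : f p != p.
Proof.
apply/eqP => /(congr1 (@flip n m)); rewrite /f flipK; apply/eqP.
exact: partnerN.
Qed.
Let fP : planar f.
Proof.
move=> c cc cf; apply/esym.
apply: (@partner_planar _ _ d (fun p => c (flip p))) => // p.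
by rewrite -[RHS]cf /f flipK.
Qed.

Definition dflip : diagram n m := mkdiagram fK fN fP.

Lemma partner_dflip p : partner dflip (flip p) = flip (partner d p).
Proof. by rewrite partner_mk /f flipK. Qed.

Lemma sem_dflip b t : sem dflip b t = sem d t b.
Proof.
have cf u v (p : pt m n) : colour u v (flip p) = colour v u p by case: p.
apply/semP/semP=> -[sb st h]; split=> // p.
  by have := h (flip p); rewrite partner_dflip !cf.
by rewrite -[p]flipK partner_dflip !cf.
Qed.
End DFlip.

Section DTens.
Variables (m n m' n' : nat) (x : diagram m n) (y : diagram m' n').
Let f (p : pt (m + m') (n + n')) : pt (m + m') (n + n') :=
  match p with
  | inl a => match split a with inl a => ptl m' n' (partner x (inl a))
                              | inr a => ptr m n (partner y (inl a)) end
  | inr a => match split a with inl a => ptl m' n' (partner x (inr a))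
                              | inr a => ptr m n (partner y (inr a)) end
  end.

Let split_l k k' (a : 'I_k) : split (lshift k' a) = inl a.
Proof. exact: (unsplitK (inl a)). Qed.
Let split_r k k' (a : 'I_k') : split (rshift k a) = inr a.
Proof. exact: (unsplitK (inr a)). Qed.

Let fl p : f (ptl m' n' p) = ptl m' n' (partner x p).
Proof. by case: p => a /=; rewrite split_l. Qed.
Let fr p : f (ptr m n p) = ptr m n (partner y p).
Proof. by case: p => a /=; rewrite split_r. Qed.

Lemma pt_split (p : pt (m + m') (n + n')) :
  (exists q, p = ptl m' n' q) \/ (exists q, p = ptr m n q).
Proof.
case: p => a; rewrite -(splitK a); case: (split a) => b /=.
- by left; exists (inl b).
- by right; exists (inl b).
- by left; exists (inr b).
- by right; exists (inr b).
Qed.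

Lemma ptl_inj : injective (@ptl m n m' n').
Proof. by move=> [a|a] [b|b] //= [] /ord_inj ->. Qed.
Lemma ptr_inj : injective (@ptr m n m' n').
Proof. by move=> [a|a] [b|b] //= [] /addnI /ord_inj ->. Qed.

Let fK : involutive f.
Proof. by move=> p; case: (pt_split p) => -[q ->]; rewrite ?fl ?fr partnerK. Qed.
Let fN p : f p != p.
Proof.
by case: (pt_split p) => -[q ->]; rewrite ?fl ?fr;
   rewrite ?(inj_eq ptl_inj) ?(inj_eq ptr_inj) partnerN.
Qed.
Let fP : planar f.
Proof.
move=> c cc cf; rewrite !big_split_ord /=; congr (_ * _)%g.
  by apply: (@partner_planar _ _ x (fun p => c (ptl m' n' p))) => // p; rewrite -fl.
by apply: (@partner_planar _ _ y (fun p => c (ptr m n p))) => // p; rewrite -fr.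
Qed.

Definition dtens : diagram (m + m') (n + n') := mkdiagram fK fN fP.

Lemma partner_dtensl p : partner dtens (ptl m' n' p) = ptl m' n' (partner x p).
Proof. by rewrite partner_mk fl. Qed.
Lemma partner_dtensr p : partner dtens (ptr m n p) = ptr m n (partner y p).
Proof. by rewrite partner_mk fr. Qed.

Lemma juxtaposedE d : juxtaposed x y d = (d == dtens).
Proof.
apply/andP/eqP => [[/forallP h1 /forallP h2]|->].
  apply: diagram_eqP => p; case: (pt_split p) => -[q ->].
    by rewrite partner_dtensl; apply/eqP.
  by rewrite partner_dtensr; apply/eqP.
by split; apply/forallP=> p; rewrite ?partner_dtensl ?partner_dtensr.
Qed.

Lemma sem_dtens_cat b b' t t' : size b = m -> size t = n ->
  sem dtens (b ++ b') (t ++ t') = sem x b t && sem y b' t'.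
Proof.
move=> sb st.
have cl (p : pt m n) : colour (b ++ b') (t ++ t') (ptl m' n' p) = colour b t p.
  by case: p => a /=; rewrite nth_cat ?sb ?st ltn_ord.
have cr (p : pt m' n') : colour (b ++ b') (t ++ t') (ptr m n p) = colour b' t' p.
  by case: p => a /=; rewrite nth_cat ?sb ?st ltnNge leq_addr /= addKn.
apply/semP/andP => [[]|[/semP[_ _ hx] /semP[sb' st' hy]]].
  rewrite !size_cat sb st => /addnI sb' /addnI st' h.
  split; apply/semP; split=> // p.
    by have := h (ptl m' n' p); rewrite partner_dtensl !cl.
  by have := h (ptr m n p); rewrite partner_dtensr !cr.
rewrite !size_cat sb st sb' st'; split=> // p.
by case: (pt_split p) => -[q ->]; rewrite ?partner_dtensl ?partner_dtensr ?cl ?cr.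
Qed.

Lemma sem_dtens b t : sem dtens b t =
  sem x (take m b) (take n t) && sem y (drop m b) (drop n t).
Proof.
case: (ltnP (size b) m) => [lt_b|le_b].
  apply/idP/idP => [/semP[sb _ _]|/andP[/semP[+ _ _] _]]; first by lia.
  by rewrite size_take ltnNge (ltnW lt_b) /= => sb; rewrite sb ltnn in lt_b.
case: (ltnP (size t) n) => [lt_t|le_t].
  apply/idP/idP => [/semP[_ st _]|/andP[/semP[_ + _] _]]; first by lia.
  by rewrite size_take ltnNge (ltnW lt_t) /= => st; rewrite st ltnn in lt_t.
by rewrite -sem_dtens_cat ?cat_take_drop // size_takel.
Qed.

End DTens.

Lemma comp_id_l m n (x : diagram m n) : comp (did n) x = x /\ loops (did n) x = 0.
Proof.
apply: comp_eqP => b t; rewrite muln1.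
case: (boolP (size t == n)) => st; last first.
  rewrite big1 => [|c _].
    by case: semP => // -[_ st' _]; rewrite st' eqxx in st.
  apply/eqP; rewrite eqb0 sem_did; apply: contra st.
  by case/and3P=> _ sc /eqP <-.
rewrite (@sum_words1 _ _ t); first by rewrite sem_did st eqxx !andbT.
  exact/eqP.
by move=> v sv vt; rewrite sem_did (introF eqP vt) !andbF.
Qed.

Lemma comp_dflip l m n (x : diagram m n) (y : diagram l m) :
  comp (dflip y) (dflip x) = dflip (comp x y) /\ loops (dflip y) (dflip x) = loops x y.
Proof.
apply: comp_eqP => b t; rewrite sem_dflip -sem_comp.
by apply: eq_bigr => c _; rewrite !sem_dflip andbC.
Qed.

Lemma dflipK m n (x : diagram m n) : dflip (dflip x) = x.
Proof. by apply: sem_inj => b t; rewrite !sem_dflip. Qed.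

Lemma dflip_id n : dflip (did n) = did n.
Proof.
by apply: sem_inj => b t; rewrite sem_dflip !sem_did => /andP[st /eqP <-]; rewrite st eqxx.
Qed.

Lemma dflip_tens m n m' n' (x : diagram m n) (y : diagram m' n') :
  dflip (dtens x y) = dtens (dflip x) (dflip y).
Proof. by apply: sem_inj => b t; rewrite sem_dflip !sem_dtens !sem_dflip. Qed.

Lemma dtens_id m n : dtens (did m) (did n) = did (m + n).
Proof.
apply: sem_inj => b t; rewrite sem_dtens !sem_did.
case/andP=> /andP[/eqP sb /eqP e1] /andP[/eqP sb' /eqP e2].
rewrite -[b](cat_take_drop m) -[t](cat_take_drop m) -e1 -e2 eqxx.
by rewrite size_cat sb sb' eqxx.
Qed.

Lemma comp_dtens l m n l' m' n' (x : diagram m n) (y : diagram l m)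
    (x' : diagram m' n') (y' : diagram l' m') :
  comp (dtens x x') (dtens y y') = dtens (comp x y) (comp x' y') /\
  loops (dtens x x') (dtens y y') = loops x y + loops x' y'.
Proof.
apply: comp_eqP => b t; rewrite sem_dtens -mulnb expnD mulnACA -!sem_comp.
rewrite sum_words_cat big_distrl /= big_seq [RHS]big_seq.
apply: eq_bigr => u; rewrite mem_words => /eqP su.
rewrite big_distrr /=; apply: eq_bigr => v _.
rewrite !sem_dtens take_size_cat // drop_size_cat // -!mulnb.
by rewrite mulnACA.
Qed.

Local Open Scope ring_scope.

(** * The linear category *)

Definition dg m n (d : diagram m n) : TL m n := [ffun e => (e == d)%:R].

Definition coef m n (d : diagram m n) (X : TL m n) : K := X d.

Lemma coef_linear m n (d : diagram m n) : linear (@coef m n d : TL m n -> K^o).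
Proof. by move=> a X Y; rewrite /coef !ffunE. Qed.

HB.instance Definition _ m n (d : diagram m n) :=
  GRing.isLinear.Build K (TL m n) K^o _ (@coef m n d : TL m n -> K^o) (@coef_linear m n d).

Lemma coefTLP m n (d : diagram m n) a (X Y : TL m n) :
  coef d (a *: X + Y) = a * coef d X + coef d Y.
Proof. exact: coef_linear. Qed.

Lemma coefTL0 m n (d : diagram m n) : coef d 0 = 0.
Proof. exact: linear0. Qed.

Lemma coefTLZ m n (d : diagram m n) a X : coef d (a *: X) = a * coef d X.
Proof. exact: linearZ. Qed.

Lemma coefTLB m n (d : diagram m n) (X Y : TL m n) : coef d (X - Y) = coef d X - coef d Y.
Proof. exact: linearB. Qed.

Lemma coef_dg m n (d e : diagram m n) : coef d (dg e) = (d == e)%:R.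
Proof. by rewrite /coef ffunE. Qed.

Lemma TL_eqP m n (X Y : TL m n) : (forall d, coef d X = coef d Y) -> X = Y.
Proof. by move=> h; apply/ffunP. Qed.

Lemma TL_expand m n (X : TL m n) : X = \sum_d coef d X *: dg d.
Proof.
apply/ffunP => e; rewrite sum_ffunE (bigD1 e) //= big1 => [|d de].
  by rewrite !ffunE eqxx /= addr0 [_ *: _]mulr1.
by rewrite !ffunE eq_sym (negPf de) [_ *: _]mulr0.
Qed.

Lemma TL_ind m n (P : TL m n -> Prop) :
  P 0 -> (forall a d X, P X -> P (a *: dg d + X)) -> forall X, P X.
Proof.
move=> P0 PS X; rewrite (TL_expand X).
by elim/big_rec: _ => // d Y _; apply: PS.
Qed.

Lemma TLDE m n (X Y : TL m n) d : (X + Y) d = (X d : K) + (Y d : K).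
Proof. by rewrite ffunE. Qed.

Lemma TLZE m n a (X : TL m n) d : (a *: X) d = a * (X d : K).
Proof. by rewrite ffunE. Qed.

Lemma mulTL_linear_l l m n a (X X' : TL m n) (Y : TL l m) :
  mulTL (a *: X + X') Y = a *: mulTL X Y + mulTL X' Y.
Proof.
apply/ffunP => d; rewrite TLDE TLZE !ffunE big_distrr -big_split /=.
apply: eq_bigr => x _; rewrite big_distrr -big_split /=.
by apply: eq_bigr => y _; rewrite TLDE TLZE !mulrDl !mulrA.
Qed.

Lemma mulTL_linear_r l m n (X : TL m n) : linear (@mulTL l m n X).
Proof.
move=> a Y Y'; apply/ffunP => d; rewrite TLDE TLZE !ffunE big_distrr -big_split /=.
apply: eq_bigr => x _; rewrite big_distrr -big_split /=.
apply: eq_bigr => y _; rewrite TLDE TLZE !mulrDr !mulrDl.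
by congr (_ + _); rewrite !mulrA [a * _]mulrC.
Qed.

HB.instance Definition _ l m n (X : TL m n) :=
  GRing.isLinear.Build K (TL l m) (TL l n) _ (@mulTL l m n X) (mulTL_linear_r X).

Definition mulTLr l m n (Y : TL l m) (X : TL m n) : TL l n := mulTL X Y.

Lemma mulTLr_linear l m n (Y : TL l m) : linear (@mulTLr l m n Y).
Proof. by move=> a X X'; apply: mulTL_linear_l. Qed.

HB.instance Definition _ l m n (Y : TL l m) :=
  GRing.isLinear.Build K (TL m n) (TL l n) _ (@mulTLr l m n Y) (mulTLr_linear Y).

Section MulTheory.
Variables (l m n : nat).
Implicit Types (X : TL m n) (Y : TL l m).

Lemma mulTL0 X : mulTL X (0 : TL l m) = 0. Proof. exact: linear0. Qed.
Lemma mulTL0l Y : mulTL (0 : TL m n) Y = 0. Proof. exact: (linear0 (mulTLr Y)). Qed.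
Lemma mulTLDr X Y Y' : mulTL X (Y + Y') = mulTL X Y + mulTL X Y'.
Proof. exact: linearD. Qed.
Lemma mulTLDl X X' Y : mulTL (X + X') Y = mulTL X Y + mulTL X' Y.
Proof. exact: (linearD (mulTLr Y)). Qed.
Lemma mulTLBr X Y Y' : mulTL X (Y - Y') = mulTL X Y - mulTL X Y'.
Proof. exact: linearB. Qed.
Lemma mulTLZr a X Y : mulTL X (a *: Y) = a *: mulTL X Y.
Proof. exact: linearZ. Qed.
Lemma mulTLZl a X Y : mulTL (a *: X) Y = a *: mulTL X Y.
Proof. by rewrite -[LHS]/(mulTLr Y _) linearZ. Qed.
Lemma mulTL_sumr I (r : seq I) P (F : I -> TL l m) X :
  mulTL X (\sum_(i <- r | P i) F i) = \sum_(i <- r | P i) mulTL X (F i).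
Proof. exact: linear_sum. Qed.
Lemma mulTL_suml I (r : seq I) P (F : I -> TL m n) Y :
  mulTL (\sum_(i <- r | P i) F i) Y = \sum_(i <- r | P i) mulTL (F i) Y.
Proof. exact: (linear_sum (mulTLr Y)). Qed.

Lemma mulTL_dg (x : diagram m n) (y : diagram l m) :
  mulTL (dg x) (dg y) = delta ^+ loops x y *: dg (comp x y).
Proof.
apply/ffunP => d; rewrite !ffunE (bigD1 x) //= [X in _ + X]big1 => [|x' xx']; last first.
  by apply: big1 => y' _; rewrite ffunE (negPf xx') !mul0r.
rewrite addr0 big_mkcond (bigD1 y) //= big1 => [|y' yy']; last first.
  by rewrite !ffunE (negPf yy') mulr0 mul0r if_same.
by rewrite addr0 !ffunE !eqxx !mul1r stackedE [RHS]mulr_natr mulrb.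
Qed.

End MulTheory.

Lemma basisTL_dg m n (R : rel (pt m n)) (d : diagram m n) :
  (forall p q q', R p q -> R p q' -> q = q') ->
  (forall p, R p (partner d p)) -> basisTL R = dg d.
Proof.
move=> fR dR; apply/ffunP => e; rewrite !ffunE; congr (_%:R).
congr nat_of_bool; apply/forallP/eqP => [eR|-> //].
by apply: diagram_eqP => p; apply: fR (eR p) (dR p).
Qed.

Lemma idTLE n : idTL n = dg (did n).
Proof.
apply: basisTL_dg => [p q q' /eqP -> /eqP -> //|p].
by rewrite partner_mk.
Qed.

Lemma reflTL_linear m n : linear (@reflTL m n).
Proof.
move=> a X Y; apply/ffunP => d; rewrite TLDE TLZE !ffunE big_distrr -big_split /=.
by apply: eq_bigr => x _; rewrite TLDE TLZE.
Qed.

HB.instance Definition _ m n :=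
  GRing.isLinear.Build K (TL m n) (TL n m) _ (@reflTL m n) (@reflTL_linear m n).

Lemma reflTL_dg m n (x : diagram m n) : reflTL (dg x) = dg (dflip x).
Proof.
apply/ffunP => d; rewrite !ffunE big_mkcond (bigD1 x) //= big1 => [|y yx].
  rewrite ffunE eqxx addr0; have -> : [forall p, partner d (flip p) == flip (partner x p)] = (d == dflip x).
    apply/forallP/eqP => [h|-> p]; last by rewrite partner_dflip.
    apply: diagram_eqP => p; rewrite -(flipK p) partner_dflip; exact/eqP.
  by case: eqP.
by rewrite ffunE (negPf yx) if_same.
Qed.

(** ** Juxtaposition *)

Lemma tensTL_linear_r m n m' n' (X : TL m n) : linear (@tensTL m n m' n' X).
Proof.
move=> a Y Y'; apply/ffunP => d; rewrite TLDE TLZE !ffunE big_distrr -big_split /=.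
apply: eq_bigr => x _; rewrite big_distrr -big_split /=.
apply: eq_bigr => y _; rewrite TLDE TLZE !mulrDr.
by congr (_ + _); rewrite !mulrA [a * _]mulrC.
Qed.

HB.instance Definition _ m n m' n' (X : TL m n) :=
  GRing.isLinear.Build K (TL m' n') (TL (m + m') (n + n')) _ (@tensTL m n m' n' X)
    (tensTL_linear_r X).

Definition tensTLr m n m' n' (Y : TL m' n') (X : TL m n) : TL (m + m') (n + n') :=
  tensTL X Y.

Lemma tensTLr_linear m n m' n' (Y : TL m' n') : linear (@tensTLr m n m' n' Y).
Proof.
move=> a X X'; apply/ffunP => d; rewrite TLDE TLZE !ffunE big_distrr -big_split /=.
apply: eq_bigr => x _; rewrite big_distrr -big_split /=.
by apply: eq_bigr => y _; rewrite TLDE TLZE !mulrDl !mulrA.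
Qed.

HB.instance Definition _ m n m' n' (Y : TL m' n') :=
  GRing.isLinear.Build K (TL m n) (TL (m + m') (n + n')) _ (@tensTLr m n m' n' Y)
    (tensTLr_linear Y).

Section TensTheory.
Variables (m n m' n' : nat).
Implicit Types (X : TL m n) (Y : TL m' n').

Lemma tensTL0 X : tensTL X (0 : TL m' n') = 0. Proof. exact: linear0. Qed.
Lemma tensTL0l Y : tensTL (0 : TL m n) Y = 0. Proof. exact: (linear0 (tensTLr Y)). Qed.
Lemma tensTLDr X Y Y' : tensTL X (Y + Y') = tensTL X Y + tensTL X Y'.
Proof. exact: linearD. Qed.
Lemma tensTLDl X X' Y : tensTL (X + X') Y = tensTL X Y + tensTL X' Y.
Proof. exact: (linearD (tensTLr Y)). Qed.
Lemma tensTLZr a X Y : tensTL X (a *: Y) = a *: tensTL X Y.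
Proof. exact: linearZ. Qed.
Lemma tensTLZl a X Y : tensTL (a *: X) Y = a *: tensTL X Y.
Proof. by rewrite -[LHS]/(tensTLr Y _) linearZ. Qed.
Lemma tensTL_suml I (r : seq I) P (F : I -> TL m n) Y :
  tensTL (\sum_(i <- r | P i) F i) Y = \sum_(i <- r | P i) tensTL (F i) Y.
Proof. exact: (linear_sum (tensTLr Y)). Qed.
Lemma tensTL_dg (x : diagram m n) (y : diagram m' n') :
  tensTL (dg x) (dg y) = dg (dtens x y).
Proof.
apply/ffunP => d; rewrite !ffunE (bigD1 x) //= [X in _ + X]big1 => [|x' xx']; last first.
  by apply: big1 => y' _; rewrite ffunE (negPf xx') !mul0r.
rewrite addr0 big_mkcond (bigD1 y) //= big1 => [|y' yy']; last first.
  by rewrite !ffunE (negPf yy') mulr0 if_same.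
by rewrite addr0 !ffunE !eqxx !mul1r juxtaposedE; case: eqP.
Qed.

End TensTheory.

(** ** The trace form *)

Lemma trTL_linear n : linear (@trTL n : TL n n -> K^o).
Proof.
move=> a X Y; rewrite /trTL -[RHS]/(a * _ + _) big_distrr -big_split /=.
by apply: eq_bigr => d _; rewrite TLDE TLZE mulrDl -mulrA.
Qed.

HB.instance Definition _ n :=
  GRing.isLinear.Build K (TL n n) K^o _ (@trTL n : TL n n -> K^o) (@trTL_linear n).

Lemma trTLP n a (X Y : TL n n) : trTL (a *: X + Y) = a * trTL X + trTL Y.
Proof. exact: trTL_linear. Qed.

Lemma trTL0 n : trTL (0 : TL n n) = 0.
Proof. exact: linear0. Qed.

Lemma trTLZ n a (X : TL n n) : trTL (a *: X) = a * trTL X.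
Proof. exact: linearZ. Qed.

Lemma trTL_sum n I (r : seq I) P (F : I -> TL n n) :
  trTL (\sum_(i <- r | P i) F i) = \sum_(i <- r | P i) trTL (F i).
Proof. exact: linear_sum. Qed.

Lemma trTL_dg n (d : diagram n n) : trTL (dg d) = delta ^+ closure_loops d.
Proof.
rewrite /trTL (bigD1 d) //= big1 => [|e ed]; first by rewrite ffunE eqxx addr0 mul1r.
by rewrite ffunE (negPf ed) mul0r.
Qed.

Lemma tensTL_lin2l m n m' n' a b (X Y : TL m n) (Z : TL m' n') :
  tensTL (a *: X + b *: Y) Z = a *: tensTL X Z + b *: tensTL Y Z.
Proof. by rewrite tensTLDl !tensTLZl. Qed.

Lemma tensTL_lin2r m n m' n' a b (X Y : TL m n) (Z : TL m' n') :
  tensTL Z (a *: X + b *: Y) = a *: tensTL Z X + b *: tensTL Z Y.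
Proof. by rewrite tensTLDr !tensTLZr. Qed.

Lemma mulTL_lin2l l m n a b (X Y : TL m n) (Z : TL l m) :
  mulTL (a *: X + b *: Y) Z = a *: mulTL X Z + b *: mulTL Y Z.
Proof. by rewrite mulTLDl !mulTLZl. Qed.

Lemma mulTL_lin2r l m n a b (X Y : TL l m) (Z : TL m n) :
  mulTL Z (a *: X + b *: Y) = a *: mulTL Z X + b *: mulTL Z Y.
Proof. by rewrite mulTLDr !mulTLZr. Qed.

(* Otherwise a failing unification unfolds these constants down to fractions of
   polynomials and does not terminate in practice. *)
#[global] Opaque loops closure_loops comp dtens dflip did TL dg mulTL tensTL reflTL trTL coef basisTL idTL eTL.

Lemma eq_lin (R : pzRingType) (V : lmodType R) a (x x' y : V) :
  x = x' -> a *: x + y = a *: x' + y.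
Proof. by move->. Qed.

Lemma mulTLA k l m n (X : TL m n) (Y : TL l m) (Z : TL k l) :
  mulTL (mulTL X Y) Z = mulTL X (mulTL Y Z).
Proof.
elim/TL_ind: X => [|a x X IH]; first by rewrite !mulTL0l.
rewrite !mulTLDl !mulTLZl IH; apply: eq_lin => {IH}.
elim/TL_ind: Y => [|b y Y IH]; first by rewrite !(mulTL0, mulTL0l).
rewrite !(mulTLDl, mulTLDr) !(mulTLZl, mulTLZr) IH; apply: eq_lin => {IH}.
elim/TL_ind: Z => [|c z Z IH]; first by rewrite !mulTL0.
rewrite !mulTLDr !mulTLZr IH; apply: eq_lin => {IH}.
have [e1 e2] := compA x y z.
by rewrite !mulTL_dg !(mulTLZl, mulTLZr) !mulTL_dg !scalerA -!exprD e1 e2.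
Qed.

Lemma mul1TL m n (X : TL m n) : mulTL (idTL n) X = X.
Proof.
elim/TL_ind: X => [|a x X IH]; first by rewrite mulTL0.
rewrite mulTLDr mulTLZr IH idTLE mulTL_dg; have [-> ->] := comp_id_l x.
by rewrite scale1r.
Qed.

Lemma reflTLK m n (X : TL m n) : reflTL (reflTL X) = X.
Proof.
elim/TL_ind: X => [|a x X IH]; first by rewrite !linear0.
by rewrite (reflTL_linear a) (reflTL_linear a) IH !reflTL_dg dflipK.
Qed.

Lemma reflTLM l m n (X : TL m n) (Y : TL l m) :
  reflTL (mulTL X Y) = mulTL (reflTL Y) (reflTL X).
Proof.
elim/TL_ind: X => [|a x X IH]; first by rewrite mulTL0l !linear0.
rewrite mulTLDl mulTLZl !linearD !linearZ /= IH; apply: eq_lin => {IH}.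
elim/TL_ind: Y => [|b y Y IH]; first by rewrite mulTL0 !linear0 mulTL0l.
rewrite mulTLDr mulTLZr !linearD !linearZ /= mulTLDl mulTLZl IH; apply: eq_lin => {IH}.
by rewrite !reflTL_dg !mulTL_dg linearZ /= reflTL_dg; have [-> ->] := comp_dflip x y.
Qed.

Lemma reflTL1 n : reflTL (idTL n) = idTL n.
Proof. by rewrite idTLE reflTL_dg dflip_id. Qed.

Lemma mulTL1 m n (X : TL m n) : mulTL X (idTL m) = X.
Proof. by rewrite -[LHS]reflTLK reflTLM reflTL1 mul1TL reflTLK. Qed.

Lemma tensTL_id m n : tensTL (idTL m) (idTL n) = idTL (m + n).
Proof. by rewrite !idTLE tensTL_dg dtens_id. Qed.

Lemma mul_tensTL l m n l' m' n' (X : TL m n) (Y : TL l m) (X' : TL m' n') (Y' : TL l' m') :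
  mulTL (tensTL X X') (tensTL Y Y') = tensTL (mulTL X Y) (mulTL X' Y').
Proof.
elim/TL_ind: X => [|a x X IH]; first by rewrite !(mulTL0l, tensTL0l).
rewrite !(mulTLDl, tensTLDl) !(mulTLZl, tensTLZl) IH.
apply: eq_lin => {IH}.
elim/TL_ind: X' => [|a' x' X' IH]; first by rewrite !(mulTL0l, tensTL0).
rewrite !(mulTLDl, tensTLDr) !(mulTLZl, tensTLZr) IH.
apply: eq_lin => {IH}.
elim/TL_ind: Y => [|b y Y IH]; first by rewrite !(mulTL0, tensTL0l).
rewrite !(mulTLDr, tensTLDl) !(mulTLZr, tensTLZl) IH.
apply: eq_lin => {IH}.
elim/TL_ind: Y' => [|b' y' Y' IH]; first by rewrite !(mulTL0, tensTL0).
rewrite !(mulTLDr, tensTLDr) !(mulTLZr, tensTLZr) IH.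
apply: eq_lin => {IH}.
rewrite !(tensTL_dg, mulTL_dg) !(tensTLZl, tensTLZr) tensTL_dg scalerA -exprD.
by have [-> ->] := comp_dtens x y x' y'.
Qed.

Lemma reflTL_tens m n m' n' (X : TL m n) (Y : TL m' n') :
  reflTL (tensTL X Y) = tensTL (reflTL X) (reflTL Y).
Proof.
elim/TL_ind: X => [|a x X IH]; first by rewrite !(tensTL0l, linear0).
rewrite tensTLDl tensTLZl !linearD !linearZ /= tensTLDl tensTLZl IH; apply: eq_lin => {IH}.
elim/TL_ind: Y => [|b y Y IH]; first by rewrite !(tensTL0, linear0).
rewrite tensTLDr tensTLZr !linearD !linearZ /= IH; apply: eq_lin => {IH}.
by rewrite tensTL_dg !reflTL_dg tensTL_dg dflip_tens.
Qed.

(** The left side is the trace of the 0/1 matrix of [d]: a word placed both at the bottom and on the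
    top is a colouring of the closure, with one free colour per loop. *)
Lemma sem_closure n (d : diagram n n) :
  (\sum_(b <- words n) sem d b b = 2 ^ closure_loops d)%N.
Proof.
set e := fun p q : pt n n => (q == partner d p) || (q == flip p).
have e_sym : symmetric e.
  have E (U : eqType) (f : U -> U) p q : involutive f -> (q == f p) = (p == f q).
    by move=> fK; rewrite -(inj_eq (inv_inj fK)) fK eq_sym.
  by move=> p q; rewrite /e (E _ _ _ _ (partnerK d)) (E _ _ _ _ (@flipK n n)).
Transparent closure_loops.
rewrite /closure_loops -/e -(card_closed_sets e_sym) //.
rewrite sum_words -big_mkcond /= sum1dep_card.
pose cls (b : n.-tuple bool) : {set pt n n} := [set p | colour b b p].
rewrite -(@card_in_imset _ _ cls); last first.
  move=> b c _ _ /setP ebc; apply/eq_from_tnth => i.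
  by have := ebc (inl i); rewrite !inE /= !(tnth_nth false).
apply: eq_card => A; apply/imsetP/idP => [[b + ->]|].
  rewrite !inE => /semP[_ _ hb]; apply/andP; split; first by apply/forallP => p; apply/implyP.
  apply/forallP => p; apply/forallP => q; apply/implyP => /orP[] /eqP ->; rewrite !inE.
    by rewrite hb.
  by case: p.
rewrite inE => /andP[_ /forallP cl].
have clA p q : e p q -> (p \in A) = (q \in A).
  by move=> pq; have /forallP/(_ q)/implyP/(_ pq)/eqP := cl p.
exists [tuple inl i \in A | i < n].
  have := @sem_words _ _ d (fun p => p \in A).
  rewrite inE; have -> : word (fun a : 'I_n => inr a \in A) = word (fun a : 'I_n => inl a \in A).
    congr tval; apply/eq_from_tnth => i; rewrite !tnth_mktuple.
    by apply: clA; rewrite /e eqxx orbT.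
  by apply=> p; apply/esym/clA; rewrite /e eqxx.
apply/setP => p; rewrite inE; case: p => i /=.
  by rewrite -[RHS]/(nth false (word (fun a : 'I_n => inl a \in A)) i) nth_word.
rewrite -[RHS]/(nth false (word (fun a : 'I_n => inl a \in A)) i) nth_word.
by apply: clA; rewrite /e eqxx orbT.
Qed.

(** The exponent of [delta] in the Gram matrix of the trace form: the number of loops obtained by
    gluing [x] to [y] along all their boundary points. *)
Definition dform m n (x y : diagram m n) : nat :=
  (loops x (dflip y) + closure_loops (comp x (dflip y)))%N.

Lemma sem_trace m n (x : diagram m n) (y : diagram n m) :
  (2 ^ (loops x y + closure_loops (comp x y)) =
   \sum_(b <- words n) \sum_(c <- words m) (sem y b c && sem x c b))%N.
Proof.
rewrite expnD -sem_closure mulnC big_distrl /=.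
by apply: eq_bigr => b _; rewrite -sem_comp.
Qed.

Lemma trTL_mulC m n (X : TL m n) (Y : TL n m) : trTL (mulTL X Y) = trTL (mulTL Y X).
Proof.
elim/TL_ind: X => [|a x X IH]; first by rewrite mulTL0l mulTL0 !trTL0.
rewrite mulTLDl mulTLDr mulTLZl mulTLZr !trTLP IH; congr (_ * _ + _) => {IH}.
elim/TL_ind: Y => [|b y Y IH]; first by rewrite mulTL0l mulTL0 !trTL0.
rewrite mulTLDl mulTLDr mulTLZl mulTLZr !trTLP IH; congr (_ * _ + _) => {IH}.
rewrite !mulTL_dg !trTLZ !trTL_dg -!exprD; congr (_ ^+ _).
apply/eqP; rewrite -(@eqn_exp2l 2 _ _ isT) !sem_trace exchange_big /=.
by apply/eqP/eq_bigr => c _; apply: eq_bigr => b' _; rewrite andbC.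
Qed.

Lemma trTL_refl n (X : TL n n) : trTL (reflTL X) = trTL X.
Proof.
elim/TL_ind: X => [|a x X IH]; first by rewrite linear0.
rewrite reflTL_linear !trTLP IH; congr (_ * _ + _) => {IH}.
rewrite reflTL_dg !trTL_dg; congr (_ ^+ _); apply/eqP.
by rewrite -(@eqn_exp2l 2 _ _ isT) -!sem_closure; apply/eqP/eq_bigr => b _; rewrite sem_dflip.
Qed.

Lemma sem_dform m n (x y : diagram m n) :
  (2 ^ dform x y = \sum_(b <- words n) \sum_(c <- words m) (sem y c b && sem x c b))%N.
Proof.
by rewrite sem_trace; apply: eq_bigr => b _; apply: eq_bigr => c _; rewrite sem_dflip.
Qed.

#[global] Opaque dform.

(** [2 ^ dform x y] counts the colourings compatible with both diagrams. When [y] differs from [x],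
    some colouring of [x] fails for [y], so the count drops strictly. *)
Lemma dform_lt m n (x y : diagram m n) : x != y -> (dform x y < dform x x)%N.
Proof.
move=> xy; rewrite -(@ltn_exp2l 2 _ _ isT).
rewrite [X in leq X _](congr1 S (sem_dform x y)) [X in leq _ X]sem_dform.
have [b [t [xbt ybt]]] : exists b t, sem x b t /\ ~~ sem y b t.
  apply: boolp.contrapT => h; case/eqP: xy; apply: sem_inj => b t xbt.
  by apply: boolp.contrapT => /negP ybt; apply: h; exists b, t.
have [sb st _] := semP _ _ _ xbt.
have D1 k (w : seq bool) (F : seq bool -> nat) : size w = k ->
    (\sum_(u <- words k) F u = F w + \sum_(u <- words k | u != w) F u)%N.
  by move=> sw; rewrite (bigD1_seq w) ?uniq_words ?mem_words ?sw.
rewrite (D1 n t _ st) (D1 m b _ sb) [X in (_ < X)%N](D1 n t _ st).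
rewrite [X in (_ < X + _)%N](D1 m b _ sb).
rewrite xbt (negPf ybt) /= add0n -addnA add1n ltnS.
apply: leq_add; first by apply: leq_sum => c _; case: (sem y _ _); case: (sem x _ _).
by apply: leq_sum => u _; apply: leq_sum => c _; case: (sem y _ _); case: (sem x _ _).
Qed.

Lemma trTL_form m n (X Y : TL m n) : trTL (mulTL X (reflTL Y)) =
  \sum_x \sum_y coef x X * coef y Y * delta ^+ dform x y.
Proof.
rewrite {1}(TL_expand X) {1}(TL_expand Y) mulTL_suml trTL_sum.
apply: eq_bigr => x _; rewrite mulTLZl trTLZ linear_sum mulTL_sumr trTL_sum.
rewrite big_distrr; apply: eq_bigr => y _.
rewrite linearZ /= mulTLZr trTLZ reflTL_dg mulTL_dg trTLZ trTL_dg.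
Transparent dform. by rewrite -mulrA exprD.
Qed.

(** * Anisotropy of the trace form *)

Lemma fraction_div (R : idomainType) (x : {fraction R}) :
  exists p q : R, q != 0 /\ x * tofrac q = tofrac p.
Proof.
elim/quotW: x => r; exists \n_r, \d_r; split; first exact: denom_ratioP.
apply/eqP; rewrite -[_ * _]/(FracField.mul _ _) !piE FracField.equivfE /FracField.mulf.
rewrite !numden_Ratio ?mulf_neq0 ?oner_neq0 ?denom_ratioP //.
by rewrite !mulr1 mulrC.
Qed.

Lemma common_denominator (R : idomainType) (I : finType) (a : I -> {fraction R}) :
  exists q : R, q != 0 /\ exists p : I -> R, forall i, a i * tofrac q = tofrac (p i).
Proof.
have h i := fraction_div (a i).
have /boolp.choice[pq pqP] : forall i, exists pq : R * R, pq.2 != 0 /\ a i * tofrac pq.2 = tofrac pq.1.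
  by move=> i; have [p [q h']] := fraction_div (a i); exists (p, q).
exists (\prod_i (pq i).2); split.
  by apply/prodf_neq0 => i _; case: (pqP i).
exists (fun i => (pq i).1 * \prod_(j | j != i) (pq j).2) => i.
by rewrite (bigD1 i) //= !tofracM mulrA; case: (pqP i) => _ ->.
Qed.

Lemma coefM_top (R : nzRingType) (p q : {poly R}) m n :
  (size p <= m.+1)%N -> (size q <= n.+1)%N -> (p * q)`_(m + n) = p`_m * q`_n.
Proof.
move=> sp sq; rewrite coefM.
have lt_m : (m < (m + n).+1)%N by lia.
rewrite (bigD1 (Ordinal lt_m)) //= addKn big1 ?addr0 // => i.
rewrite -val_eqE /= => im; case: (ltnP i m) => im'.
  by rewrite [q`_ _]nth_default ?mulr0 //; apply: leq_trans sq _; lia.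
by rewrite [p`_ _]nth_default ?mul0r //; apply: leq_trans sp _; lia.
Qed.

Lemma size_polyM_top (R : nzRingType) (p q : {poly R}) m n :
  (size p <= m.+1)%N -> (size q <= n.+1)%N -> (size (p * q)%R <= (m + n).+1)%N.
Proof. by move=> sp sq; apply: leq_trans (size_polyMleq _ _) _; lia. Qed.

Lemma coefX_top (R : nzRingType) (p : {poly R}) m k :
  (size p <= m.+1)%N -> (size (p ^+ k) <= (m * k).+1)%N /\ (p ^+ k)`_(m * k) = p`_m ^+ k.
Proof.
move=> sp; elim: k => [|k [s1 c1]]; first by rewrite muln0 !expr0 size_poly1 coef1.
rewrite exprS mulnS; split.
  by apply: leq_trans (size_polyMleq _ _) _; lia.
by rewrite coefM_top // c1 exprS.
Qed.

Lemma A_neq0 : A != 0.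
Proof. by rewrite tofrac_eq0 polyX_eq0. Qed.

Definition delta_poly : {poly rat} := - ('X^4 + 1).

Lemma delta_tofrac : A ^+ 2 * delta = tofrac delta_poly.
Proof.
rewrite /delta /delta_poly tofracN tofracD tofracXn tofrac1 -/A.
by rewrite mulrBr mulfV ?expf_neq0 ?A_neq0 // mulrN -exprD opprD.
Qed.

Lemma delta_neq0 : delta != 0.
Proof.
have : A ^+ 2 * delta != 0.
  rewrite delta_tofrac tofrac_eq0 /delta_poly oppr_eq0; apply/eqP => /(congr1 (fun p : {poly rat} => p`_4)).
  by rewrite coefD coefXn coef1 coef0.
by rewrite mulf_eq0 negb_or => /andP[].
Qed.

(* After clearing denominators, the form is a polynomial in A whose leading
   coefficient is, up to sign, a sum of squares of rationals. *)
Lemma form_anisotropic (I : finType) (D : I -> I -> nat) (h : nat) (a : I -> K) :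
  (forall x, D x x = h) -> (forall x y, x != y -> (D x y < h)%N) ->
  \sum_x \sum_y a x * a y * delta ^+ D x y = 0 -> forall x, a x = 0.
Proof.
move=> Dh Dlt form0 x0.
have [q [q0 [p pP]]] := common_denominator a.
have tq0 : tofrac q != 0 by rewrite tofrac_eq0.
suff p0 : p x0 = 0.
  by apply/eqP; have := pP x0; rewrite p0 tofrac0 => /eqP; rewrite mulf_eq0 (negPf tq0) orbF.
have Dle x y : (D x y <= h)%N.
  by case: (altP (x =P y)) => [->|/Dlt/ltnW //]; rewrite Dh.
(* The form multiplied by the square of [q] and by A^(2h). Since A^2 delta = -(A^4 + 1) has degree
   4, the last factor of a term of exponent D has degree 2h + 2D, which is largest only for D =
   h. *)
pose P := \sum_x \sum_y p x * p y * (delta_poly ^+ D x y * 'X^(2 * (h - D x y))).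
have P0 : P = 0.
  apply/eqP; rewrite -(tofrac_eq0 P); apply/eqP.
  transitivity (A ^+ (2 * h) * (tofrac q ^+ 2) * \sum_x \sum_y a x * a y * delta ^+ D x y).
    rewrite /P rmorph_sum big_distrr /=; apply: eq_bigr => x _.
    rewrite rmorph_sum big_distrr /=; apply: eq_bigr => y _.
    rewrite !tofracM !tofracXn -/A -delta_tofrac -!pP exprMn -exprM.
    have -> : A ^+ (2 * h) = A ^+ (2 * D x y) * A ^+ (2 * (h - D x y)).
      by rewrite -exprD -mulnDr subnKC.
    by ring.
  by rewrite form0 mulr0.
apply/eqP/negPn/negP => px0.
have [x1 px1 maxp] : exists2 x1, p x1 != 0 & forall x, (size (p x) <= size (p x1))%N.
  have [x1 _ h1] := @arg_maxnP _ x0 predT (fun x => size (p x)) isT.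
  exists x1 => [|x]; last exact: h1.
  by rewrite -size_poly_gt0; apply: leq_trans (h1 x0 isT); rewrite size_poly_gt0.
have [M Mx1] : exists M, size (p x1) = M.+1.
  by exists (size (p x1)).-1; rewrite prednK // size_poly_gt0.
have sp x : (size (p x) <= M.+1)%N by rewrite -Mx1.
have sd : (size delta_poly <= 4.+1)%N.
  rewrite /delta_poly size_polyN (leq_trans (size_polyD _ _)) // size_polyXn size_poly1.
  by [].
have cd : delta_poly`_4 = -1.
  by rewrite /delta_poly coefN coefD coefXn coef1 /= addr0.
(* Off the diagonal the degree is at most 2M + 2h + 2D < 2M + 4h, so this coefficient only sees
   squares of the coefficients of degree M, and that of [p x1] is nonzero. *)
have : P`_((M + M) + (4 * h + 0)) = (-1) ^+ h * \sum_x ((p x)`_M) ^+ 2.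
  rewrite /P coef_sum big_distrr /=; apply: eq_bigr => x _.
  rewrite coef_sum (bigD1 x) //= Dh subnn muln0 expr0 mulr1.
  have [s1 c1] := coefX_top h sd.
  rewrite coefM_top; first last.
  - by rewrite addn0.
  - exact: size_polyM_top.
  rewrite coefM_top // addn0 c1 cd big1 => [|y yx].
    by rewrite addr0 mulrC expr2.
  have [s2 _] := coefX_top (D x y) sd.
  have s3 : (size ('X^(2 * (h - D x y)) : {poly rat})%R <= (2 * (h - D x y)).+1)%N.
    by rewrite size_polyXn.
  rewrite nth_default //.
  apply: leq_trans (size_polyM_top (size_polyM_top (sp x) (sp y)) (size_polyM_top s2 s3)) _.
  by have := Dlt x y; rewrite eq_sym yx => /(_ isT); lia.
rewrite P0 coef0 => /esym/eqP; rewrite mulf_eq0 signr_eq0 /=.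
rewrite psumr_eq0 => [/allP all0|x _]; last exact: sqr_ge0.
have := all0 x1 (mem_index_enum _); rewrite /= sqrf_eq0.
by have := lead_coef_eq0 (p x1); rewrite lead_coefE Mx1 /= (negPf px1) => ->.
Qed.

Lemma order_partner m n (d : diagram m n) p : fingraph.order (partner d) p = 2.
Proof.
have := @order_cycle _ (partner d) [:: p; partner d p]; apply=> //=.
- by rewrite partnerK !eqxx.
- by rewrite inE eq_sym partnerN.
by rewrite inE eqxx.
Qed.

(** A colouring compatible with [x] is a free choice of one colour per arc, and there are (m + n)/2
    arcs. All diagonal exponents therefore agree, as [form_anisotropic] requires. *)
Lemma dform_diag m n (x : diagram m n) : (dform x x * 2)%N = (m + n)%N.
Proof.
transitivity #|{: pt m n}|; last by rewrite card_sum !card_ord.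
rewrite -(@fcard_order_set _ (partner x) (inv_inj (partnerK x)) 2 predT); first last.
- by [].
- by apply/subsetP => p _; rewrite inE order_partner.
congr (_ * _)%N; apply/eqP; rewrite -(@eqn_exp2l 2 _ _ isT).
have e_sym : symmetric (frel (partner x)).
  by move=> p q; rewrite /= -(inj_eq (inv_inj (partnerK x))) partnerK eq_sym.
rewrite -(card_closed_sets e_sym) //; apply/eqP; rewrite [LHS]sem_dform sum_words.
under eq_bigr do rewrite sum_words.
rewrite pair_big /= -big_mkcond /= sum1dep_card.
pose cls (bc : n.-tuple bool * m.-tuple bool) : {set pt m n} := [set p | colour bc.2 bc.1 p].
rewrite -(@card_in_imset _ _ cls); last first.
  move=> [b c] [b' c'] _ _ /setP ebc; congr (_, _); apply/eq_from_tnth => i.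
    by have := ebc (inr i); rewrite !inE /= !(tnth_nth false).
  by have := ebc (inl i); rewrite !inE /= !(tnth_nth false).
apply: eq_card => A; apply/imsetP/idP => [[[b c] + ->]|].
  rewrite !inE /= andbb => /semP[_ _ hb]; apply/andP; split; first by apply/forallP => p; apply/implyP.
  by apply/forallP => p; apply/forallP => q; apply/implyP => /eqP <-; rewrite !inE hb.
rewrite inE => /andP[_ /forallP cl].
have clA p : (partner x p \in A) = (p \in A).
  by have /forallP/(_ (partner x p))/implyP/(_ (eqxx _))/eqP := cl p.
exists ([tuple inr i \in A | i < n], [tuple inl i \in A | i < m]).
  by rewrite inE /= andbb; apply: (sem_words (c := fun p => p \in A)).
apply/setP => p; rewrite inE.
by rewrite -[RHS]/(colour (word (fun i => inl i \in A)) (word (fun i => inr i \in A)) p)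
  (colour_words (fun p => p \in A)).
Qed.

Lemma trTL_anisotropic m n (X : TL m n) : trTL (mulTL X (reflTL X)) = 0 -> X = 0.
Proof.
rewrite trTL_form => h; apply: TL_eqP => d; rewrite linear0.
apply: (form_anisotropic (h := (m + n)./2) (D := @dform m n) _ _ h d) => [x|x y xy].
  by rewrite -(dform_diag x) muln2 doubleK.
by rewrite -(dform_diag x) muln2 doubleK dform_lt.
Qed.

Local Close Scope ring_scope.

(** * Planar combinatorics *)

Section NatMatching.
Variables (N : nat) (f : nat -> nat).
Hypothesis f_lt : forall s, s < N -> f s < N.
Hypothesis fK : forall s, s < N -> f (f s) = s.
Hypothesis fN : forall s, s < N -> f s <> s.
Hypothesis f_nc : forall s t, s < t -> t < f s -> f s < f t -> t < N -> False.

Lemma matching_inside a s : a < N -> a < s -> s < f a -> a < f s /\ f s < f a.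
Proof.
move=> aN as_ sf; have fN' := f_lt aN; have sN : s < N by lia.
have ffs := fK sN; have ffa := fK aN; have fs := fN sN.
have h1 : f s <> a by move=> h; move: ffs; rewrite h; lia.
have h2 : f s <> f a by move=> h; move: ffs; rewrite h ffa; lia.
split.
  case: (ltngtP a (f s)) => // h; last by case: h1.
  case: (@f_nc (f s) a) => //; first by rewrite ffs.
  by rewrite ffs.
case: (ltngtP (f s) (f a)) => // h.
by case: (@f_nc a s).
Qed.

(** Descent to an innermost arc: if the partner of [a] is not its neighbour, the arc starting at
    [a.+1] lies strictly inside. *)
Lemma adjacent_arc a : a < N -> a < f a -> exists2 c, a <= c < f a & f c = c.+1.
Proof.
move: {2}(f a - a) (leqnn (f a - a)) => k; elim: k a => [|k IH] a dk aN lt_a.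
  by lia.
case: (f a =P a.+1) => [e|ne]; first by exists a => //; lia.
have [h1 h2] := @matching_inside a a.+1 aN ltac:(lia) ltac:(lia).
have aN' : a.+1 < N by have := f_lt aN; lia.
have ne' := fN aN'.
have [c cP cE] := IH a.+1 ltac:(lia) aN' ltac:(lia).
by exists c => //; lia.
Qed.

Variables (m n x : nat).
Hypothesis NE : N = m + n.
Hypothesis bot_adj : forall j, j.+1 < m -> f j = j.+1 -> j.+1 = x.
Hypothesis top_through : forall s, m <= s -> s < N -> f s < m.

(** Every bottom arc encloses an adjacent one, which can only join x-1 to x. Applied to the shorter
    arcs at both ends inside it, this forces all bottom arcs to be centred on that gap. *)
Lemma bottom_arc_sum a : a < f a -> f a < m -> (a < x <= f a) && ((a + f a).+1 == x.*2).
Proof.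
move: {2}(f a - a) (leqnn (f a - a)) => k; elim: k a => [|k IH] a dk lt_a fam.
  by lia.
have aN : a < N by lia.
have [c cP cE] := adjacent_arc aN lt_a.
have cx := bot_adj (j := c) ltac:(lia) cE.
case: (f a =P a.+1) => [e|ne]; first by rewrite e; lia.
have [h1 h2] := @matching_inside a a.+1 aN ltac:(lia) ltac:(lia).
have [h3 h4] := @matching_inside a (f a).-1 aN ltac:(lia) ltac:(lia).
have e1 := IH a.+1; have ne1 := @fN a.+1 ltac:(lia); have ne2 := @fN (f a).-1 ltac:(lia).
have e2 := IH (f (f a).-1); move: e2; rewrite fK; last lia.
by lia.
Qed.

(** Concentric bottom arcs form a single rainbow of [p] arcs; the remaining bottom points carry
    through strands, and planarity forces these to keep their order. *)
Lemma through_shape : x <= m -> exists p, [/\ n + p.*2 = m, p <= x, x + p <= m,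
  forall a, x - p <= a < x + p -> (a + f a).+1 = x.*2 &
  forall a, a < m -> (a < x - p -> f a = N.-1 - a) /\
                     (x + p <= a -> f a = N.-1 - (a - p.*2))].
Proof.
move=> xm.
(* [P c] says that the rainbow has its c-th arc, from x-c-1 to x+c. Presence is inherited inwards,
   and [p] is the first missing index. *)
pose P c := [&& c < x, x + c < m & f (x - c.+1) == x + c].
have Pdown c : P c.+1 -> P c.
  case/and3P=> h1 h2 /eqP h3; apply/and3P; split; try lia.
  have [h4 h5] := @matching_inside (x - c.+2) (x - c.+1) ltac:(lia) ltac:(lia) ltac:(lia).
  have ne := @fN (x - c.+1) ltac:(lia).
  have := @bottom_arc_sum (x - c.+1) ltac:(lia) ltac:(lia).
  by lia.
have exNP : exists c, ~~ P c by exists x; rewrite /P ltnn.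
case: (ex_minnP exNP) => p NPp pmin.
have Plt c : c < p -> P c.
  by move=> cp; apply/negPn/negP => /pmin; lia.
have Pge c : p <= c -> ~~ P c.
  elim: c => [|c IH]; first by rewrite leqn0 => /eqP <-.
  rewrite leq_eqVlt => /orP[/eqP <- //|pc].
  by apply: contra (IH _) => //; apply: Pdown.
have px : p <= x.
  by case: p {NPp pmin Pge} Plt => // p /(_ p (ltnSn p)) /and3P[].
have xpm : x + p <= m.
  case: p {NPp pmin Pge px} Plt => [_|p /(_ p (ltnSn p)) /and3P[]]; first by lia.
  by lia.
have mid a : x - p <= a < x + p -> (a + f a).+1 = x.*2.
  move=> ap; case: (ltnP a x) => ax.
    have /and3P[h1 h2 /eqP h3] := Plt (x - a.+1) ltac:(lia).
    by move: h3; (have -> : x - (x - a.+1).+1 = a by lia); lia.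
  have /and3P[h1 h2 /eqP h3] := Plt (a - x) ltac:(lia).
  have e : f (f (x - (a - x).+1)) = x - (a - x).+1 by apply: fK; lia.
  by move: e; rewrite h3; (have -> : x + (a - x) = a by lia); lia.
have thr a : a < m -> (a < x - p) || (x + p <= a) -> m <= f a.
  move=> am ap; rewrite leqNgt; apply/negP => fam.
  have ne := @fN a ltac:(lia); have ff := @fK a ltac:(lia).
  case: (ltngtP a (f a)) => [lt_a|lt_a|e]; last by case: ne.
    have /andP[h1 /eqP h2] := bottom_arc_sum lt_a fam.
    have /negP := Pge (x - a.+1) ltac:(lia); apply; apply/and3P; split; try lia.
    by (have -> : x - (x - a.+1).+1 = a by lia); lia.
  have := @bottom_arc_sum (f a); rewrite ff => /(_ lt_a am) /andP[h1 /eqP h2].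
  have /negP := Pge (x - (f a).+1) ltac:(lia); apply; apply/and3P; split; try lia.
  by (have -> : x - (x - (f a).+1).+1 = f a by lia); rewrite ff; lia.
(* For a through point, [tau a] is the number of through points on its left, hence the top position
   its strand must reach; top position b has boundary rank [N.-1 - b]. *)
pose tau a := if a < x - p then a else a - p.*2.
pose thru a := (a < x - p) || (x + p <= a).
have tau_inj : forall u v, thru u -> thru v -> tau u = tau v -> u = v.
  move=> a c; rewrite /thru /tau; case: (ltnP a (x - p)) => ?; case: (ltnP c (x - p)) => ?; lia.
have tau_surj u b : thru u -> b < tau u -> exists c, [/\ thru c, tau c = b & c < u].
  rewrite /thru /tau => tu; case: (ltnP b (x - p)) => hb lt.
    exists b; rewrite hb; split=> //; move: lt.
    by case: (ltnP u (x - p)) => ?; lia.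
  move: lt; case: (ltnP u (x - p)) => hu lt; first by lia.
  exists (b + p.*2); have -> : (b + p.*2 < x - p) = false by lia.
  by split; lia.
have tauE : forall a, a < m -> thru a -> f a = N.-1 - tau a.
  elim/ltn_ind => a IH am ta.
  have fa := thr a am ta; have faN := @f_lt a ltac:(lia).
  set b := N.-1 - f a; have bE : f a = N.-1 - b by rewrite /b; lia.
  have bn : b < n by rewrite /b; lia.
  (* A smaller top position is already taken by a strand further left. If the position were larger,
     the strand ending at [tau a] would start further right and cross this one. *)
  case: (ltngtP b (tau a)) => [lt|gt|<- //].
    have [c [tc cb ca]] := tau_surj a b ta lt.
    have e := IH c ca ltac:(lia) tc.
    have := @fK a ltac:(lia); rewrite bE -cb -e fK; lia.
  have sP : m <= N.-1 - tau a < N by lia.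
  case/andP: sP => s1 s2; have cm := top_through s1 s2; have ff := fK s2.
  set c := f (N.-1 - tau a) in cm ff.
  have tc : thru c.
    rewrite /thru; apply/negPn/negP; rewrite negb_or => h.
    by have := mid c ltac:(lia); rewrite ff; have := tau_inj; lia.
  case: (ltngtP c a) => [ca|ac|e].
  - have := IH c ca cm tc; rewrite ff => h; have : a = c by apply: tau_inj => //; lia.
    by lia.
  - by case: (@f_nc a c); rewrite ?ff; lia.
  - by move: ff; rewrite e; lia.
have nm : n + p.*2 = m.
  case: (ltngtP (n + p.*2) m) => // h.
    have tm : thru m by rewrite /thru; lia.
    have lt_n : n < tau m by rewrite /tau; case: (ltnP m (x - p)) => ?; lia.
    have [a [ta an am]] := tau_surj m n tm lt_n.
    by have := tauE a am ta; have := thr a am ta; rewrite an; lia.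
  have s1 : m <= N.-1 - (m - p.*2) by lia.
  have s2 : N.-1 - (m - p.*2) < N by lia.
  have cm := top_through s1 s2; have ff := fK s2; set c := f _ in cm ff.
  have tc : thru c.
    rewrite /thru; apply/negPn/negP; rewrite negb_or => h'.
    by have := mid c ltac:(lia); rewrite ff; lia.
  have := tauE c cm tc; rewrite ff /tau; move: tc; rewrite /thru.
  by case: (ltnP c (x - p)) => ?; lia.
exists p; split=> // a am; split=> h.
  by have := tauE a am; rewrite /thru /tau h => ->.
have := tauE a am; rewrite /thru h orbT => -> //; rewrite /tau.
by case: (ltnP a (x - p)) => //; lia.
Qed.

End NatMatching.

Section Arcp.
Variables (m n : nat) (d : diagram m n).

(* The partner map in terms of ranks along the boundary. *)
Definition arcp (s : nat) : nat := at_pos 0 (fun p => pos (partner d p)) s.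

Lemma arcp_pos p : arcp (pos p) = pos (partner d p).
Proof. exact: at_posE. Qed.

Lemma pos_exists s : s < m + n -> exists p : pt m n, s = pos p.
Proof. by move=> sN; exists (unpos (Ordinal sN)); rewrite unposK. Qed.

Lemma arcp_lt s : s < m + n -> arcp s < m + n.
Proof. by case/pos_exists=> p ->; rewrite arcp_pos pos_ltn. Qed.

Lemma arcpK s : s < m + n -> arcp (arcp s) = s.
Proof. by case/pos_exists=> p ->; rewrite !arcp_pos partnerK. Qed.

Lemma arcpN s : s < m + n -> arcp s <> s.
Proof.
case/pos_exists=> p ->; rewrite arcp_pos => /pos_inj/eqP.
by rewrite (negPf (partnerN d p)).
Qed.

Lemma arcp_nc s t : s < t -> t < arcp s -> arcp s < arcp t -> t < m + n -> False.
Proof.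
move=> st ts sst tN; have sN := ltn_trans st tN.
have [p pE] := pos_exists sN; have [q qE] := pos_exists tN; subst s t.
move: ts sst; rewrite !arcp_pos; exact: partner_noncrossing.
Qed.

End Arcp.

Lemma pos_flip m n (p : pt m n) : pos (flip p) = (m + n).-1 - pos p.
Proof. by case: p => a /=; have := ltn_ord a; lia. Qed.

Lemma arcp_dflip m n (d : diagram m n) s : s < m + n ->
  arcp (dflip d) s = (m + n).-1 - arcp d ((m + n).-1 - s).
Proof.
rewrite addnC => sN; have [p ->] := pos_exists sN.
rewrite arcp_pos -{1}(flipK p) partner_dflip pos_flip -arcp_pos pos_flip.
by rewrite ![n + m]addnC.
Qed.

Definition bot_arc m n (d : diagram m n) j := (j.+1 < m) && (arcp d j == j.+1).
Definition top_arc m n (d : diagram m n) j := bot_arc (dflip d) j.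

(* The arcs of a diagram without top arcs whose adjacent bottom arcs all have
   the form (x-1, x): p nested arcs around the gap between x-1 and x. *)
Definition Erel m n (x p : nat) : rel (pt m n) := fun u v =>
  match u, v with
  | inl a, inl b => (x - p <= a < x + p) && ((a + b).+1 == x.*2)
  | inl a, inr b | inr b, inl a =>
      ((a < x - p) && (b == a :> nat)) || ((x + p <= a) && (a == b + p.*2 :> nat))
  | inr _, inr _ => false
  end.
Arguments Erel : clear implicits.

Lemma Erel_sym m n x p u v : Erel m n x p u v = Erel m n x p v u.
Proof. by case: u v => [a|a] [b|b] //=; apply/idP/idP; lia. Qed.

Lemma Erel_fun m n x p u v w : Erel m n x p u v -> Erel m n x p u w -> v = w.
Proof.
by case: u v w => [a|a] [b|b] [c|c] //=; have := ltn_ord a;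
  have := ltn_ord b; have := ltn_ord c => *; try lia; congr (_ _);
  apply: val_inj => /=; lia.
Qed.

(** These are the diagrams that survive between f_n on top and the juxtaposition of two Jones-Wenzl
    idempotents on x and m - x strands below: the only adjacent arc left is the one across the
    gap. *)
Lemma diagram_shape m n (d : diagram m n) x : x <= m ->
  (forall j, bot_arc d j -> j.+1 = x) -> (forall j, ~~ top_arc d j) ->
  exists p, [/\ n + p.*2 = m, p <= x, x + p <= m &
             forall u, Erel m n x p u (partner d u)].
Proof.
move=> xm hb ht.
have lt := @arcp_lt _ _ d; have fK := @arcpK _ _ d; have fN := @arcpN _ _ d.
have thr s : m <= s -> s < m + n -> arcp d s < m.
  move=> ms sN; rewrite ltnNge; apply/negP => mf.
  wlog lt_s : s ms sN mf / s < arcp d s.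
    move=> h; case: (ltngtP s (arcp d s)) => [|gt|/esym]; [exact: h| |exact: fN].
    by apply: (h (arcp d s)); rewrite ?fK ?lt.
  have [c /andP[c1 c2] cE] := adjacent_arc lt fK fN (@arcp_nc _ _ d) sN lt_s.
  have cN := lt _ sN; have ccN : c < m + n by lia.
  have /negP := ht ((m + n).-1 - c.+1); apply.
  rewrite /top_arc /bot_arc arcp_dflip; last by lia.
  have -> : (m + n).-1 - ((m + n).-1 - c.+1) = c.+1 by lia.
  by rewrite -cE fK //; lia.
have hb' j : j.+1 < m -> arcp d j = j.+1 -> j.+1 = x.
  by move=> jm jE; apply: hb; rewrite /bot_arc jm jE eqxx.
have [p [np px xp mid thru]] :=
  through_shape lt fK fN (@arcp_nc _ _ d) erefl hb' thr xm.
exists p; split=> //.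
have bot (a : 'I_m) : Erel m n x p (inl a) (partner d (inl a)).
  have := mid a; have := thru a (ltn_ord a); rewrite -[nat_of_ord a]/(pos (inl a : pt m n)).
  rewrite arcp_pos /=; have := ltn_ord a.
  by case: (partner d (inl a)) => b /=; have := ltn_ord b => *;
    case: (ltnP a (x - p)) => ?; case: (ltnP a (x + p)) => ?; lia.
case=> [a|b]; first exact: bot.
have : arcp d (pos (inr b : pt m n)) < m.
  by apply: thr => /=; have := ltn_ord b; lia.
rewrite arcp_pos; case e : (partner d (inr b)) => [a|c] /=; last first.
  by have := ltn_ord c; lia.
by move=> _; have := bot a; rewrite -e partnerK e Erel_sym.
Qed.

(** Certifies that [basisTL] of such a relation is one basis vector, rather than 0 or a sum of
    several. *)
Lemma rel_diagram m n (R : rel (pt m n)) :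
  (forall u v w, R u v -> R u w -> v = w) -> (forall u v, R u v -> R v u) ->
  (forall u, ~~ R u u) -> (forall u, exists v, R u v) ->
  (forall u v u' v', R u u' -> R v v' -> pos u < pos v -> pos v < pos u' ->
     pos u' < pos v' -> False) ->
  exists d : diagram m n, basisTL R = dg d /\ forall u, R u (partner d u).
Proof.
move=> Rfun Rsym Rirr Rtot Rnc.
have [f fR] := boolp.choice Rtot.
have fK : involutive f by move=> u; apply: Rfun (fR (f u)) (Rsym _ _ (fR u)).
have cr : crossingless [ffun u => f u].
  apply/crossinglessP; split=> [u|u|u v]; rewrite ?ffunE ?fK //.
    by apply/eqP => e; have /negP := Rirr u; apply; rewrite -{2}e.
  exact: Rnc.
pose d : diagram m n := Sub _ cr.
have dR u : R u (partner d u) by rewrite /partner ffunE.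
by exists d; split=> //; apply: basisTL_dg.
Qed.

Lemma E_diagram m n x p : n + p.*2 = m -> p <= x -> x + p <= m ->
  exists d : diagram m n, basisTL (Erel m n x p) = dg d /\
    forall u, Erel m n x p u (partner d u).
Proof.
move=> np px xp; apply: rel_diagram.
- exact: Erel_fun.
- by move=> u v; rewrite Erel_sym.
- by case=> a /=; lia.
- case=> a; have lt_a := ltn_ord a.
    case: (ltnP a (x - p)) => h1.
      have lt : a < n by lia.
      by exists (inr (Ordinal lt)) => /=; lia.
    case: (ltnP a (x + p)) => h2.
      have lt : x.*2 - a.+1 < m by lia.
      by exists (inl (Ordinal lt)) => /=; lia.
    have lt : a - p.*2 < n by lia.
    by exists (inr (Ordinal lt)) => /=; lia.
  case: (ltnP a (x - p)) => h1.
    have lt : a < m by lia.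
    by exists (inl (Ordinal lt)) => /=; lia.
  have lt : a + p.*2 < m by lia.
  by exists (inl (Ordinal lt)) => /=; lia.
by move=> [a|a] [b|b] [a'|a'] [b'|b'] //=; rewrite -?val_eqE /=;
  have := ltn_ord a; have := ltn_ord b;
  have := ltn_ord a'; have := ltn_ord b'; lia.
Qed.

Definition erel n j : rel (pt n n) := fun p q => match p, q with
    | inl a, inl b | inr a, inr b =>
        ((a == j.-1 :> nat) && (b == j :> nat))
        || ((a == j :> nat) && (b == j.-1 :> nat))
    | inl a, inr b | inr b, inl a =>
        [&& a == b, a != j.-1 :> nat & a != j :> nat]
    end.

Lemma e_diagram n j : 0 < j < n ->
  exists d : diagram n n, eTL n j = dg d /\ forall u, erel j u (partner d u).
Proof.
move=> jn; apply: (@rel_diagram n n (erel j)).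
- by move=> [a|a] [b|b] [c|c] /=; rewrite -?val_eqE /= => *; try lia;
    congr (_ _); apply: val_inj => /=; lia.
- by move=> [a|a] [b|b] //=; rewrite -?val_eqE /=; lia.
- by case=> a /=; lia.
- have j1 : j.-1 < n by lia.
  have j2 : j < n by lia.
  case=> a; (case: (nat_of_ord a =P j.-1) => [e1|n1];
    [|case: (nat_of_ord a =P j) => [e2|n2]]).
  + by exists (inl (Ordinal j2)); rewrite /= e1 !eqxx.
  + by exists (inl (Ordinal j1)); rewrite /= e2 !eqxx orbT.
  + by exists (inr a); rewrite /= eqxx /=; lia.
  + by exists (inr (Ordinal j2)); rewrite /= e1 !eqxx.
  + by exists (inr (Ordinal j1)); rewrite /= e2 !eqxx orbT.
  + by exists (inl a); rewrite /= eqxx /=; lia.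
by move=> [a|a] [b|b] [a'|a'] [b'|b'] //=; rewrite -?val_eqE /=;
  have := ltn_ord a; have := ltn_ord b;
  have := ltn_ord a'; have := ltn_ord b'; lia.
Qed.

Local Open Scope ring_scope.

(** * Caps, cups and generators *)

Definition capTL n j : TL n.+2 n := basisTL (Erel n.+2 n j.+1 1).
Definition cupTL n j : TL n n.+2 := reflTL (capTL n j).

(** Position, counted from 0, of the [i]-th point other than [j] and [j.+1]: the renumbering of
    through strands caused by a cap. *)
Definition skip2 j i : nat := if (i < j)%N then i else i.+2.

Lemma skip2P n j i : (j <= n)%N -> (i < n.+2)%N -> i <> j -> i <> j.+1 ->
  exists i', (i' < n)%N /\ i = skip2 j i'.
Proof.
move=> jn lt_i n1 n2; rewrite /skip2; case: (ltnP i j) => h.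
  by exists i; rewrite h; split; lia.
by exists (i - 2)%N; split; [|case: (ltnP (i - 2) j)]; lia.
Qed.

Lemma skip2_neq n j i : (i < n)%N ->
  [/\ (skip2 j i < n.+2)%N, skip2 j i <> j & skip2 j i <> j.+1].
Proof. by rewrite /skip2; case: (ltnP i j) => h lt_i; split; lia. Qed.

Lemma cap_diagram n j : (j <= n)%N -> exists d : diagram n.+2 n, capTL n j = dg d /\
  forall b t, sem d b t <-> [/\ size b = n.+2, size t = n,
    nth false b j = nth false b j.+1 &
    forall i, (i < n)%N -> nth false t i = nth false b (skip2 j i)].
Proof.
move=> jn; have [d [dE dR]] : exists d : diagram n.+2 n,
    basisTL (Erel n.+2 n j.+1 1) = dg d /\ forall u, Erel n.+2 n j.+1 1 u (partner d u).
  by apply: E_diagram; lia.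
exists d; split=> // b t; split=> [/semP[sb st h]|[sb st bj bt]].
  split=> //.
    have lt : (j < n.+2)%N by lia.
    have := h (inl (Ordinal lt)); have := dR (inl (Ordinal lt)).
    case: (partner d _) => a /=; last by lia.
    by move=> aE <-; have -> : a = j.+1 :> nat by lia.
  move=> i lt_i; have := h (inr (Ordinal lt_i)); have := dR (inr (Ordinal lt_i)).
  case: (partner d _) => a //= aE <-; congr nth; rewrite /skip2.
  by case: (ltnP i j) => ?; lia.
apply/semP; split=> // u; have := dR u; move: (partner d u).
have E (a : nat) c : (c < n)%N -> ((a < j.+1 - 1) && (c == a) || (j.+1 + 1 <= a) && (a == c + 1.*2))%N ->
    nth false t c = nth false b a.
  by move=> lt_c h; rewrite bt //; congr nth; rewrite /skip2; case: (ltnP c j) => ?; lia.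
case: u => [a|a] [c|c] //= h.
- have [[-> ->]|[-> ->]] : (a = j :> nat /\ c = j.+1 :> nat) \/ (c = j :> nat /\ a = j.+1 :> nat) by lia.
    by [].
  by [].
- exact: E h.
- by apply/esym/E.
Qed.

Lemma e_diagram_sem n j : (j.+1 < n)%N -> exists d : diagram n n, eTL n j.+1 = dg d /\
  forall b t, sem d b t <-> [/\ size b = n, size t = n,
    nth false b j = nth false b j.+1, nth false t j = nth false t j.+1 &
    forall i, (i < n)%N -> i <> j -> i <> j.+1 -> nth false b i = nth false t i].
Proof.
move=> jn; have [|d [dE dR]] := @e_diagram n j.+1; first by rewrite jn.
exists d; split=> // b t; split=> [/semP[sb st h]|[sb st bj tj bt]].
  have lt : (j < n)%N by lia.
  split=> //.
  - have := h (inl (Ordinal lt)); have := dR (inl (Ordinal lt)).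
    case: (partner d _) => a /=; rewrite -?val_eqE /=; last by lia.
    by move=> aE <-; have -> : a = j.+1 :> nat by lia.
  - have := h (inr (Ordinal lt)); have := dR (inr (Ordinal lt)).
    case: (partner d _) => a /=; rewrite -?val_eqE /=; first by lia.
    by move=> aE <-; have -> : a = j.+1 :> nat by lia.
  move=> i lt_i n1 n2; have := h (inl (Ordinal lt_i)); have := dR (inl (Ordinal lt_i)).
  case: (partner d _) => a /=; rewrite -?val_eqE /=; first by lia.
  by move=> aE <-; congr nth; lia.
apply/semP; split=> // u; have := dR u; move: (partner d u).
case: u => [a|a] [c|c] /=; rewrite -?val_eqE /= => h.
- by have [[-> ->]|[-> ->]] : (a = j :> nat /\ c = j.+1 :> nat) \/ (c = j :> nat /\ a = j.+1 :> nat) by lia.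
- by (have -> : c = a :> nat by lia); rewrite bt //; lia.
- by (have -> : c = a :> nat by lia); rewrite bt //; lia.
- by have [[-> ->]|[-> ->]] : (a = j :> nat /\ c = j.+1 :> nat) \/ (c = j :> nat /\ a = j.+1 :> nat) by lia.
Qed.

Lemma sum_words_pick n c0 (P : seq bool -> bool) (Q : bool) : size c0 = n ->
  (forall c, size c = n -> P c = (c == c0) && Q) ->
  (\sum_(c <- words n) P c = Q)%N.
Proof.
move=> s0 h; rewrite (@sum_words1 _ _ c0) // => [|c sc cc]; rewrite h //.
  by rewrite eqxx.
by rewrite (introF eqP cc).
Qed.

(** A unique compatible middle word makes the matrix entry 1, so no loop is closed and the product
    is a diagram with coefficient 1. *)
Lemma comp_pick l m n (x : diagram m n) (y : diagram l m) (z : diagram l n) :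
  (forall b t, exists c0, size c0 = m /\
     forall c, size c = m -> sem y b c && sem x c t <-> c = c0 /\ sem z b t) ->
  mulTL (dg x) (dg y) = dg z.
Proof.
move=> h; rewrite mulTL_dg.
have [-> ->] : comp x y = z /\ loops x y = 0%N; last by rewrite scale1r.
apply: comp_eqP => b t; rewrite muln1; have [c0 [s0 hc]] := h b t.
apply: sum_words_pick s0 _ => c sc; apply/idP/idP.
  by case/(hc c sc) => -> ->; rewrite eqxx.
by case/andP=> /eqP e1 e2; apply/(hc c sc).
Qed.

Lemma eTL_cupcap n j : (j <= n)%N -> eTL n.+2 j.+1 = mulTL (cupTL n j) (capTL n j).
Proof.
move=> jn; have [d [dE dS]] := cap_diagram jn.
have [e [eE eS]] := @e_diagram_sem n.+2 j ltac:(lia).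
rewrite /cupTL dE eE reflTL_dg; apply/esym/comp_pick => b t.
exists (mkseq (fun i => nth false t (skip2 j i)) n); split; first exact: size_mkseq.
move=> c sc; rewrite sem_dflip; split.
  case/andP=> /dS[sb _ bj cb] /dS[st _ tj ct]; split.
    apply: (@eq_from_nth _ false); rewrite ?size_mkseq sc // => i lt_i.
    by rewrite nth_mkseq // ct.
  apply/eS; split=> // i lt_i n1 n2.
  have [i' [lt_i' ->]] := skip2P jn lt_i n1 n2.
  by rewrite -cb // -ct.
case=> -> /eS[sb st bj tj bt]; apply/andP; split; apply/dS; rewrite size_mkseq; split=> // i lt_i.
  by have [h1 h2 h3] := skip2_neq j lt_i; rewrite nth_mkseq // -bt.
by rewrite nth_mkseq.
Qed.

(* The three points met by the two arcs carry the same colour. *)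
Lemma cap_e_adjacent n j k : (j <= n)%N -> (k <= n)%N -> (j == k.+1) || (k == j.+1) ->
  mulTL (capTL n j) (eTL n.+2 k.+1) = capTL n k.
Proof.
move=> jn kn jk; have [d [dE dS]] := cap_diagram jn.
have [d' [dE' dS']] := cap_diagram kn.
have [e [eE eS]] := @e_diagram_sem n.+2 k ltac:(lia).
rewrite dE eE dE'; apply: comp_pick => b t.
have [a jka] : exists a, (j = a /\ k = a.+1) \/ (j = a.+1 /\ k = a).
  by case/orP: jk => /eqP ->; [exists k|exists j]; tauto.
pose c0 := mkseq (fun i => nth false t (if (i < a)%N then i else if (i <= a.+2)%N then a else i.-2)) n.+2.
have c0E i : (i < n.+2)%N -> nth false c0 i =
    nth false t (if (i < a)%N then i else if (i <= a.+2)%N then a else i.-2).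
  by move=> lt_i; rewrite nth_mkseq.
exists c0; split; first exact: size_mkseq.
have c0w l i : l = a \/ l = a.+1 -> (i < n)%N -> nth false c0 (skip2 l i) = nth false t i.
  move=> la lt_i; rewrite c0E; last by case: (skip2_neq l lt_i).
  congr nth; rewrite /skip2; case: (ltnP i l) => h /=;
    by case: ifP => h1; [|case: ifP => h2]; lia.
have c0a i : (i < 3)%N -> nth false c0 (a + i) = nth false t a.
  move=> lt_i; rewrite c0E; last by lia.
  by congr nth; case: ifP => h1; [|case: ifP => h2]; lia.
have c0s : size c0 = n.+2 by exact: size_mkseq.
have ja : j = a \/ j = a.+1 by lia.
have ka : k = a \/ k = a.+1 by lia.
have c0j l : l = a \/ l = a.+1 -> nth false c0 l = nth false c0 l.+1.
  have := c0a 0 isT; have := c0a 1 isT; have := c0a 2 isT.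
  by rewrite addn0 addn1 addn2 => h2 h1 h0 [->|->]; rewrite ?h0 ?h1 ?h2.
clear c0E; clearbody c0.
move=> c sc; split.
  case/andP=> /eS[sb _ bk ck bc] /dS[_ st cj ct].
  have ca i : (i < 3)%N -> nth false c (a + i) = nth false t a.
    move=> i3; have -> : nth false t a = nth false c (skip2 j a) by rewrite ct //; lia.
    rewrite /skip2; case: jka => -[ja' ka']; subst j k; rewrite ?ltnn ?ltnSn.
      by case: i i3 => [|[|[|i]]] //= _; rewrite ?addn0 ?addn1 ?addn2 ?cj ?ck.
    by case: i i3 => [|[|[|i]]] //= _; rewrite ?addn0 ?addn1 ?addn2 -?cj -?ck.
  have cE : c = c0.
    apply: (@eq_from_nth _ false); rewrite sc ?c0s // => i lt_i.
    case: (boolP (a <= i < a.+3)%N) => h.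
      by (have -> : i = (a + (i - a))%N by lia); rewrite ca ?c0a //; lia.
    have [i' [lt_i' ->]] : exists i', (i' < n)%N /\ i = skip2 j i' by apply: skip2P; lia.
    by rewrite c0w // ct.
  split=> //; apply/dS'; split=> // i lt_i.
  have [h1 h2 h3] := skip2_neq k lt_i.
  by rewrite bc // cE c0w.
case=> -> /dS'[sb st bk bt]; apply/andP; split; last first.
  by apply/dS; split=> // [|i lt_i]; [exact: c0j | rewrite c0w].
apply/eS; split=> // [|i lt_i n1 n2]; first exact: c0j.
by have [i' [lt_i' ->]] := skip2P kn lt_i n1 n2; rewrite c0w // bt.
Qed.

Lemma bot_arcP m n (d : diagram m n) j :
  reflect (exists a a' : 'I_m, [/\ a = j :> nat, a' = j.+1 :> nat &
             partner d (inl a) = inl a']) (bot_arc d j).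
Proof.
apply: (iffP andP) => [[jm /eqP jE]|[a [a' [aj aj' e]]]].
  have lt : (j < m)%N by lia.
  exists (Ordinal lt), (Ordinal jm); split=> //.
  by apply: pos_inj; rewrite -arcp_pos.
by rewrite -aj' -aj; split; rewrite // -[nat_of_ord a]/(pos (inl a : pt m n)) arcp_pos e.
Qed.

Lemma sem_recolour m n (d : diagram m n) j b c t : bot_arc d j ->
  size b = m -> nth false b j = nth false b j.+1 ->
  (forall i, (i < m)%N -> i <> j -> i <> j.+1 -> nth false b i = nth false c i) ->
  sem d c t -> sem d b t.
Proof.
case/bot_arcP=> a [a' [aj aj' e]] sb bj bc /semP[sc st h]; apply/semP; split=> // u.
have e' : partner d (inl a') = inl a by rewrite -e partnerK.
have E v : v <> inl a -> v <> inl a' -> colour b t v = colour c t v.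
  case: v => // i n1 n2 /=; apply: bc => // ij.
    by case: n1; congr inl; apply: val_inj; rewrite /= ij.
  by case: n2; congr inl; apply: val_inj; rewrite /= ij.
case: (u =P inl a) => [->|n1]; first by rewrite e /= aj aj'.
case: (u =P inl a') => [->|n2]; first by rewrite e' /= aj aj'.
rewrite !E // => e1; [case: n2|case: n1];
  by rewrite -[u](partnerK d) e1.
Qed.

(** The top arc of the generator closes the bottom arc of [d] into a loop, and its bottom arc
    replaces it. The compatible middle words [c0 v] differ only in the colour [v] of this loop,
    which is the factor 2 of one loop. *)
Lemma bot_arc_e m n (d : diagram m n) j : bot_arc d j ->
  mulTL (dg d) (eTL m j.+1) = delta *: dg d.
Proof.
move=> dj; case/andP: (dj) => jm _; have [e [-> eS]] := e_diagram_sem jm.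
rewrite mulTL_dg; have [-> ->] : comp d e = d /\ loops d e = 1%N; last by rewrite expr1.
apply: comp_eqP => b t; rewrite expn1 muln2 -addnn.
pose c0 v := mkseq (fun i => if (i == j) || (i == j.+1) then v else nth false b i) m.
have c0E v i : (i < m)%N -> nth false (c0 v) i =
    if (i == j) || (i == j.+1) then v else nth false b i.
  by move=> lt_i; rewrite nth_mkseq.
have c0s v : size (c0 v) = m by exact: size_mkseq.
have c0ne : c0 false != c0 true.
  apply/eqP => /(congr1 (fun w => nth false w j)).
  by rewrite !c0E ?eqxx //; lia.
have P c : size c = m -> sem e b c && sem d c t =
    ((c == c0 false) || (c == c0 true)) && sem d b t.
  move=> sc; apply/andP/andP => [[/eS[sb _ bj cj bc] dc]|[cc dt]].
    split; last by apply: sem_recolour dj sb bj bc dc.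
    have -> : c = c0 (nth false c j).
      apply: (@eq_from_nth _ false); rewrite sc ?c0s // => i lt_i.
      rewrite c0E //; case: eqP => [->|n1] //=.
      by case: eqP => [->|n2] //; rewrite bc.
    by case: (nth false c j); rewrite eqxx ?orbT.
  have [v ->] : exists v, c = c0 v by case/orP: cc => /eqP ->; eexists.
  have [sb _ _] := semP _ _ _ dt.
  have bj : nth false b j = nth false b j.+1.
    case/bot_arcP: (dj) => a [a' [aj aj' ae]]; case/semP: dt => _ _ /(_ (inl a)).
    by rewrite ae /= aj aj'.
  have cj : nth false (c0 v) j = nth false (c0 v) j.+1.
    by rewrite !c0E ?eqxx ?orbT //; lia.
  have bc i : (i < m)%N -> i <> j -> i <> j.+1 -> nth false (c0 v) i = nth false b i.
    by move=> lt_i n1 n2; rewrite c0E // (introF eqP n1) (introF eqP n2).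
  split; last exact: sem_recolour dj (c0s v) cj bc dt.
  by apply/eS; split=> // i lt_i n1 n2; rewrite bc.
transitivity (\sum_(c <- words m) ((c == c0 false) && sem d b t + ((c == c0 true) && sem d b t)))%N.
  rewrite big_seq [RHS]big_seq; apply: eq_bigr => c; rewrite mem_words => /eqP sc.
  rewrite P //; case: eqP => [->|_] /=; first by rewrite (negPf c0ne) addn0.
  by case: eqP.
rewrite big_split /= (sum_words_pick (c0 := c0 false) (Q := sem d b t)) //.
by rewrite (sum_words_pick (c0 := c0 true) (Q := sem d b t)).
Qed.

(** The cap acts on the last two strands, which the generator does not meet. *)
Lemma cap_e_last n j : (0 < j < n)%N ->
  mulTL (capTL n n) (eTL n.+2 j) = mulTL (eTL n j) (capTL n n).
Proof.
case: j => // j jn; have [d [-> dS]] := @cap_diagram n n (leqnn n).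
have [e [-> eS]] := @e_diagram_sem n.+2 j ltac:(lia).
have [e' [-> eS']] := @e_diagram_sem n j ltac:(lia).
have sk i : (i < n)%N -> skip2 n i = i by rewrite /skip2 => ->.
have capS b t : sem d b t <-> [/\ size b = n.+2, nth false b n = nth false b n.+1 & t = take n b].
  split=> [/dS[sb st bn bt]|[sb bn ->]].
    split=> //; apply: (@eq_from_nth _ false) => [|i]; rewrite ?size_takel ?sb ?st //; try lia.
    by move=> lt_i; rewrite nth_take // bt // sk.
  apply/dS; split; rewrite ?size_takel ?sb //; first lia.
  by move=> i lt_i; rewrite nth_take // sk.
(* A middle word of this product can only be the truncation of [b] to its first [n] letters; the
   entry at the all-false words then shows that no loop is closed. *)
have [g gS] : exists g : diagram n.+2 n, mulTL (dg e') (dg d) = dg g /\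
   forall b t, sem g b t <-> [/\ size b = n.+2, nth false b n = nth false b n.+1 & sem e' (take n b) t].
  pose g := comp e' d; have l0 : loops e' d = 0%N.
    have := sem_comp e' d (nseq n.+2 false) (nseq n false).
    rewrite (sum_words_pick (c0 := nseq n false) (Q := true)) ?size_nseq //.
      rewrite sem0 mul1n; case: (loops e' d) => // k; rewrite expnS; lia.
    move=> c sc; rewrite andbT; apply/andP/eqP => [[/capS[_ _ ->] _]|->].
      by rewrite take_nseq //; lia.
    by rewrite !sem0.
  exists g; split; first by rewrite mulTL_dg l0 scale1r.
  move=> b t; have := sem_comp e' d b t; rewrite l0 muln1.
  rewrite (sum_words_pick (c0 := take n (b ++ nseq n false)) (Q := [&& size b == n.+2, nth false b n == nth false b n.+1 & sem e' (take n b) t])).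
  - move=> h; split.
      by move=> gs; move: h; rewrite gs; case: (boolP [&& _, _ & _]) => // /and3P[/eqP ? /eqP ? ?].
    by case=> /eqP h1 /eqP h2 h3; move: h; rewrite h1 h2 h3; case: sem.
  - by rewrite size_takel // size_cat size_nseq leq_addl.
  move=> c sc; apply/andP/andP => [[/capS[sb bn cE] ec]|[/eqP -> /and3P[/eqP sb /eqP bn h]]].
    rewrite sb eqxx bn eqxx -cE ec takel_cat ?sb; last by lia.
    by rewrite cE.
  rewrite takel_cat ?sb; last by lia.
  by split=> //; apply/capS.
case: gS => -> gS; apply: comp_pick => b t.
pose c0 := mkseq (fun i => if (i < n)%N then nth false t i else nth false b i) n.+2.
have c0E i : (i < n.+2)%N -> nth false c0 i = if (i < n)%N then nth false t i else nth false b i.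
  by move=> lt_i; rewrite nth_mkseq.
have c0s : size c0 = n.+2 by exact: size_mkseq.
exists c0; split=> // c sc; split.
  case/andP=> /eS[sb _ bj cj bc] /capS[_ cn tE]; split.
    apply: (@eq_from_nth _ false); rewrite sc ?c0s // => i lt_i.
    rewrite c0E // tE; case: (ltnP i n) => h; first by rewrite nth_take.
    by rewrite bc //; lia.
  apply/gS; split=> //; first by rewrite !bc //; lia.
  apply/eS'; rewrite tE !size_takel ?sb ?sc; try lia.
  split=> //; rewrite ?nth_take //; try lia.
  by move=> i lt_i n1 n2; rewrite !nth_take // bc //; lia.
case=> -> /gS[sb bn /eS'[s1 st bj tj bt]].
have c0t : take n c0 = t.
  apply: (@eq_from_nth _ false) => [|i]; rewrite size_takel ?c0s ?st //; try lia.
  by move=> lt_i; rewrite nth_take // c0E ?lt_i //; lia.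
apply/andP; split; last first.
  apply/capS; split; rewrite ?c0t // !c0E //.
  by rewrite ltnn; have -> : (n.+1 < n)%N = false by lia.
have jn1 : (j < n)%N by lia.
have jn2 : (j.+1 < n)%N by lia.
apply/eS; split=> //.
- by rewrite -(nth_take (n0 := n) false jn1) bj nth_take.
- by rewrite !c0E ?jn1 ?jn2 //; lia.
move=> i lt_i n1 n2; rewrite c0E //; case: (ltnP i n) => h //.
by rewrite -bt // nth_take.
Qed.

(** ** Compatibility with juxtaposition *)

Lemma tens_e_id n i j : (0 < j < n)%N ->
  tensTL (eTL n j) (idTL i) = eTL (n + i) j.
Proof.
move=> jn; have [d [-> dR]] := e_diagram jn.
have [e [-> eR]] := @e_diagram (n + i) j ltac:(lia).
rewrite idTLE tensTL_dg; congr dg; apply: diagram_eqP => u.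
have fR u0 v w : erel j u0 v -> erel j u0 w -> v = w :> pt (n + i) (n + i).
  by case: u0 v w => [a|a] [b|b] [c|c] /=; rewrite -?val_eqE /= => *; try lia;
    congr (_ _); apply: val_inj => /=; lia.
apply: fR (eR u); case: (pt_split u) => -[q ->].
  rewrite partner_dtensl; have := dR q.
  by case: q (partner d q) => [a|a] [b|b] /=; rewrite -?val_eqE /=; lia.
rewrite partner_dtensr partner_mk.
by case: q => a /=; rewrite -?val_eqE /=; lia.
Qed.

Lemma tens_id_e n i j : (0 < j < i)%N ->
  tensTL (idTL n) (eTL i j) = eTL (n + i) (n + j).
Proof.
move=> jn; have [d [-> dR]] := e_diagram jn.
have [e [-> eR]] := @e_diagram (n + i) (n + j) ltac:(lia).
rewrite idTLE tensTL_dg; congr dg; apply: diagram_eqP => u.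
have fR u0 v w : erel (n + j) u0 v -> erel (n + j) u0 w -> v = w :> pt (n + i) (n + i).
  by case: u0 v w => [a|a] [b|b] [c|c] /=; rewrite -?val_eqE /= => *; try lia;
    congr (_ _); apply: val_inj => /=; lia.
apply: fR (eR u); case: (pt_split u) => -[q ->].
  rewrite partner_dtensl partner_mk.
  by case: q => a /=; rewrite -?val_eqE /=; have := ltn_ord a; lia.
rewrite partner_dtensr; have := dR q.
by case: q (partner d q) => [a|a] [b|b] /=; rewrite -?val_eqE /=; lia.
Qed.

Lemma bot_arc_dtensl m n m' n' (x : diagram m n) (y : diagram m' n') j :
  bot_arc x j -> bot_arc (dtens x y) j.
Proof.
case/bot_arcP=> a [a' [aj aj' e]]; apply/bot_arcP.
exists (lshift m' a), (lshift m' a'); split=> //.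
by rewrite -[inl (lshift m' a)]/(ptl m' n' (inl a)) partner_dtensl e.
Qed.

Lemma bot_arc_dtensr m n m' n' (x : diagram m n) (y : diagram m' n') j :
  bot_arc y j -> bot_arc (dtens x y) (m + j).
Proof.
case/bot_arcP=> a [a' [aj aj' e]]; apply/bot_arcP.
exists (rshift m a), (rshift m a'); split; rewrite /= ?aj ?aj' ?addnS //.
by rewrite -[inl (rshift m a)]/(ptr m n (inl a)) partner_dtensr e.
Qed.

(** ** Persistence of arcs *)

Lemma bot_arc_comp l m n (x : diagram m n) (y : diagram l m) j :
  bot_arc y j -> bot_arc (comp x y) j.
Proof.
case/bot_arcP=> a [a' [aj aj' e]]; apply/bot_arcP; exists a, a'; split=> //.
apply/eqP; rewrite partner_comp; apply/andP; split.
  by apply/eqP => -[] aa; move: aj'; rewrite -aa aj; lia.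
by apply: connect1; rewrite /= e.
Qed.

Lemma top_arc_comp l m n (x : diagram m n) (y : diagram l m) j :
  top_arc x j -> top_arc (comp x y) j.
Proof.
by rewrite /top_arc; have [<- _] := comp_dflip x y; apply: bot_arc_comp.
Qed.

Lemma coef_top_arc l m n (x : diagram m n) (Y : TL l m) (d : diagram l n) j :
  top_arc x j -> ~~ top_arc d j -> coef d (mulTL (dg x) Y) = 0.
Proof.
move=> xj dj; elim/TL_ind: Y => [|a y Y IH]; first by rewrite mulTL0 coefTL0.
rewrite mulTLDr mulTLZr mulTL_dg coefTLP IH addr0.
rewrite coefTLZ coef_dg; case: eqP => [e|_]; last by rewrite !mulr0.
by move: dj; rewrite e top_arc_comp.
Qed.

Lemma coef_bot_arc l m n (X : TL m n) (y : diagram l m) (d : diagram l n) j :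
  bot_arc y j -> ~~ bot_arc d j -> coef d (mulTL X (dg y)) = 0.
Proof.
move=> xj dj; elim/TL_ind: X => [|a x X IH]; first by rewrite mulTL0l coefTL0.
rewrite mulTLDl mulTLZl mulTL_dg coefTLP IH addr0.
rewrite coefTLZ coef_dg; case: eqP => [e|_]; last by rewrite !mulr0.
by move: dj; rewrite e bot_arc_comp.
Qed.

(** ** Diagrams without arcs *)

(** In [diagram_shape] a gap at 0 leaves no room for nested arcs, so every strand goes straight
    through. *)
Lemma no_arc_id m n (d : diagram m n) :
  (forall j, ~~ bot_arc d j) -> (forall j, ~~ top_arc d j) ->
  exists e : m = n, dg d = castTL erefl e (idTL m).
Proof.
move=> hb ht; have [j bj|p [np p0 _ dR]] := diagram_shape (leq0n m) _ ht.
  by have := hb j; rewrite bj.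
have p00 : p = 0%N by lia.
subst p; have mn : m = n by lia.
exists mn; subst n; rewrite [castTL _ _ _]/= idTLE; congr dg; apply: diagram_eqP => u.
apply: Erel_fun (dR u) _; rewrite partner_mk; case: u => a /=; rewrite ?addn0 eqxx ?orbT //; lia.
Qed.

Lemma bot_arc_did n j : ~~ bot_arc (did n) j.
Proof. by apply/bot_arcP => -[a [a' [_ _]]]; rewrite partner_mk. Qed.

Lemma top_arc_did n j : ~~ top_arc (did n) j.
Proof. by rewrite /top_arc dflip_id bot_arc_did. Qed.

(** * Braid words *)

(** The decreasing indices [s + n - 1], ..., [s]: one strand crossing [n] neighbours. *)
Definition down n s : seq nat := rev (iota s n).

(* The crossing of i strands over n strands. *)
Definition cross n i : seq nat := flatten [seq down n t | t <- iota 1 i].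

(** A positive word of the half twist, the Garside element of the braid group; its square is the
    full twist. *)
Definition half n : seq nat := flatten [seq down m 1 | m <- iota 0 n].

Definition full n : seq nat := half n ++ half n.

Lemma downS n s : down n.+1 s = (s + n)%N :: down n s.
Proof. rewrite /down -[n.+1]addn1 iotaD rev_cat. exact: erefl. Qed.

Lemma down_cat m n s : down (m + n) s = down n (s + m) ++ down m s.
Proof. by rewrite /down iotaD rev_cat. Qed.

Lemma crossS n i : cross n i.+1 = cross n i ++ down n i.+1.
Proof.
rewrite /cross; have -> : iota 1 i.+1 = iota 1 i ++ [:: i.+1].
  by rewrite -[i.+1 in LHS]addn1 iotaD.
by rewrite map_cat flatten_cat /= cats0.
Qed.

Lemma map_down c n s : map (addn c) (down n s) = down n (c + s).
Proof. by rewrite /down map_rev iotaDl. Qed.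

Lemma map_cross c n i : map (addn c) (cross n i) = flatten [seq down n (c + t) | t <- iota 1 i].
Proof.
by rewrite /cross map_flatten -map_comp; congr flatten; apply: eq_map => t /=; rewrite map_down.
Qed.

Lemma cross0 i : cross 0 i = [::].
Proof. by rewrite /cross; elim: (iota 1 i). Qed.

Lemma crossD n a b : cross n (a + b) = cross n a ++ map (addn a) (cross n b).
Proof.
rewrite map_cross /cross iotaD map_cat flatten_cat addnC iotaDl -map_comp.
by congr (_ ++ flatten _); apply: eq_map.
Qed.

Lemma iota1S m : iota 1 m.+1 = iota 1 m ++ [:: m.+1].
Proof. by rewrite -[m.+1 in LHS]addn1 iotaD. Qed.

Lemma halfS n : half n.+1 = half n ++ down n 1.
Proof. by rewrite /half -[n.+1]addn1 iotaD map_cat flatten_cat /= cats0. Qed.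

Lemma mem_down n s a : (a \in down n s) = (s <= a < s + n)%N.
Proof. by rewrite /down mem_rev mem_iota. Qed.

Lemma mem_cross n i a : a \in cross n i -> (0 < a < n + i)%N.
Proof.
elim: i => [|i IH]; first by rewrite in_nil.
by rewrite crossS mem_cat => /orP[/IH|]; rewrite ?mem_down; lia.
Qed.

Lemma mem_half n a : a \in half n -> (0 < a < n)%N.
Proof.
elim: n => [|n IH]; first by rewrite in_nil.
by rewrite halfS mem_cat => /orP[/IH|]; rewrite ?mem_down; lia.
Qed.

Lemma mem_full n a : a \in full n -> (0 < a < n)%N.
Proof. by rewrite mem_cat => /orP[]; apply: mem_half. Qed.

Lemma size_half n : ((size (half n)).*2 = n * n.-1)%N.
Proof.
elim: n => // n IH; rewrite halfS size_cat doubleD IH /down size_rev size_iota /=.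
by case: n {IH} => // n; rewrite -muln2 /=; nia.
Qed.

Section Braid.
Variables (R : pzRingType) (N : nat) (sg : nat -> R).
Hypothesis far : forall a b, (0 < a)%N -> (a.+1 < b)%N -> (b < N)%N ->
  sg a * sg b = sg b * sg a.
Hypothesis braid : forall a, (0 < a)%N -> (a.+1 < N)%N ->
  sg a * sg a.+1 * sg a = sg a.+1 * sg a * sg a.+1.

Definition ev (w : seq nat) : R := \prod_(a <- w) sg a.

Lemma ev_cat u v : ev (u ++ v) = ev u * ev v.
Proof. exact: big_cat. Qed.

Lemma ev_cons a v : ev (a :: v) = sg a * ev v.
Proof. exact: big_cons. Qed.

Lemma ev_nil : ev [::] = 1.
Proof. exact: big_nil. Qed.

Lemma ev_seq1 a : ev [:: a] = sg a.
Proof. exact: big_seq1. Qed.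

Lemma ev_comm x w : (forall a, a \in w -> x * sg a = sg a * x) -> x * ev w = ev w * x.
Proof.
elim: w => [|a w IH] h; first by rewrite ev_nil mulr1 mul1r.
rewrite ev_cons mulrA h ?mem_head // -!mulrA IH // => b bw.
by apply: h; rewrite in_cons bw orbT.
Qed.

Lemma far_ev a w : (0 < a < N)%N ->
  (forall b, b \in w -> [&& 0 < b, b < N & (a.+1 < b) || (b.+1 < a)])%N ->
  sg a * ev w = ev w * sg a.
Proof.
case/andP=> a0 aN h; apply: ev_comm => b /h /and3P[b0 bN /orP[ab|ba]].
  exact: far.
by apply/esym/far.
Qed.

Lemma far_evev u w :
  (forall a b, a \in u -> b \in w -> [&& 0 < a, a < N, 0 < b, b < N &
     (a.+1 < b) || (b.+1 < a)])%N ->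
  ev u * ev w = ev w * ev u.
Proof.
move=> h; apply: ev_comm => b bw; apply/esym/ev_comm => a au.
by have /and5P[a0 aN b0 bN /orP[ab|ba]] := h a b au bw; [apply/esym/far | apply: far].
Qed.

(** A generator slides through the word by far commutation until it meets its two neighbours; there
    the braid relation lowers its index by one. *)
Lemma down_shift n s t : (0 < s <= t)%N -> (t.+1 < s + n <= N)%N ->
  ev (down n s) * sg t.+1 = sg t * ev (down n s).
Proof.
elim: n => [|n IH] st tn; first lia.
rewrite downS ev_cons -mulrA.
case: (ltnP t.+1 (s + n)) => h.
  rewrite IH; try lia.
  by rewrite !mulrA (@far t) //; lia.
have -> : (s + n = t.+1)%N by lia.
case: n IH tn h => [|n] _ tn h; first lia.
have e : (s + n = t)%N by lia.
rewrite downS e ev_cons -!mulrA -(@far_ev t.+1); first last.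
- by move=> b; rewrite mem_down; lia.
- lia.
by rewrite !mulrA -braid //; lia.
Qed.

(** Two parallel strands crossing [n] others carry their mutual crossing along, from index [t] to
    index [t + n]. *)
Lemma down_down n t : (0 < t)%N -> (t + n < N)%N ->
  ev (down n t) * ev (down n t.+1) * sg t = sg (t + n) * (ev (down n t) * ev (down n t.+1)).
Proof.
elim: n => [|n IH] t0 tn; first by rewrite /down /= !ev_nil addn0 !(mul1r, mulr1).
rewrite !downS !ev_cons.
have c1 : ev (down n t) * sg (t.+1 + n) = sg (t.+1 + n) * ev (down n t).
  apply/esym/far_ev; first lia.
  by move=> b; rewrite mem_down; lia.
have c2 : sg (t + n) * ev (down n t) * (sg (t.+1 + n) * ev (down n t.+1)) =
    sg (t + n) * sg (t + n).+1 * (ev (down n t) * ev (down n t.+1)).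
  by rewrite -!mulrA (mulrA (ev (down n t))) c1 -!mulrA addSn.
rewrite c2 -mulrA IH; try lia.
by rewrite !mulrA braid ?addnS //; lia.
Qed.

Lemma cross_shiftl n i t : (0 < t < i)%N -> (n + i <= N)%N ->
  ev (cross n i) * sg t = sg (n + t) * ev (cross n i).
Proof.
elim: i => [|i IH] ti nN; first lia.
rewrite crossS ev_cat.
case: (ltnP t i) => h.
  rewrite -mulrA -(@far_ev t); first last.
  - by move=> b; rewrite mem_down; lia.
  - lia.
  by rewrite mulrA IH ?mulrA //; lia.
have -> : t = i by lia.
case: i IH ti nN h => [|i] _ ti nN h; first lia.
rewrite crossS ev_cat -!mulrA (mulrA (ev (down n i.+1))) down_down; try lia.
rewrite !mulrA -(@far_ev (i.+1 + n)) ?[(n + i.+1)%N]addnC //; first lia.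
by move=> b /mem_cross; lia.
Qed.

Lemma cross_shiftr n i t : (0 < t < n)%N -> (n + i <= N)%N ->
  ev (cross n i) * sg (i + t) = sg t * ev (cross n i).
Proof.
elim: i => [|i IH] ti nN; first by rewrite /cross /= ev_nil mul1r mulr1.
rewrite crossS ev_cat -mulrA addSn down_shift; try lia.
by rewrite mulrA IH ?mulrA //; lia.
Qed.

Lemma cross_evl n i w : (forall a, a \in w -> (0 < a < i)%N) -> (n + i <= N)%N ->
  ev (cross n i) * ev w = ev (map (addn n) w) * ev (cross n i).
Proof.
elim: w => [|a w IH] h nN; first by rewrite ev_nil mulr1 mul1r.
rewrite /= !ev_cons mulrA cross_shiftl ?h ?mem_head //.
by rewrite -!mulrA IH // => b bw; apply: h; rewrite in_cons bw orbT.
Qed.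

Lemma cross_evr n i w : (forall a, a \in w -> (0 < a < n)%N) -> (n + i <= N)%N ->
  ev (cross n i) * ev (map (addn i) w) = ev w * ev (cross n i).
Proof.
elim: w => [|a w IH] h nN; first by rewrite ev_nil mulr1 mul1r.
rewrite /= !ev_cons mulrA cross_shiftr ?h ?mem_head //.
by rewrite -!mulrA IH // => b bw; apply: h; rewrite in_cons bw orbT.
Qed.

(** A half twist of two groups is a half twist of each together with one crossing of the groups.
    When a strand is added to the second group, its word splits into the part crossing the first
    group and the part inside the second, and [half i] commutes past the former. *)
Lemma halfD n i : (n + i <= N)%N ->
  ev (half (n + i)) = ev (half n) * ev (cross n i) * ev (half i).
Proof.
elim: i => [|i IH] nN; first by rewrite addn0 /cross /half /= ev_nil !mulr1.
rewrite addnS !halfS crossS !ev_cat IH; last lia.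
have -> : down (n + i) 1 = down n i.+1 ++ down i 1.
  by rewrite addnC down_cat add1n.
rewrite ev_cat -!mulrA; congr (_ * (_ * _)); rewrite !mulrA; congr (_ * _).
apply: far_evev => a b /mem_half; rewrite mem_down; lia.
Qed.

Lemma cross_stack n m i : (n + m + i <= N)%N ->
  ev (cross (n + m) i) = ev (map (addn n) (cross m i)) * ev (cross n i).
Proof.
elim: i => [|i IH] nN; first by rewrite /cross /= ev_nil mulr1.
rewrite !crossS map_cat !ev_cat IH; last lia.
have -> : down (n + m) i.+1 = map (addn n) (down m i.+1) ++ down n i.+1.
  by rewrite down_cat /down map_rev -iotaDl addnC.
rewrite ev_cat !mulrA; congr (_ * _); rewrite -!mulrA; congr (_ * _).
apply: far_evev => a b /mem_cross an /mapP[b' +] ->; rewrite mem_down; lia.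
Qed.

(** The half twist turns the row of strands over, so conjugation by it sends the crossing [t] to
    [n - t]; this is why its square is central. *)
Lemma half_flip n t : (0 < t < n)%N -> (n <= N)%N ->
  ev (half n) * sg t = sg (n - t) * ev (half n).
Proof.
elim: n t => [|m IH] t tn nN; first lia.
(* Splitting off the last strand or the first one: the second form treats all crossings but the
   last, the first form treats that one. *)
have e1 : ev (half m.+1) = ev (half m) * ev (down m 1) by rewrite halfS ev_cat.
have e2 : ev (half m.+1) = ev (cross 1 m) * ev (half m).
  by rewrite -[m.+1]add1n halfD // /half /= ev_nil mul1r.
case: (ltnP t m) => h.
  rewrite e2 -mulrA IH //; try lia.
  by rewrite !mulrA cross_shiftl; [congr (sg _ * _ * _)| |]; lia.
case: t tn h => [|[|t]] // tn h.
  have -> : m = 1%N by lia.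
  by rewrite /half /down /= /ev /= !big_seq1.
rewrite e1 -mulrA down_shift; try lia.
by rewrite mulrA IH ?mulrA; [congr (sg _ * _ * _)| |]; lia.
Qed.

Lemma full_central n t : (0 < t < n)%N -> (n <= N)%N ->
  sg t * ev (full n) = ev (full n) * sg t.
Proof.
move=> tn nN; have -> : ev (full n) = ev (half n) * ev (half n) by apply: ev_cat.
rewrite -[RHS]mulrA half_flip // [RHS]mulrA half_flip; try lia.
by rewrite -[RHS]mulrA; congr (sg _ * _); lia.
Qed.

(* The full twist of n + i strands is made of the full twists of the first n and
   of the last i strands and of the double crossing of these two groups. *)
Lemma fullD n i : (n + i <= N)%N ->
  ev (full (n + i)) =
  ev (map (addn n) (full i)) * ev (full n) * (ev (cross n i) * ev (cross i n)).
Proof.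
move=> nN; rewrite ev_cat halfD // [X in _ * X](_ : _ = ev (half (i + n))); last first.
  by rewrite [(i + n)%N]addnC halfD.
rewrite halfD; last by rewrite addnC.
have c1 := @cross_evl n i (full i) (@mem_full i) nN.
have c2 : ev (cross i n) * ev (half n) = ev (map (addn i) (half n)) * ev (cross i n).
  by apply: cross_evl; [exact: mem_half|rewrite addnC].
have c3 := @cross_evr n i (half n) (@mem_half n) nN.
have c4 : ev (half n) * ev (map (addn n) (full i)) = ev (map (addn n) (full i)) * ev (half n).
  apply: far_evev => a b /mem_half an /mapP[b' /mem_full b'i ->]; lia.
transitivity (ev (half n) * (ev (cross n i) * ev (full i)) * (ev (cross i n) * ev (half n))).
  by rewrite [ev (full i)]ev_cat !mulrA.
rewrite c1 c2 !mulrA c4 -!mulrA (mulrA (ev (cross n i))) c3.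
by rewrite [ev (full n)]ev_cat !mulrA.
Qed.

(** The strand [n.+1] winding once around the first [n]: the Jucys-Murphy element for single
    strands. *)
Definition jm n : R := ev (cross n 1) * ev (cross 1 n).

Lemma jm0 : jm 0 = 1.
Proof. by rewrite /jm /cross /= ev_nil mulr1. Qed.

Lemma jmS n : jm n.+1 = sg n.+1 * jm n * sg n.+1.
Proof.
have c1 m : cross m 1 = down m 1 by rewrite /cross /= cats0.
have c2 : cross 1 n.+1 = cross 1 n ++ [:: n.+1] by rewrite crossS.
by rewrite /jm c2 !c1 downS add1n ev_cat ev_seq1 ev_cons !mulrA.
Qed.

Lemma full_jm n : (n.+1 <= N)%N -> ev (full n.+1) = ev (full n) * jm n.
Proof. by move=> nN; rewrite -addn1 fullD ?addn1 // /full /half /= ev_nil mul1r. Qed.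

End Braid.

(** * Crossings in the Kauffman bracket *)

Section TemperleyLiebRelations.
Variables (F : fieldType) (al dl : F) (R : algType F) (N : nat) (e : nat -> R).
Hypothesis al0 : al != 0.
Hypothesis dlE : dl = - al ^+ 2 - al ^- 2.
Hypothesis e_sq : forall a, (0 < a < N)%N -> e a * e a = dl *: e a.
Hypothesis e_up : forall a, (0 < a)%N -> (a.+1 < N)%N -> e a * e a.+1 * e a = e a.
Hypothesis e_down : forall a, (0 < a)%N -> (a.+1 < N)%N -> e a.+1 * e a * e a.+1 = e a.+1.
Hypothesis e_far : forall a b, (0 < a)%N -> (a.+1 < b)%N -> (b < N)%N -> e a * e b = e b * e a.

Definition kauffman a : R := al^-1 *: 1 + al *: e a.
Notation sg := kauffman.

(** The framing factor of the bracket: a crossing that is capped off is -A^3 times the cap. *)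
Let coef_curl : al^-1 + al * dl = - al ^+ 3.
Proof. by rewrite dlE; field. Qed.

(** The cancellation behind the second Reidemeister move; it allows a strand to be pulled across a
    cap in [e_sg_sg] and [sg_sg_e]. *)
Let coef_kauffman : al^-1 * al^-1 + dl + al * al = 0.
Proof. by rewrite dlE; field. Qed.

Lemma e_sg a : (0 < a < N)%N -> e a * sg a = - al ^+ 3 *: e a.
Proof.
move=> aN; rewrite /sg mulrDr -!scalerAr mulr1 e_sq // scalerA -scalerDl.
by rewrite coef_curl.
Qed.

Lemma sg_comm a b : e a * e b = e b * e a -> sg a * sg b = sg b * sg a.
Proof.
move=> h; rewrite /sg !mulrDl !mulrDr -!scalerAl -!scalerAr !mulr1 !mul1r h.
by rewrite !scalerA [al^-1 * al]mulrC -!addrA; congr (_ + _); rewrite addrCA.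
Qed.

Lemma sg_far a b : (0 < a)%N -> (a.+1 < b)%N -> (b < N)%N -> sg a * sg b = sg b * sg a.
Proof. by move=> *; apply/sg_comm/e_far. Qed.

Let adjacent a b := (e a * e a = dl *: e a /\ e a * e b * e a = e a).

Lemma e_sg_sg a b : adjacent a b -> e a * sg b * sg a = e a * e b.
Proof.
case=> h1 h2; rewrite -mulrA.
have -> : sg b * sg a = (al^-1 * al^-1) *: 1 + e a + e b + (al * al) *: (e b * e a).
  rewrite /sg mulrDl !mulrDr -!scalerAl -!scalerAr !mulr1 !mul1r !scalerA.
  by rewrite mulVf // mulfV // !scale1r !addrA.
rewrite !mulrDr -!scalerAr mulr1 h1 mulrA h2 -scalerDl addrAC -scalerDl.
by rewrite coef_kauffman scale0r add0r.
Qed.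

Lemma sg_sg_e a b : adjacent a b -> sg a * sg b * e a = e b * e a.
Proof.
case=> h1 h2.
have -> : sg a * sg b = (al^-1 * al^-1) *: 1 + e b + e a + (al * al) *: (e a * e b).
  rewrite /sg mulrDl !mulrDr -!scalerAl -!scalerAr !mulr1 !mul1r !scalerA.
  by rewrite mulVf // mulfV // !scale1r !addrA.
rewrite !mulrDl -!scalerAl mul1r h1 h2 -addrA -scalerDl.
rewrite [_ *: _ + e b * e a]addrC -addrA -scalerDl addrA coef_kauffman.
by rewrite scale0r addr0.
Qed.

(** Expanding one outer crossing on each side and pulling the remaining strands across the cap gives
    the same two terms. *)
Lemma sg_braid a : (0 < a)%N -> (a.+1 < N)%N ->
  sg a * sg a.+1 * sg a = sg a.+1 * sg a * sg a.+1.
Proof.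
move=> a0 aN.
have h1 : adjacent a a.+1 by split; [apply: e_sq; lia|apply: e_up].
have h2 : adjacent a.+1 a by split; [apply: e_sq; lia|apply: e_down].
have E x y : adjacent x y -> sg x * sg y * sg x =
    al^-1 *: (sg x * sg y) + al *: (e y * e x).
  by move=> h; rewrite {3}/sg mulrDr -!scalerAr mulr1 sg_sg_e.
have E' x y : adjacent y x -> sg y * (sg x * sg y) =
    al^-1 *: (sg x * sg y) + al *: (e y * e x).
  by move=> h; rewrite {1}/sg mulrDl -!scalerAl mul1r mulrA e_sg_sg.
by rewrite E // -[RHS]mulrA E'.
Qed.

Notation ev := (ev sg).
Notation jm := (jm sg).

(* The curl relation for a strand winding around the first [a] strands. *)
Lemma e_jm a : (a.+1 < N)%N ->
  e a.+1 * jm a * sg a.+1 * jm a = - al ^+ 3 *: e a.+1.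
Proof.
elim: a => [|a IH] aN; first by rewrite jm0 !mulr1 e_sg.
have far' := sg_far; have br := sg_braid.
have c : jm a * sg a.+2 = sg a.+2 * jm a.
  apply/esym; rewrite /jm -ev_cat; apply: (@far_ev _ N) => //.
  by move=> b; rewrite mem_cat => /orP[] /mem_cross; lia.
have h1 : adjacent a.+2 a.+1 by split; [apply: e_sq; lia|apply: e_down].
have h2 : adjacent a.+1 a.+2 by split; [apply: e_sq; lia|apply: e_up].
rewrite jmS -!mulrA.
transitivity (e a.+2 * sg a.+1 * jm a * (sg a.+1 * sg a.+2 * sg a.+1) * jm a * sg a.+1).
  by rewrite !mulrA.
rewrite br; try lia.
transitivity (e a.+2 * sg a.+1 * (jm a * sg a.+2) * sg a.+1 * (sg a.+2 * jm a) * sg a.+1).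
  by rewrite !mulrA.
transitivity (e a.+2 * sg a.+1 * (sg a.+2 * jm a) * sg a.+1 * (jm a * sg a.+2) * sg a.+1).
  by rewrite c.
transitivity ((e a.+2 * sg a.+1 * sg a.+2) * jm a * sg a.+1 * jm a * sg a.+2 * sg a.+1).
  by rewrite !mulrA.
rewrite e_sg_sg // -!mulrA; transitivity (e a.+2 * (e a.+1 * jm a * sg a.+1 * jm a) * (sg a.+2 * sg a.+1)).
  by rewrite !mulrA.
rewrite IH; last lia.
rewrite -scalerAr -scalerAl -mulrA (mulrA (e a.+1)) e_sg_sg // mulrA.
by rewrite e_down //; lia.
Qed.

(** A crossing is an affine function of its generator with nonzero slope, so commuting with the one
    is commuting with the other. *)
Lemma e_full_comm n t : (0 < t < n)%N -> (n <= N)%N ->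
  e t * ev (full n) = ev (full n) * e t.
Proof.
move=> tn nN; have := full_central sg_far sg_braid tn nN.
move: (ev (full n)) => X.
rewrite /sg mulrDl mulrDr -!scalerAl -!scalerAr mul1r mulr1 => /addrI.
exact: scalerI.
Qed.

(** The two strands joined by the generator unwind from the first [a] strands, leaving two curls:
    one is removed by [e_jm], the other by [e_sg], and each costs -A^3. *)
Lemma e_full a : (a.+1 < N)%N ->
  e a.+1 * ev (full a.+2) = al ^+ 6 *: (ev (full a) * e a.+1).
Proof.
move=> aN; have far' := sg_far; have br := sg_braid.
rewrite (@full_jm _ N) // (@full_jm _ N) //; last exact: ltnW.
have c : e a.+1 * ev (full a) = ev (full a) * e a.+1.
  apply: ev_comm => b /mem_full h; rewrite /sg mulrDl mulrDr -!scalerAr -!scalerAl mulr1 mul1r.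
  by rewrite -(@e_far b) //; lia.
rewrite jmS !mulrA c -!mulrA.
transitivity (ev (full a) * (e a.+1 * jm a * sg a.+1 * jm a * sg a.+1)).
  by rewrite !mulrA.
rewrite e_jm // -scalerAl e_sg; last lia.
by rewrite scalerA -scalerAr; congr (_ *: _); ring.
Qed.

End TemperleyLiebRelations.

(** * The Temperley-Lieb algebra as a ring *)

(* The type [TL n n] already carries the pointwise product of functions: the ring
   structure given by the composition is attached to an alias. *)
Record alg_axioms (F : fieldType) (V : lmodType F) (mul : V -> V -> V) (one : V) := {
  algA : associative mul;
  alg1l : left_id one mul;
  alg1r : right_id one mul;
  alg1n : one != 0;
  algDl : left_distributive mul +%R;
  algDr : right_distributive mul +%R;
  algZl : forall a x y, a *: mul x y = mul (a *: x) y;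
  algZr : forall a x y, a *: mul x y = mul x (a *: y)
}.

Definition alg_of (F : fieldType) (V : lmodType F) (mul : V -> V -> V) (one : V)
  (ax : alg_axioms mul one) : Type := V.

Section AlgOf.
Variables (F : fieldType) (V : lmodType F) (mul : V -> V -> V) (one : V).
Variable ax : alg_axioms mul one.
HB.instance Definition _ := GRing.Lmodule.on (alg_of ax).
HB.instance Definition _ := GRing.Zmodule_isNzRing.Build (alg_of ax)
  (algA ax) (alg1l ax) (alg1r ax) (algDl ax) (algDr ax) (alg1n ax).
HB.instance Definition _ := GRing.Lmodule_isLalgebra.Build F (alg_of ax) (algZl ax).
HB.instance Definition _ := GRing.Lalgebra_isAlgebra.Build F (alg_of ax) (algZr ax).
End AlgOf.

Lemma TL_axioms n : alg_axioms (@mulTL n n n) (idTL n).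
Proof.
split.
- by move=> X Y Z; rewrite mulTLA.
- exact: mul1TL.
- exact: mulTL1.
- apply/eqP => /(congr1 (coef (did n))); rewrite idTLE coef_dg eqxx coefTL0.
  by apply/eqP; apply: oner_neq0.
- by move=> X Y Z; rewrite mulTLDl.
- by move=> X Y Z; rewrite mulTLDr.
- by move=> a X Y; rewrite mulTLZl.
- by move=> a X Y; rewrite mulTLZr.
Qed.

Definition TLalg n : algType K := alg_of (TL_axioms n).

Lemma eTL_sq n j : (0 < j < n)%N -> mulTL (eTL n j) (eTL n j) = delta *: eTL n j.
Proof.
case: j => // j jn; have [e [eE eR]] := @e_diagram n j.+1 jn.
rewrite {1}eE bot_arc_e ?eE //; apply/bot_arcP.
have lt : (j < n)%N by lia.
have lt' : (j.+1 < n)%N by lia.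
exists (Ordinal lt), (Ordinal lt'); split=> //; have := eR (inl (Ordinal lt)).
case: (partner e _) => a /=; rewrite -?val_eqE /= => h; last by lia.
by congr inl; apply: val_inj => /=; lia.
Qed.

Lemma eTL_adjacent n j k : (0 < j < n)%N -> (0 < k < n)%N -> (j == k.+1) || (k == j.+1) ->
  mulTL (mulTL (eTL n j) (eTL n k)) (eTL n j) = eTL n j.
Proof.
case: j k => [|j] [|k] //; case: n => [|[|n]] // jn kn jk.
rewrite {1}(@eTL_cupcap n j) ?mulTLA; last lia.
rewrite -(mulTLA (capTL n j)) cap_e_adjacent ?cap_e_adjacent; try lia.
by rewrite -eTL_cupcap //; lia.
Qed.

Lemma eTL_far n a b : (0 < a)%N -> (a.+1 < b)%N -> (b < n)%N ->
  mulTL (eTL n a) (eTL n b) = mulTL (eTL n b) (eTL n a).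
Proof.
move=> a0 ab bn; have -> : n = (a.+1 + (n - a.+1))%N by lia.
have -> : b = (a.+1 + (b - a.+1))%N by lia.
by rewrite -tens_e_id -?tens_id_e ?mul_tensTL ?mulTL1 ?mul1TL //; lia.
Qed.

(** * Jones-Wenzl idempotents *)

Definition form m n (X Y : TL m n) : K := trTL (mulTL X (reflTL Y)).

Lemma formC m n (X Y : TL m n) : form X Y = form Y X.
Proof. by rewrite /form -trTL_refl reflTLM reflTLK. Qed.

Lemma formP m n a (X X' Y : TL m n) : form (a *: X + X') Y = a * form X Y + form X' Y.
Proof. by rewrite /form mulTL_linear_l trTLP. Qed.

Lemma formPr m n a (X X' Y : TL m n) : form Y (a *: X + X') = a * form Y X + form Y X'.
Proof. by rewrite formC formP !(formC Y). Qed.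

Lemma form0r m n (X : TL m n) : form X 0 = 0.
Proof. by rewrite /form linear0 mulTL0 trTL0. Qed.

#[global] Opaque form.

Lemma form_eq0 m n (X : TL m n) : form X X = 0 -> X = 0.
Proof. exact: trTL_anisotropic. Qed.

Lemma form_nondeg m n (X : TL m n) : (forall d, form X (dg d) = 0) -> X = 0.
Proof.
move=> h; apply: form_eq0; suff: forall Y, form X Y = 0 by apply.
by elim/TL_ind => [|a d Y IH]; rewrite ?form0r // formPr h IH mulr0 addr0.
Qed.

(** Gram-Schmidt for the trace form: anisotropy permits division by the norm of any nonzero vector.
    [P] stands for a subspace containing [S], so that the projection can be kept inside it. *)
Lemma form_projection m n (S : seq (TL m n)) (P : TL m n -> Prop) (v : TL m n) :
  P 0 -> (forall a X Y, P X -> P Y -> P (a *: X + Y)) -> (forall w, w \in S -> P w) ->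
  exists u, P u /\ forall w, w \in S -> form (v - u) w = 0.
Proof.
elim: S P v => [|w S IH] P v P0 PP PS; first by exists 0.
have PS' s : s \in S -> P s by move=> sS; apply: PS; rewrite in_cons sS orbT.
have [u' [Pu' u'S]] := IH P v P0 PP PS'.
(* A smaller subspace for the second recursive call: it also records that the projection of [w] is
   orthogonal to every vector orthogonal to [S]. *)
pose P2 p := P p /\ forall x, (forall s, s \in S -> form x s = 0) -> form x p = 0.
have [p [[Pp pS] wS]] : exists p, P2 p /\ forall s, s \in S -> form (w - p) s = 0.
  apply: IH => [|a X Y [PX hX] [PY hY]|s sS].
  - by split=> // x _; apply: form0r.
  - by split=> [|x hx]; [apply: PP | rewrite formPr hX ?hY // mulr0 addr0].
  - by split=> [|x ->] //; apply: PS'.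
have Pw : P (w - p).
  have -> : w - p = (-1) *: p + w by rewrite scaleN1r addrC.
  by apply: PP => //; apply: PS; rewrite mem_head.
set w' := w - p in wS Pw; have wE : w = 1 *: w' + p by rewrite scale1r subrK.
case: (altP (form w' w' =P 0)) => [/form_eq0 w0|q0].
  exists u'; split=> // s; rewrite in_cons => /orP[/eqP ->|]; last exact: u'S.
  by rewrite wE w0 scaler0 add0r pS.
pose c := form (v - u') w' / form w' w'.
have uE : v - (c *: w' + u') = - c *: w' + (v - u').
  by rewrite opprD addrCA scaleNr.
have orthS s : s \in S -> form (v - (c *: w' + u')) s = 0.
  by move=> sS; rewrite uE formP wS // mulr0 add0r u'S.
exists (c *: w' + u'); split; first exact: PP.
move=> s; rewrite in_cons => /orP[/eqP ->|]; last exact: orthS.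
rewrite wE formPr [form _ p]pS // addr0 mul1r uE formP /c mulNr divfK //.
by rewrite addNr.
Qed.

(** By [bot_arc_e] the diagram absorbs the generator up to the factor [delta], which is nonzero. *)
Lemma bot_arc_killed l m n (d : diagram m n) (X : TL l m) j :
  bot_arc d j -> mulTL (eTL m j.+1) X = 0 -> mulTL (dg d) X = 0.
Proof.
move=> dj eX; have := bot_arc_e dj => /(congr1 (fun Y => mulTL Y X)).
rewrite mulTLA eX mulTL0 mulTLZl => /esym/eqP.
by rewrite scaler_eq0 (negPf delta_neq0) => /eqP.
Qed.

Lemma refl_eTL n j : (0 < j < n)%N -> reflTL (eTL n j) = eTL n j.
Proof.
case: j n => // j [|[|n]] // jn.
by rewrite eTL_cupcap ?reflTLM ?reflTLK //; lia.
Qed.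

Lemma top_arc_killed l m n (d : diagram l m) (X : TL m n) j :
  top_arc d j -> mulTL X (eTL m j.+1) = 0 -> mulTL X (dg d) = 0.
Proof.
move=> dj eX; rewrite -[LHS]reflTLK reflTLM reflTL_dg (bot_arc_killed dj) ?linear0 //.
have jm : (0 < j.+1 < m)%N by case/andP: dj => ->.
by rewrite -(refl_eTL jm) -reflTLM eX linear0.
Qed.

Lemma bot_arc_cases m n (d : diagram m n) :
  (exists j, bot_arc d j) \/ (exists j, top_arc d j) \/
  (exists e : m = n, dg d = castTL erefl e (idTL m)).
Proof.
case: (boolp.pselect (exists j, bot_arc d j)) => [|hb]; first by left.
case: (boolp.pselect (exists j, top_arc d j)) => [|ht]; first by right; left.
right; right; apply: no_arc_id => j; apply/negP => h; [apply: hb|apply: ht];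
  by exists j.
Qed.

Lemma eq_addl (V : zmodType) (x x' y : V) : x = x' -> x + y = x' + y.
Proof. by move->. Qed.

Lemma dg_inj m n : injective (@dg m n).
Proof.
move=> d e /(congr1 (coef d)); rewrite !coef_dg eqxx; case: eqP => // _ /eqP.
by rewrite oner_eq0.
Qed.

Lemma bottom_arc_adjacent m n (d : diagram m n) a b :
  partner d (inl a) = inl b -> exists j, bot_arc d j.
Proof.
have lt := @arcp_lt _ _ d; have fK := @arcpK _ _ d; have fN := @arcpN _ _ d.
wlog lt_ab : a b / (a < b)%N.
  move=> h ab; case: (ltngtP a b) => [|gt|/val_inj e]; first by move/h; apply.
    by apply: (h b a) => //; rewrite -ab partnerK.
  by have := partnerN d (inl a); rewrite ab e eqxx.
move=> ab; have aE : arcp d a = b by rewrite -[nat_of_ord a]/(pos (inl a : pt m n)) arcp_pos ab.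
have [am bm] := (ltn_ord a, ltn_ord b).
have [|c cP cE] := adjacent_arc lt fK fN (@arcp_nc _ _ d) (ltn_addr n am); first by rewrite aE.
by exists c; apply/andP; split; [lia | apply/eqP].
Qed.

(** Without bottom arcs the bottom points go injectively, hence bijectively, to the top points;
    there are then no top arcs either, and [no_arc_id] applies. *)
Lemma bot_arc_nid n (d : diagram n n) : d != did n -> exists j, bot_arc d j.
Proof.
move=> dn; apply: contrapT => hb.
have bt (a : 'I_n) : exists b : 'I_n, partner d (inl a) = inr b.
  case e : (partner d (inl a)) => [b|b]; last by exists b.
  by case: hb; apply: bottom_arc_adjacent e.
have [phi phiE] := choice bt.
have phi_inj : injective phi.
  by move=> a b ab; have := phiE a; rewrite ab -phiE => /(inv_inj (partnerK d)) [].
case/negP: dn; apply/eqP/dg_inj; rewrite -idTLE.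
have [j|j|e ->] := @no_arc_id _ _ d.
- by apply/negP => h; apply: hb; exists j.
- apply/bot_arcP => -[a [a' [_ _]]].
  rewrite -[inl a]/(flip (inr a : pt n n)) partner_dflip => /(congr1 (@flip n n)).
  rewrite flipK /= -(f_invF phi_inj a) -phiE partnerK.
  by [].
by rewrite (eq_irrelevance e erefl).
Qed.

Lemma top_arc_nid n (d : diagram n n) : d != did n -> exists j, top_arc d j.
Proof.
move=> dn; apply: bot_arc_nid; apply: contra dn => /eqP e.
by rewrite -(dflipK d) e dflip_id.
Qed.

Section JonesWenzl.
Variable n : nat.

Lemma coef_e_dg j (d : diagram n n) : (0 < j < n)%N ->
  (exists2 d', d' != did n & exists a, mulTL (eTL n j) (dg d) = a *: dg d') /\
  (exists2 d', d' != did n & exists a, mulTL (dg d) (eTL n j) = a *: dg d').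
Proof.
case: j => // j jn; have [e [eE eR]] := @e_diagram n j.+1 jn.
have be : bot_arc e j.
  apply/bot_arcP; have lt : (j < n)%N by lia.
  have lt' : (j.+1 < n)%N by lia.
  exists (Ordinal lt), (Ordinal lt'); split=> //; have := eR (inl (Ordinal lt)).
  case: (partner e _) => a /=; rewrite -?val_eqE /= => h; last by lia.
  by congr inl; apply: val_inj => /=; lia.
have te : top_arc e j.
  by rewrite /top_arc (dg_inj (etrans (esym (reflTL_dg e)) (etrans (congr1 _ (esym eE)) (etrans (refl_eTL jn) eE)))).
rewrite eE !mulTL_dg; split.
  exists (comp e d); last by eexists.
  by apply/eqP => h; have := top_arc_did n j; rewrite -h top_arc_comp.
exists (comp d e); last by eexists.
by apply/eqP => h; have := bot_arc_did n j; rewrite -h bot_arc_comp.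
Qed.

(** Pairing e_j f with a diagram d is pairing f with e_j d, a multiple of a non-identity diagram, so
    e_j f is orthogonal to everything. Idempotency then comes from the coefficient 1 of the identity
    in f. *)
Lemma jw_exists : exists f : TL n n, is_jones_wenzl f.
Proof.
pose S := [seq dg d | d <- enum (diagram n n) & d != did n].
have [|a X Y hX hY|w|u [u0 uS]] :=
  @form_projection n n S (fun X => coef (did n) X = 0) (idTL n).
- exact: coefTL0.
- by rewrite coefTLP hX hY mulr0 addr0.
- case/mapP=> d; rewrite mem_filter => /andP[dn _] ->.
  by rewrite coef_dg eq_sym (negPf dn).
set f := idTL n - u in uS.
have f1 : coef (did n) f = 1.
  by rewrite /f coefTLB u0 subr0 idTLE coef_dg eqxx.
have fperp d : d != did n -> form f (dg d) = 0.
  by move=> dn; apply: uS; apply: map_f; rewrite mem_filter dn mem_enum.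
have ekill j : (0 < j < n)%N -> mulTL (eTL n j) f = 0 /\ mulTL f (eTL n j) = 0.
  move=> jn; split; apply: form_nondeg => d.
    have [[d' d'n [a aE]] _] := coef_e_dg d jn.
    transitivity (form f (mulTL (eTL n j) (dg d))).
      Transparent form. rewrite /form trTL_mulC reflTLM refl_eTL // trTL_mulC.
      by rewrite -mulTLA [in RHS]trTL_mulC -!mulTLA.
    by rewrite aE -[_ *: _]addr0 formPr fperp // mulr0 form0r addr0.
  have [_ [d' d'n [a aE]]] := coef_e_dg d jn.
  transitivity (form f (mulTL (dg d) (eTL n j))).
    by rewrite /form reflTLM refl_eTL // mulTLA.
  by rewrite aE -[_ *: _]addr0 formPr fperp // mulr0 form0r addr0.
#[local] Opaque form.
exists f; split=> //.
  by apply/eqP => f0; move: f1; rewrite f0 coefTL0 => /esym/eqP; rewrite oner_eq0.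
suff fX X : mulTL f X = coef (did n) X *: f by rewrite fX f1 scale1r.
elim/TL_ind: X => [|a d X IH]; first by rewrite mulTL0 coefTL0 scale0r.
rewrite mulTLDr mulTLZr IH coefTLP scalerDl; apply: eq_addl => {IH}.
rewrite coef_dg; case: (altP (d =P did n)) => [->|dn].
  by rewrite eqxx -idTLE mulTL1 mulr1.
have [j dj] := top_arc_nid dn; have jn : (0 < j.+1 < n)%N by case/andP: dj.
have [_ h] := ekill _ jn.
by rewrite (top_arc_killed dj h) scaler0 eq_sym (negPf dn) mulr0 scale0r.
Qed.

Lemma jwP : is_jones_wenzl (jw n).
Proof. by have [f h] := jw_exists; rewrite /jw; apply: (xgetPex 0 (ex_intro _ f h)). Qed.

End JonesWenzl.

Section JonesWenzlTheory.
Variable n : nat.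
Local Notation f := (jw n).

Lemma jw_neq0 : f != 0. Proof. by case: (jwP n). Qed.
Lemma jw_idem : mulTL f f = f. Proof. by case: (jwP n). Qed.

Lemma jw_top d m (dg_ : diagram m n) : top_arc dg_ d -> mulTL f (dg dg_) = 0.
Proof.
move=> dj; apply: (top_arc_killed dj); case: (jwP n) => _ _ /(_ d.+1) h.
by case: h => //; case/andP: dj => ->.
Qed.

Lemma jw_bot d m (dg_ : diagram n m) : bot_arc dg_ d -> mulTL (dg dg_) f = 0.
Proof.
move=> dj; apply: (bot_arc_killed dj); case: (jwP n) => _ _ /(_ d.+1) h.
by case: h => //; case/andP: dj => ->.
Qed.

(** Every non-identity diagram has a top arc and is killed by [f], so only the identity coefficient
    of [X] is seen. This plays the role of Schur's lemma below. *)
Lemma jw_mull X : mulTL f X = coef (did n) X *: f.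
Proof.
elim/TL_ind: X => [|a d X IH]; first by rewrite mulTL0 coefTL0 scale0r.
rewrite mulTLDr mulTLZr IH coefTLP scalerDl; apply: eq_addl => {IH}.
rewrite coef_dg; case: (altP (d =P did n)) => [->|dn].
  by rewrite eqxx -idTLE mulTL1 mulr1.
have [j dj] := top_arc_nid dn.
by rewrite (jw_top dj) scaler0 eq_sym (negPf dn) mulr0 scale0r.
Qed.

Lemma jw_mulr X : mulTL X f = coef (did n) X *: f.
Proof.
elim/TL_ind: X => [|a d X IH]; first by rewrite mulTL0l coefTL0 scale0r.
rewrite mulTLDl mulTLZl IH coefTLP scalerDl; apply: eq_addl => {IH}.
rewrite coef_dg; case: (altP (d =P did n)) => [->|dn].
  by rewrite eqxx -idTLE mul1TL mulr1.
have [j dj] := bot_arc_nid dn.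
by rewrite (jw_bot dj) scaler0 eq_sym (negPf dn) mulr0 scale0r.
Qed.

Lemma coef_jw : coef (did n) f = 1.
Proof.
have := jw_mull f; rewrite jw_idem -{1}[f]scale1r => /eqP.
rewrite -subr_eq0 -scalerBl scaler_eq0 (negPf jw_neq0) orbF subr_eq0.
by move/eqP.
Qed.

(** The reflection of f again has identity coefficient 1, so f times its reflection is f; that
    product is invariant under reflection. *)
Lemma refl_jw : reflTL f = f.
Proof.
have h : coef (did n) (reflTL f) = 1.
  have := jw_mulr f; rewrite jw_idem => e.
  have c d (X : TL n n) : coef (dflip d) (reflTL X) = coef d X.
    elim/TL_ind: X => [|a d' X IH]; first by rewrite linear0 !coefTL0.
    rewrite reflTL_linear !coefTLP IH reflTL_dg !coef_dg.
    by rewrite (inj_eq (can_inj (@dflipK n n))).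
  by rewrite -[did n]dflip_id c coef_jw.
have e1 := jw_mull (reflTL f); rewrite h scale1r in e1.
have : reflTL (mulTL f (reflTL f)) = reflTL f by rewrite e1.
by rewrite reflTLM reflTLK e1.
Qed.

Lemma Delta_neq0 : Delta n != 0.
Proof.
apply/eqP => h; have := jw_neq0; rewrite (@trTL_anisotropic _ _ f) ?eqxx //.
by rewrite refl_jw jw_idem.
Qed.

Lemma sigma_jw j : (0 < j < n)%N -> mulTL f (sigma n j) = A^-1 *: f.
Proof.
move=> jn; rewrite /sigma mulTL_lin2r mulTL1.
by case: (jwP n) => _ _ /(_ j jn)[_ ->]; rewrite scaler0 addr0.
Qed.

End JonesWenzlTheory.

Lemma jw_neq_mul m n (X : TL m n) : m <> n -> mulTL (jw n) (mulTL X (jw m)) = 0.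
Proof.
move=> mn; elim/TL_ind: X => [|a d X IH]; first by rewrite mulTL0l mulTL0.
rewrite mulTLDl mulTLDr mulTLZl mulTLZr IH addr0.
have [[j /jw_bot ->]|[[j /jw_top h]|[e _]]] := bot_arc_cases d.
- by rewrite mulTL0 scaler0.
- by rewrite -mulTLA h mulTL0l scaler0.
by case: mn.
Qed.

(** * Trivalent vertices *)

(** Top arcs of the upper factor persist in a product, so only the identity component of [X] can
    contribute to a diagram without top arcs. *)
Lemma coef_mul_no_top l n (d : diagram l n) (X : TL n n) (W : TL l n) :
  (forall j, ~~ top_arc d j) -> coef d (mulTL X W) = coef (did n) X * coef d W.
Proof.
move=> hd; elim/TL_ind: X => [|a e X IH]; first by rewrite mulTL0l !coefTL0 mul0r.
rewrite mulTLDl mulTLZl !coefTLP IH mulrDl -mulrA; congr (_ * _ + _) => {IH}.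
rewrite coef_dg; case: (altP (e =P did n)) => [->|en].
  by rewrite eqxx -idTLE mul1TL mul1r.
have [j ej] := top_arc_nid en.
by rewrite (coef_top_arc _ ej (hd j)) eq_sym (negPf en) mul0r.
Qed.

Lemma coef_mul_tens x y n (d : diagram (x + y) n) (W : TL (x + y) n) (X : TL x x) (Y : TL y y) :
  (forall j, bot_arc d j -> j.+1 = x) ->
  coef d (mulTL W (tensTL X Y)) = coef (did x) X * coef (did y) Y * coef d W.
Proof.
move=> hd; elim/TL_ind: X => [|a e X IH].
  by rewrite tensTL0l mulTL0 !coefTL0 !mul0r.
rewrite tensTLDl mulTLDr tensTLZl mulTLZr !coefTLP IH mulrDl mulrDl -!mulrA.
congr (_ * _ + _) => {IH}.
elim/TL_ind: Y => [|b e' Y IH]; first by rewrite tensTL0 mulTL0 !coefTL0 mul0r mulr0.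
rewrite tensTLDr mulTLDr tensTLZr mulTLZr !coefTLP IH mulrDl mulrDr -!mulrA.
rewrite [coef _ (dg e) * (b * _)]mulrCA; congr (_ * _ + _) => {IH}.
rewrite !coef_dg tensTL_dg; case: (altP (e =P did x)) => [->|en]; last first.
  have [j ej] := bot_arc_nid en.
  rewrite (coef_bot_arc _ (bot_arc_dtensl e' ej)) 1?eq_sym ?(negPf en) ?mul0r //.
  by apply/negP => /hd jx; case/andP: ej; lia.
case: (altP (e' =P did y)) => [->|en']; last first.
  have [j ej] := bot_arc_nid en'.
  rewrite (coef_bot_arc _ (bot_arc_dtensr (did x) ej)) 1?[_ == e']eq_sym ?(negPf en') ?mul0r ?mulr0 //.
  by apply/negP => /hd; lia.
by rewrite !eqxx dtens_id -idTLE mulTL1 !mul1r.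
Qed.

Lemma vertex_diagramP x y z : admissible x y z -> exists d : diagram (x + y) z,
  [/\ vertex_diagram x y z = dg d, forall j, bot_arc d j -> j.+1 = x &
      forall j, ~~ top_arc d j].
Proof.
case/and4P=> h0 h1 h2 h3.
have [|||d [dE dR]] := @E_diagram (x + y) z x (x + y - z)./2; try lia.
exists d; split=> // [j /bot_arcP[a [a' [aj aj' e]]]|j].
  by have := dR (inl a); rewrite e /= aj aj'; lia.
apply/bot_arcP => -[a [a' [_ _]]].
rewrite -[inl a]/(flip (inr a : pt (x + y) z)) partner_dflip => /(congr1 (@flip _ _)).
by rewrite flipK => e; have := dR (inr a); rewrite e.
Qed.

Lemma vertex_jwl x y z : mulTL (jw z) (vertex x y z) = vertex x y z.
Proof. by rewrite /vertex -mulTLA jw_idem. Qed.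

Lemma tens_jw_idem x y : mulTL (tensTL (jw x) (jw y)) (tensTL (jw x) (jw y)) =
  tensTL (jw x) (jw y).
Proof. by rewrite mul_tensTL !jw_idem. Qed.

Lemma vertex_jwr x y z : mulTL (vertex x y z) (tensTL (jw x) (jw y)) = vertex x y z.
Proof. by rewrite /vertex !mulTLA tens_jw_idem. Qed.

(** The underlying diagram has coefficient 1 in the vertex: by [coef_mul_no_top] and [coef_mul_tens]
    the idempotents enter only through their identity coefficients. *)
Lemma vertex_neq0 x y z : admissible x y z -> vertex x y z != 0.
Proof.
move=> adm; have [d [dE hb ht]] := vertex_diagramP adm.
apply/eqP => /(congr1 (coef d)); rewrite coefTL0 /vertex coef_mul_no_top //.
rewrite coef_mul_tens // !coef_jw dE coef_dg eqxx !mulr1 => /eqP.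
by rewrite oner_eq0.
Qed.

Lemma theta_neq0 x y z : admissible x y z -> theta x y z != 0.
Proof.
move=> adm; apply/eqP => /trTL_anisotropic h.
by have := vertex_neq0 adm; rewrite h eqxx.
Qed.

Lemma reflTL_jwr m n (X : TL m n) : mulTL (jw n) X = X -> mulTL (reflTL X) (jw n) = reflTL X.
Proof. by move=> h; rewrite -{2}h reflTLM refl_jw. Qed.

Lemma jw_hom m (X : TL m m) : mulTL (jw m) X = X -> exists c, X = c *: jw m.
Proof. by move=> h; exists (coef (did m) X); rewrite -jw_mull. Qed.

Lemma jw_hom_neq m n (X : TL m n) : m <> n -> mulTL (jw n) X = X -> mulTL X (jw m) = X -> X = 0.
Proof. by move=> mn h1 h2; rewrite -h1 -h2 jw_neq_mul. Qed.

(** By Schur's lemma the product is a multiple of [jw z]; taking traces finds the scalar. *)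
Lemma vertex_refl x y z : mulTL (vertex x y z) (reflTL (vertex x y z)) =
  (theta x y z / Delta z) *: jw z.
Proof.
have [c cE] : exists c, mulTL (vertex x y z) (reflTL (vertex x y z)) = c *: jw z.
  by apply: jw_hom; rewrite -mulTLA vertex_jwl.
by rewrite /theta cE trTLZ -/(Delta z) mulfK // Delta_neq0.
Qed.

Lemma vertex_orth x y z z' : z <> z' ->
  mulTL (vertex x y z) (reflTL (vertex x y z')) = 0.
Proof.
move=> zz; apply: jw_hom_neq => [e||]; first by apply: zz.
  by rewrite -mulTLA vertex_jwl.
by rewrite mulTLA reflTL_jwr // vertex_jwl.
Qed.

(** On a vector killed by all generators every non-identity term of [jw n] vanishes, and the
    identity has coefficient 1. *)
Lemma jw_fix m n (W : TL m n) :
  (forall j, (0 < j < n)%N -> mulTL (eTL n j) W = 0) -> mulTL (jw n) W = W.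
Proof.
move=> eW; suff h X : mulTL X W = coef (did n) X *: W by rewrite h coef_jw scale1r.
elim/TL_ind: X => [|a d X IH]; first by rewrite mulTL0l coefTL0 scale0r.
rewrite mulTLDl mulTLZl IH coefTLP scalerDl; apply: eq_addl => {IH}.
rewrite coef_dg; case: (altP (d =P did n)) => [->|dn].
  by rewrite eqxx -idTLE mul1TL mulr1.
have [j dj] := bot_arc_nid dn; case/andP: (dj) => jn _.
by rewrite (bot_arc_killed dj) ?eW // scaler0 eq_sym (negPf dn) mulr0 scale0r.
Qed.

Lemma tens_jw_killed x y n (d : diagram (x + y) n) j :
  bot_arc d j -> j.+1 <> x -> mulTL (dg d) (tensTL (jw x) (jw y)) = 0.
Proof.
move=> dj jx; apply: bot_arc_killed (dj) _; case/andP: dj => jn _.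
case: (ltnP j.+1 x) => h.
  by rewrite -tens_e_id // mul_tensTL; case: (jwP x) => _ _ /(_ j.+1 h)[-> _]; rewrite tensTL0l.
have -> : j.+1 = (x + (j.+1 - x))%N by lia.
have h' : (0 < j.+1 - x < y)%N by lia.
by rewrite -tens_id_e // mul_tensTL; case: (jwP y) => _ _ /(_ _ h')[-> _]; rewrite tensTL0.
Qed.

(** * The fusion rule *)

Section Fusion.
Variables x y : nat.

Definition fusion_sum : TL (x + y) (x + y) :=
  \sum_(z < (x + y).+1 | admissible x y z)
     (Delta z / theta x y z) *: mulTL (reflTL (vertex x y z)) (vertex x y z).

Let P := tensTL (jw x) (jw y) - fusion_sum.

Let vertex_P z : admissible x y z -> mulTL (vertex x y z) P = 0.
Proof.
move=> adm; rewrite mulTLBr vertex_jwr mulTL_sumr.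
have zlt : (z < (x + y).+1)%N by case/and4P: adm => *; lia.
rewrite (bigD1 (Ordinal zlt)) //= big1 => [|z' /andP[_ z'z]]; last first.
  rewrite mulTLZr -mulTLA vertex_orth ?mulTL0l ?scaler0 // => e.
  by case/eqP: z'z; apply: val_inj.
rewrite addr0 mulTLZr -mulTLA vertex_refl mulTLZl vertex_jwl scalerA.
by rewrite mulrA divfK ?theta_neq0 // divff ?Delta_neq0 // scale1r subrr.
Qed.

Let jw_P : mulTL (tensTL (jw x) (jw y)) P = P.
Proof.
rewrite mulTLBr tens_jw_idem mulTL_sumr; congr (_ - _).
apply: eq_bigr => z _; rewrite mulTLZr -mulTLA; congr (_ *: mulTL _ _).
by rewrite -{2}[vertex x y z]vertex_jwr reflTLM reflTL_tens !refl_jw.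
Qed.

(** Strong induction on [z]. A generator on top factors through a cap, which lands on [z - 2]
    points, so all generators kill [Y P] and [jw z] fixes it. Between the idempotents only the
    diagram of the vertex survives, and [vertex_P] disposes of it. Taking the identity for [Y] gives
    the fusion rule. *)
Let P_killed z (Y : TL (x + y) z) : mulTL Y P = 0.
Proof.
elim/ltn_ind: z Y => z IH Y.
have fW : mulTL (jw z) (mulTL Y P) = mulTL Y P.
  apply: jw_fix => -[|j] // jz; case: z IH Y jz => [|[|z]] // IH Y jz.
  by rewrite eTL_cupcap // mulTLA -(mulTLA (capTL _ _)) IH // mulTL0.
rewrite -fW; elim/TL_ind: Y {fW} => [|a d Y IHY]; first by rewrite mulTL0l mulTL0.
rewrite mulTLDl mulTLDr mulTLZl mulTLZr IHY addr0 -jw_P.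
case: (pselect (exists j, top_arc d j)) => [[j /jw_top h]|ht].
  by rewrite -!mulTLA h !mulTL0l scaler0.
case: (pselect (exists2 j, bot_arc d j & j.+1 <> x)) => [[j dj jx]|hb].
  by rewrite -(mulTLA (dg d)) (tens_jw_killed dj jx) mulTL0l mulTL0 scaler0.
have [|j dj|j|p [zp px xp dR]] := @diagram_shape _ _ d x.
- exact: leq_addr.
- by apply: contrapT => jx; apply: hb; exists j.
- by apply/negP => h; apply: ht; exists j.
have adm : admissible x y z by rewrite /admissible; apply/and4P; split; lia.
have pE : p = (x + y - z)./2 by lia.
have dE : dg d = vertex_diagram x y z.
  by apply/esym/basisTL_dg => [u v w|u]; [exact: Erel_fun | rewrite -pE; exact: dR].
by rewrite dE -!mulTLA -/(vertex x y z) [mulTL (mulTL (jw z) _) _]mulTLA vertex_P ?scaler0.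
Qed.

Lemma fusion : tensTL (jw x) (jw y) = fusion_sum.
Proof. by apply/eqP; rewrite -subr_eq0 -/P -[P]mul1TL P_killed. Qed.

End Fusion.

(** * Full twists *)

Definition evT n (w : seq nat) : TL n n := prodTL w (sigma n).

Lemma evT_cons n a w : evT n (a :: w) = mulTL (sigma n a) (evT n w).
Proof. by rewrite /evT /prodTL big_cons. Qed.

Lemma evT_nil n : evT n [::] = idTL n.
Proof. by rewrite /evT /prodTL big_nil. Qed.

Lemma prodTL_cat n u v (X : nat -> TL n n) :
  prodTL (u ++ v) X = mulTL (prodTL u X) (prodTL v X).
Proof.
rewrite /prodTL; elim: u => [|a u IH]; first by rewrite big_nil mul1TL.
by rewrite !big_cons IH mulTLA.
Qed.

Lemma evT_cat n u v : evT n (u ++ v) = mulTL (evT n u) (evT n v).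
Proof. exact: prodTL_cat. Qed.

Notation eA n := (eTL n : nat -> TLalg n).
Notation sgA n := (kauffman A (eA n)).

Lemma evTE n w : evT n w = ev (sgA n) w.
Proof.
elim: w => [|a w IH]; first by rewrite evT_nil ev_nil.
by rewrite evT_cons ev_cons IH.
Qed.

Section Relations.
Variable n : nat.

Lemma eA_sq a : (0 < a < n)%N -> eA n a * eA n a = delta *: eA n a.
Proof. exact: eTL_sq. Qed.

Lemma eA_up a : (0 < a)%N -> (a.+1 < n)%N -> eA n a * eA n a.+1 * eA n a = eA n a.
Proof. by move=> a0 an; apply: eTL_adjacent; lia. Qed.

Lemma eA_down a : (0 < a)%N -> (a.+1 < n)%N -> eA n a.+1 * eA n a * eA n a.+1 = eA n a.+1.
Proof. by move=> a0 an; apply: eTL_adjacent; lia. Qed.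

Lemma eA_far a b : (0 < a)%N -> (a.+1 < b)%N -> (b < n)%N -> eA n a * eA n b = eA n b * eA n a.
Proof. exact: eTL_far. Qed.

Definition sA_far := @sg_far K A (TLalg n) n (eA n) eA_far.
Definition sA_braid := @sg_braid K A delta (TLalg n) n (eA n) A_neq0 erefl eA_sq eA_up eA_down.

End Relations.

Lemma evT_fullD n i : evT (n + i) (full (n + i)) =
  mulTL (mulTL (evT (n + i) (map (addn n) (full i))) (evT (n + i) (full n)))
        (evT (n + i) (cross n i ++ cross i n)).
Proof.
rewrite evT_cat !evTE.
exact: (fullD (@sA_far (n + i)) (@sA_braid (n + i)) (leqnn _)).
Qed.

Lemma evT_cross_stack N n m i : (n + m + i <= N)%N ->
  evT N (cross (n + m) i) = mulTL (evT N (map (addn n) (cross m i))) (evT N (cross n i)).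
Proof. by rewrite !evTE; apply: (cross_stack (@sA_far N)). Qed.

Lemma evT_full_central n j : (0 < j < n)%N ->
  mulTL (eTL n j) (evT n (full n)) = mulTL (evT n (full n)) (eTL n j).
Proof.
move=> jn; rewrite !evTE.
exact: (@e_full_comm K A delta (TLalg n) n (eA n) A_neq0 erefl
  (@eA_sq n) (@eA_up n) (@eA_down n) (@eA_far n) n j jn (leqnn n)).
Qed.

Lemma evT_e_full n : mulTL (eTL n.+2 n.+1) (evT n.+2 (full n.+2)) =
  A ^+ 6 *: mulTL (evT n.+2 (full n)) (eTL n.+2 n.+1).
Proof.
rewrite !evTE.
exact: (@e_full K A delta (TLalg n.+2) n.+2 (eA n.+2) A_neq0 erefl
  (@eA_sq n.+2) (@eA_up n.+2) (@eA_down n.+2) (@eA_far n.+2) n (ltnSn _)).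
Qed.

Lemma scaler_swap (F : fieldType) (V : lmodType F) (a b : F) (v : V) :
  a *: (b *: v) = b *: (a *: v).
Proof. by rewrite !scalerA mulrC. Qed.

Definition Ainv : K := A^-1.

Lemma sigmaE n a : sigma n a = Ainv *: idTL n + A *: eTL n a.
Proof. reflexivity. Qed.

#[local] Opaque Ainv sigma evT capTL cupTL full cross half.

Lemma evT_tensl n i w : (forall a, a \in w -> (0 < a < n)%N) ->
  evT (n + i) w = tensTL (evT n w) (idTL i).
Proof.
elim: w => [|a w IH] h; first by rewrite !evT_nil tensTL_id.
rewrite !evT_cons IH => [|b bw]; last by apply: h; rewrite in_cons bw orbT.
rewrite -[idTL i in RHS]mulTL1 -mul_tensTL.
have -> // : tensTL (sigma n a) (idTL i) = sigma (n + i) a.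
by rewrite !sigmaE tensTL_lin2l tensTL_id tens_e_id ?h ?mem_head.
Qed.

Lemma evT_tensr n i w : (forall a, a \in w -> (0 < a < i)%N) ->
  evT (n + i) (map (addn n) w) = tensTL (idTL n) (evT i w).
Proof.
elim: w => [|a w IH] h; first by rewrite !evT_nil tensTL_id.
rewrite /= !evT_cons IH => [|b bw]; last by apply: h; rewrite in_cons bw orbT.
rewrite -[idTL n in RHS]mulTL1 -mul_tensTL.
have -> // : tensTL (idTL n) (sigma i a) = sigma (n + i) (n + a).
by rewrite !sigmaE tensTL_lin2r tensTL_id tens_id_e ?h ?mem_head.
Qed.

Lemma jw_evT n w : (forall a, a \in w -> (0 < a < n)%N) ->
  mulTL (jw n) (evT n w) = A ^- size w *: jw n.
Proof.
elim: w => [|a w IH] h; first by rewrite evT_nil mulTL1 expr0 invr1 scale1r.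
rewrite evT_cons -mulTLA sigma_jw ?h ?mem_head // mulTLZl IH => [|b bw].
  by rewrite scalerA exprS invfM.
by apply: h; rewrite in_cons bw orbT.
Qed.

Lemma jw_full n : mulTL (jw n) (evT n (full n)) = A ^- (n * n.-1) *: jw n.
Proof.
rewrite jw_evT; last exact: mem_full.
Transparent full. by rewrite /full size_cat addnn size_half.
Qed.

#[local] Opaque full.
Lemma cap_evT_last n w : (forall a, a \in w -> (0 < a < n)%N) ->
  mulTL (capTL n n) (evT n.+2 w) = mulTL (evT n w) (capTL n n).
Proof.
elim: w => [|a w IH] h; first by rewrite !evT_nil mulTL1 mul1TL.
have ha := h a (mem_head _ _).
rewrite !evT_cons -mulTLA.
have -> : mulTL (capTL n n) (sigma n.+2 a) = mulTL (sigma n a) (capTL n n).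
  by rewrite !sigmaE mulTL_lin2r mulTL_lin2l mulTL1 mul1TL cap_e_last.
by rewrite mulTLA IH ?mulTLA // => b bw; apply: h; rewrite in_cons bw orbT.
Qed.

Transparent capTL.
Lemma cap_e_self n j : (j <= n)%N ->
  mulTL (capTL n j) (eTL n.+2 j.+1) = delta *: capTL n j.
Proof.
move=> jn; have [|||d [dE dR]] := @E_diagram n.+2 n j.+1 1; try lia.
rewrite /capTL dE bot_arc_e //; apply/bot_arcP.
have lt : (j < n.+2)%N by lia.
have lt' : (j.+1 < n.+2)%N by lia.
exists (Ordinal lt), (Ordinal lt'); split=> //; have := dR (inl (Ordinal lt)).
case: (partner d _) => a /= h; last by lia.
by congr inl; apply: val_inj => /=; lia.
Qed.

#[local] Opaque capTL.
(** For the last cap this is [evT_e_full], the cap being a generator-absorbing element up to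
    [delta]. Every other cap is its right neighbour times a generator, and generators commute with
    the full twist. *)
Lemma cap_full n j : (j <= n)%N ->
  mulTL (capTL n j) (evT n.+2 (full n.+2)) = A ^+ 6 *: mulTL (evT n (full n)) (capTL n j).
Proof.
move: {2}(n - j)%N (erefl (n - j)%N) => k; elim: k j => [|k IH] j kE jn.
  have -> : j = n by lia.
  apply: (scalerI delta_neq0); rewrite -mulTLZl -cap_e_self // mulTLA evT_e_full.
  rewrite mulTLZr -mulTLA cap_evT_last; last exact: mem_full.
  move: (evT n (full n)) => Y.
  by rewrite mulTLA (congr1 (mulTL Y) (cap_e_self (leqnn n))) mulTLZr scaler_swap.
rewrite -(@cap_e_adjacent n j.+1 j) ?eqxx //; last lia.
rewrite mulTLA evT_full_central; last lia.
by rewrite -mulTLA IH ?mulTLZl ?mulTLA //; lia.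
Qed.

Lemma twist_step z n (W : TL n z) j c : (j <= n)%N ->
  mulTL W (evT n (full n)) = c *: W ->
  mulTL (mulTL W (capTL n j)) (evT n.+2 (full n.+2)) = (A ^+ 6 * c) *: mulTL W (capTL n j).
Proof.
move=> jn h; rewrite mulTLA (congr1 (mulTL W) (cap_full jn)) mulTLZr -mulTLA h.
by rewrite mulTLZl scalerA.
Qed.

(** A bottom arc detaches as a cap, which costs A^6 and leaves two strands fewer. After [p] caps
    only [z] strands remain, and there the twist acts on f_z through its crossings. *)
Lemma twist_scalar z p n (X : TL n z) : n = (z + p.*2)%N ->
  mulTL (mulTL (jw z) X) (evT n (full n)) =
  (A ^+ (6 * p) * A ^- (z * z.-1)) *: mulTL (jw z) X.
Proof.
elim: p n X => [|p IH] n X nE.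
  rewrite addn0 in nE; subst n.
  by rewrite muln0 expr0 mul1r jw_mull mulTLZl jw_full scaler_swap.
case: n nE X => [|[|n]] nE X; try by rewrite doubleS in nE; lia.
elim/TL_ind: X => [|a d X IHX]; first by rewrite mulTL0 mulTL0l scaler0.
rewrite mulTLDr mulTLDl scalerDr IHX mulTLZr mulTLZl; apply: eq_addl.
rewrite [RHS]scaler_swap; apply: (congr1 ( *:%R a)).
have [[j dj]|[[j /jw_top h]|[e _]]] := bot_arc_cases d; last by lia.
  have jn : (j <= n)%N by case/andP: dj; lia.
  have dE : delta *: dg d = mulTL (mulTL (dg d) (cupTL n j)) (capTL n j).
    by rewrite -(bot_arc_e dj) (eTL_cupcap jn) mulTLA.
  apply: (scalerI delta_neq0).
  rewrite [RHS]scaler_swap -mulTLZl -mulTLZr dE -(mulTLA (jw z)).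
  rewrite (twist_step jn (IH n _ _)); last by lia.
  have e6 : A ^+ 6 * (A ^+ (6 * p) * A ^- (z * z.-1)) = A ^+ (6 * p.+1) * A ^- (z * z.-1).
    by rewrite mulrA -exprD mulnS.
  rewrite e6; exact: erefl.
by rewrite h mulTL0l scaler0.
Qed.

(** * Casts *)

Section Casts.
Variables (m n m' n' : nat) (em : m = m') (en : n = n').

Lemma castTLZ c (X : TL m n) : castTL em en (c *: X) = c *: castTL em en X.
Proof. by case: m' / em; case: n' / en. Qed.

Lemma castTL_sum I (r : seq I) (P : pred I) (F : I -> TL m n) :
  castTL em en (\sum_(i <- r | P i) F i) = \sum_(i <- r | P i) castTL em en (F i).
Proof. by case: m' / em; case: n' / en. Qed.

Lemma refl_cast (X : TL m n) : reflTL (castTL em en X) = castTL en em (reflTL X).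
Proof. by case: m' / em; case: n' / en. Qed.

Lemma castTL_comp m'' n'' (em' : m' = m'') (en' : n' = n'') (X : TL m n) em'' en'' :
  castTL em' en' (castTL em en X) = castTL em'' en'' X.
Proof.
case: m'' / em' em''; case: n'' / en' en'' => en'' em''.
by rewrite (eq_irrelevance em'' em) (eq_irrelevance en'' en).
Qed.

End Casts.

Lemma castTL_id m n (em : m = m) (en : n = n) (X : TL m n) : castTL em en X = X.
Proof. by rewrite (eq_irrelevance em erefl) (eq_irrelevance en erefl). Qed.

Lemma mul_cast l m n l' m' n' (el : l = l') (em : m = m') (en : n = n')
    (X : TL m n) (Y : TL l m) :
  mulTL (castTL em en X) (castTL el em Y) = castTL el en (mulTL X Y).
Proof. by case: l' / el; case: m' / em; case: n' / en. Qed.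

Lemma mul_castr l m n l' (el : l = l') (X : TL m n) (Y : TL l m) :
  mulTL X (castTL el erefl Y) = castTL el erefl (mulTL X Y).
Proof. by case: l' / el. Qed.

Lemma mul_cast_evT m n m' (em : m = m') (X : TL m n) w :
  mulTL (castTL em erefl X) (evT m' w) = castTL em erefl (mulTL X (evT m w)).
Proof. by case: m' / em. Qed.

Lemma tens_castr m n p q p' q' (e1 : p = p') (e2 : q = q')
    (e3 : (m + p = m + p')%N) (e4 : (n + q = n + q')%N) (X : TL m n) (Y : TL p q) :
  tensTL X (castTL e1 e2 Y) = castTL e3 e4 (tensTL X Y).
Proof. by move: e3 e4; case: p' / e1; case: q' / e2 => e3 e4; rewrite !castTL_id. Qed.

Definition castd m n m' n' (em : m = m') (en : n = n') (d : diagram m n) : diagram m' n' :=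
  let: erefl := em in let: erefl := en in d.

Lemma cast_dg m n m' n' (em : m = m') (en : n = n') (d : diagram m n) :
  castTL em en (dg d) = dg (castd em en d).
Proof. by case: m' / em; case: n' / en. Qed.

Lemma sem_castd m n m' n' (em : m = m') (en : n = n') (d : diagram m n) b t :
  sem (castd em en d) b t = sem d b t.
Proof. by case: m' / em; case: n' / en. Qed.

Lemma castTLP m n m' n' (em : m = m') (en : n = n') a (X Y : TL m n) :
  castTL em en (a *: X + Y) = a *: castTL em en X + castTL em en Y.
Proof. by case: m' / em; case: n' / en. Qed.

Lemma castTL0 m n m' n' (em : m = m') (en : n = n') : castTL em en (0 : TL m n) = 0.
Proof. by case: m' / em; case: n' / en. Qed.

Lemma tens0TL m n (X : TL m n) : tensTL (idTL 0) X = X.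
Proof.
elim/TL_ind: X => [|a d X IH]; first by rewrite tensTL0.
rewrite tensTLDr tensTLZr IH idTLE tensTL_dg; apply: eq_lin; apply: (congr1 (@dg (0 + m) (0 + n))).
by apply: (@sem_inj (0 + m) (0 + n)) => b t; rewrite sem_dtens !take0 !drop0 => /andP[].
Qed.

Lemma tensTL_0r m n (X : TL m n) :
  tensTL X (idTL 0) = castTL (esym (addn0 m)) (esym (addn0 n)) X.
Proof.
elim/TL_ind: X => [|a d X IH]; first by rewrite tensTL0l castTL0.
rewrite tensTLDl tensTLZl IH idTLE tensTL_dg castTLP cast_dg; apply: eq_lin; apply: congr1.
apply: sem_inj => b t; rewrite sem_castd sem_dtens sem_did => /andP[h /andP[h1 h2]].
have [sb st _] := semP _ _ _ h.
have db : drop m b = [::] by apply/nilP.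
have dt : drop n t = [::] by rewrite -(eqP h2).
by rewrite -(cat_take_drop m b) -(cat_take_drop n t) db dt !cats0.
Qed.

Lemma tensTL_A m n p q r s (X : TL m n) (Y : TL p q) (Z : TL r s) :
  tensTL X (tensTL Y Z) =
  castTL (esym (addnA m p r)) (esym (addnA n q s)) (tensTL (tensTL X Y) Z).
Proof.
elim/TL_ind: X => [|a x X IH]; first by rewrite !tensTL0l castTL0.
rewrite !(tensTLDl, tensTLZl) castTLP IH; apply: eq_lin => {IH}.
elim/TL_ind: Y => [|b y Y IH]; first by rewrite !(tensTL0l, tensTL0) castTL0.
rewrite !(tensTLDl, tensTLZl, tensTLDr, tensTLZr) castTLP IH; apply: eq_lin => {IH}.
elim/TL_ind: Z => [|c z Z IH]; first by rewrite !tensTL0 castTL0.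
rewrite !(tensTLDr, tensTLZr) castTLP IH; apply: eq_lin => {IH}.
rewrite !tensTL_dg cast_dg; apply: congr1; apply: sem_inj => b' t.
rewrite sem_castd !sem_dtens !take_drop !drop_drop.
by rewrite !take_takel ?leq_addr // [(p + m)%N]addnC [(q + n)%N]addnC andbA.
Qed.

Lemma tens_powSr i (X : TL i i) m :
  tens_pow X m.+1 = castTL (esym (mulSnr m i)) (esym (mulSnr m i)) (tensTL (tens_pow X m) X).
Proof.
elim: m => [|m IH].
  rewrite [tens_pow X 1]/= tensTL_0r [tens_pow X 0]/= tens0TL.
  by apply/esym; rewrite -{1}[X](castTL_id erefl erefl); apply: castTL_comp.
rewrite [tens_pow X m.+2]/= -/(tens_pow X m.+1) {1}IH.
have e : (i + (m * i + i) = i + m.+1 * i)%N by rewrite mulSnr.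
rewrite (tens_castr _ _ e e) tensTL_A.
have e' : (i + m * i + i = i + m.+1 * i)%N by rewrite -addnA e.
by rewrite (castTL_comp _ _ _ _ _ e' e'); apply/esym; rewrite -{1}[tensTL _ X](castTL_id erefl erefl); apply: castTL_comp.
Qed.

(** * The vectors v_s *)

Definition adm_upto i (s : seq nat) m : Prop :=
  entry s 1 = i /\ forall j, (0 < j < m)%N -> admissible (entry s j) i (entry s j.+1).

Lemma adm_upto_le i s m m' : (m' <= m)%N -> adm_upto i s m -> adm_upto i s m'.
Proof. by move=> le [s1 h]; split=> // j hj; apply: h; lia. Qed.

Lemma vrec1 i s (e : i = entry s 1) : vrec i s 1 = castTL (esym (mul1n i)) e (jw i).
Proof.
rewrite /=; case: eqP => [e'|//]; last by case.
by rewrite (eq_irrelevance (esym e') e).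
Qed.

Lemma vrecS i s m : vrec i s m.+2 = castTL (esym (mulSnr m.+1 i)) erefl
  (mulTL (vertex (entry s m.+1) i (entry s m.+2)) (tensTL (vrec i s m.+1) (idTL i))).
Proof. by []. Qed.

Lemma vertex_tens x i z n m (W : TL n x) (Y : TL m i) : mulTL (jw x) W = W ->
  mulTL (vertex x i z) (tensTL W (mulTL (jw i) Y)) = mulTL (vertex x i z) (tensTL W Y).
Proof. by move=> e; rewrite -[W in LHS]e -mul_tensTL -mulTLA vertex_jwr. Qed.

Lemma vertex_tens1 x i z n (W : TL n x) : mulTL (jw x) W = W ->
  mulTL (vertex x i z) (tensTL W (jw i)) = mulTL (vertex x i z) (tensTL W (idTL i)).
Proof. by move=> e; rewrite -[jw i]mulTL1 vertex_tens. Qed.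

Lemma vrec_jw i s m : adm_upto i s m.+1 ->
  mulTL (jw (entry s m.+1)) (vrec i s m.+1) = vrec i s m.+1.
Proof.
move=> [s1 _]; case: m => [|m]; last by rewrite vrecS mul_castr -mulTLA vertex_jwl.
rewrite (vrec1 (esym s1)); move: (esym s1); case: (entry s 1) / => /=.
by rewrite mul_castr jw_idem.
Qed.

Lemma vrec_F i s m : adm_upto i s m.+1 ->
  mulTL (vrec i s m.+1) (Fki m.+1 i) = vrec i s m.+1.
Proof.
rewrite /Fki; elim: m => [|m IH] gs; rewrite tens_powSr.
  case: (gs) => s1 _; rewrite (vrec1 (esym s1)) [tens_pow _ 0]/= tens0TL.
  by rewrite (eq_irrelevance (esym (mul1n i)) (esym (mulSnr 0 i))) mul_cast jw_idem.
have gs' := adm_upto_le (leqnSn _) gs.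
rewrite vrecS mul_cast mulTLA mul_tensTL mul1TL IH //.
by rewrite vertex_tens1 // vrec_jw.
Qed.

Lemma vrec_ext i s s' m (e : entry s m.+1 = entry s' m.+1) :
  (forall j, (0 < j <= m.+1)%N -> entry s j = entry s' j) ->
  vrec i s' m.+1 = castTL erefl e (vrec i s m.+1).
Proof.
elim: m e => [|m IH] e h.
  pose v1 z : TL (1 * i) z :=
    if z =P i is ReflectT e then castTL (esym (mul1n i)) (esym e) (jw i) else 0.
  by rewrite -[LHS]/(v1 (entry s' 1)) -[vrec i s 1]/(v1 (entry s 1)); case: (entry s' 1) / e.
rewrite !vrecS; have e' : entry s m.+1 = entry s' m.+1 by apply: h; lia.
rewrite (IH e') => [|j hj]; last by apply: h; lia.
case: (entry s' m.+1) / e'; case: (entry s' m.+2) / e.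
by rewrite !castTL_id.
Qed.

(** The inner pairing of [W] and [W'] is a scalar times an idempotent that the outer vertices
    absorb. *)
Lemma vertex_gram x i z z' m (W W' : TL m x) c : mulTL W (reflTL W') = c *: jw x ->
  mulTL (mulTL (vertex x i z) (tensTL W (idTL i)))
        (reflTL (mulTL (vertex x i z') (tensTL W' (idTL i)))) =
  c *: mulTL (vertex x i z) (reflTL (vertex x i z')).
Proof.
move=> e; rewrite reflTLM reflTL_tens reflTL1 mulTLA -(mulTLA (tensTL _ _)).
rewrite mul_tensTL mulTL1 e.
have -> : tensTL (c *: jw x) (idTL i) = c *: tensTL (jw x) (idTL i).
  by rewrite tensTLZl.
rewrite mulTLZl mulTLZr -mulTLA.
by have := vertex_tens1 i z (jw_idem x); rewrite vertex_jwr => <-.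
Qed.

Lemma mul_refl_castl m n n' (e : n = n') (X : TL m n) (Y : TL m n) :
  mulTL (reflTL (castTL erefl e X)) (castTL erefl e Y) = mulTL (reflTL X) Y.
Proof. by case: n' / e. Qed.

Lemma mul_refl_castr m n n' p (e : m = p) (X : TL m n) (Y : TL m n') :
  mulTL (castTL e erefl X) (reflTL (castTL e erefl Y)) = mulTL X (reflTL Y).
Proof. by case: p / e. Qed.

Lemma vrec_norm i s m : adm_upto i s m.+1 ->
  exists2 c, c != 0 & mulTL (vrec i s m.+1) (reflTL (vrec i s m.+1)) = c *: jw (entry s m.+1).
Proof.
elim: m => [|m IH] gs.
  case: (gs) => s1 _; exists 1; first exact: oner_neq0.
  rewrite (vrec1 (esym s1)) scale1r; move: (esym s1); case: (entry s 1) / => /=.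
  by rewrite mul_refl_castr refl_jw jw_idem.
have [c c0 e] := IH (adm_upto_le (leqnSn _) gs); case: gs => _ /(_ m.+1) adm.
have {}adm : admissible (entry s m.+1) i (entry s m.+2) by apply: adm; lia.
exists (c * (theta (entry s m.+1) i (entry s m.+2) / Delta (entry s m.+2))).
  by rewrite !mulf_neq0 ?invr_eq0 ?Delta_neq0 ?theta_neq0.
by rewrite vrecS mul_refl_castr (vertex_gram _ _ _ e) vertex_refl scalerA.
Qed.

(** If the shorter prefixes agree, the last vertices have different outputs and [vertex_orth]
    applies; if not, the inner pairing is already 0 by induction. *)
Lemma vrec_orth i s t m : adm_upto i s m.+1 -> adm_upto i t m.+1 ->
  (exists2 j, (0 < j <= m.+1)%N & entry s j <> entry t j) ->
  mulTL (vrec i s m.+1) (reflTL (vrec i t m.+1)) = 0.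
Proof.
elim: m => [|m IH] gs gt [j hj st].
  case: st; have -> : j = 1%N by lia.
  by case: gs => ->; case: gt => ->.
have gs' := adm_upto_le (leqnSn _) gs; have gt' := adm_upto_le (leqnSn _) gt.
rewrite !vrecS mul_refl_castr.
have [eqst|nst] := pselect (forall j', (0 < j' <= m.+1)%N -> entry s j' = entry t j').
  have e : entry s m.+1 = entry t m.+1 by apply: eqst; lia.
  rewrite (vrec_ext i e eqst).
  have [c _ ec] := vrec_norm gs'.
  case: (entry t m.+1) / e; rewrite castTL_id (vertex_gram _ _ _ ec).
  rewrite vertex_orth ?scaler0 // => ee; apply: st.
  by have [le_j|lt_j] := leqP j m.+1; [apply: eqst; lia | have -> : j = m.+2 by lia].
rewrite reflTLM reflTL_tens reflTL1 mulTLA -(mulTLA (tensTL _ _)) mul_tensTL mulTL1.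
rewrite IH ?tensTL0l ?mulTL0l ?mulTL0 //.
apply: contrapT => hn; apply: nst => j' hj'; apply: contrapT => hne; apply: hn.
by exists j'.
Qed.

(** * Decomposition of the unit *)

Section Decomposition.
Variables (i m : nat).

Definition gram_vec (s : seq nat) : TL (m * i) (m * i) :=
  mulTL (reflTL (vrec i s m)) (vrec i s m).

Definition gram_span (X : TL (m * i) (m * i)) : Prop :=
  exists r : seq (K * seq nat),
    (forall p, p \in r -> size p.2 = m /\ adm_upto i p.2 m) /\
    X = \sum_(p <- r) p.1 *: gram_vec p.2.

Lemma gram_span0 : gram_span 0.
Proof. by exists [::]; rewrite big_nil. Qed.

Lemma gram_spanD X Y : gram_span X -> gram_span Y -> gram_span (X + Y).
Proof.
move=> [r [hr ->]] [r' [hr' ->]]; exists (r ++ r'); split; last by rewrite big_cat.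
by move=> p; rewrite mem_cat => /orP[/hr|/hr'].
Qed.

Lemma gram_spanZ a X : gram_span X -> gram_span (a *: X).
Proof.
move=> [r [hr ->]]; exists [seq (a * p.1, p.2) | p <- r]; split.
  by move=> p /mapP[q /hr h ->].
by rewrite big_map scaler_sumr; apply: eq_bigr => p _; rewrite scalerA.
Qed.

Lemma gram_span1 s : size s = m -> adm_upto i s m -> gram_span (gram_vec s).
Proof.
move=> sz gs; exists [:: (1, s)]; split; last by rewrite big_seq1 scale1r.
by move=> p; rewrite inE => /eqP->.
Qed.

End Decomposition.

Lemma vrec_rcons i s z m : size s = m.+1 -> exists e,
  vrec i (rcons s z) m.+2 = castTL (esym (mulSnr m.+1 i)) e
    (mulTL (vertex (entry s m.+1) i z) (tensTL (vrec i s m.+1) (idTL i))).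
Proof.
move=> sz; have ez : entry (rcons s z) m.+2 = z by rewrite /entry nth_rcons sz ltnn eqxx.
have es j : (0 < j <= m.+1)%N -> entry s j = entry (rcons s z) j.
  by move=> hj; rewrite /entry nth_rcons sz; case: ltnP => //; lia.
have e : entry s m.+1 = entry (rcons s z) m.+1 by apply: es; lia.
exists (esym ez); rewrite vrecS (vrec_ext i e es).
case: (entry (rcons s z) m.+1) / e.
by move: (esym ez); case: (entry (rcons s z) m.+2) /.
Qed.

Lemma adm_upto_rcons i s z m : size s = m.+1 -> adm_upto i s m.+1 ->
  admissible (entry s m.+1) i z -> adm_upto i (rcons s z) m.+2.
Proof.
move=> sz [s1 h] adm; split; first by rewrite /entry nth_rcons sz.
move=> j hj; rewrite /entry !nth_rcons sz.
have -> : (j.-1 < m.+1)%N by lia.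
have [lt_j|] := ltnP j.+1.-1 m.+1; first by apply: h; lia.
move=> le_j; have ej : j = m.+1 by lia.
by rewrite ej eqxx.
Qed.

(** Juxtaposing a Gram term of [s] with f_i and inserting the fusion rule between its two halves
    replaces [s] by its admissible extensions. *)
Lemma Fki_gram i m : gram_span (Fki m.+1 i).
Proof.
rewrite /Fki; elim: m => [|m [r [hr e]]]; rewrite tens_powSr.
  have -> : castTL (esym (mulSnr 0 i)) (esym (mulSnr 0 i)) (tensTL (tens_pow (jw i) 0) (jw i))
     = gram_vec i 1 [:: i].
    rewrite /gram_vec (vrec1 (s := [:: i]) erefl) refl_cast mul_cast refl_jw jw_idem /= tens0TL.
    by rewrite (eq_irrelevance (esym (mulSnr 0 i)) (esym (mul1n i))).
  by apply: gram_span1 => //; split=> // j; lia.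
have -> : tensTL (tens_pow (jw i) m.+1) (jw i) =
    \sum_(p <- r) p.1 *: tensTL (gram_vec i m.+1 p.2) (jw i).
  by rewrite e tensTL_suml; apply: eq_bigr => p _; rewrite tensTLZl.
rewrite castTL_sum big_seq; elim/big_ind: _ => [||p /hr[sz gs]].
- exact: gram_span0.
- exact: gram_spanD.
rewrite castTLZ; apply: gram_spanZ.
set x := entry p.2 m.+1; set v := vrec i p.2 m.+1.
have -> : tensTL (gram_vec i m.+1 p.2) (jw i) =
    \sum_(z < (x + i).+1 | admissible x i z) (Delta z / theta x i z) *:
      mulTL (reflTL (mulTL (vertex x i z) (tensTL v (idTL i))))
            (mulTL (vertex x i z) (tensTL v (idTL i))).
  have vE : mulTL (jw x) v = v by apply: vrec_jw.
  have -> : tensTL (gram_vec i m.+1 p.2) (jw i) =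
     mulTL (tensTL (reflTL v) (idTL i)) (mulTL (tensTL (jw x) (jw i)) (tensTL v (idTL i))).
    by rewrite !mul_tensTL mul1TL mulTL1 vE.
  rewrite fusion /fusion_sum mulTL_suml mulTL_sumr; apply: eq_bigr => z _.
  rewrite mulTLZl mulTLZr; congr (_ *: _).
  by rewrite reflTLM reflTL_tens reflTL1 !mulTLA.
rewrite castTL_sum; elim/big_ind: _ => [||z adm].
- exact: gram_span0.
- exact: gram_spanD.
rewrite castTLZ; apply: gram_spanZ.
have [e' er] := vrec_rcons i z sz.
suff -> : castTL (esym (mulSnr m.+1 i)) (esym (mulSnr m.+1 i))
  (mulTL (reflTL (mulTL (vertex x i z) (tensTL v (idTL i))))
            (mulTL (vertex x i z) (tensTL v (idTL i)))) = gram_vec i m.+2 (rcons p.2 z).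
  by apply: gram_span1; [rewrite size_rcons sz | apply: adm_upto_rcons].
by rewrite /gram_vec er refl_cast mul_cast.
Qed.

(** * Comparison of twist scalars *)

Lemma twist_coef_neq0 a b c : twist_coef a b c != 0.
Proof.
rewrite /twist_coef.
apply: mulf_neq0.
  by rewrite signr_eq0.
by apply: expfz_neq0; apply: A_neq0.
Qed.

(** Squaring removes the sign and the halving of the exponent. The factor on the left avoids
    negative powers, so that exponents can later be compared as natural numbers. *)
Lemma twist_coef_sq x i z q : (x + i = z + q.*2)%N -> (q <= x)%N -> (q <= i)%N ->
  twist_coef z x i ^+ 2 * A ^+ (z * (z + 2)) = A ^+ (x * (x + 2) + i * (i + 2)).
Proof.
move=> e qx qi; rewrite /twist_coef exprMn sqrr_sign mul1r.
set E := (_ - _)%Z.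
have [h eh] : exists h : int, E = h * 2.
  (* Half of [E], found by expanding with z = x + i - 2q; as [E] is even, the integer division in
     [twist_coef] is exact. *)
  exists (((2 * q + 2 * q * (x + i))%N)%:Z - ((x * i + 2 * q * q)%N)%:Z).
  have -> : E = (x * (x + 2) + i * (i + 2))%N%:Z - (z * (z + 2))%N%:Z by [].
  have ez : z%:Z = x%:Z + i%:Z - 2 * q%:Z by lia.
  rewrite !(PoszM, PoszD) ez; ring.
rewrite eh mulzK // [(A ^ h) ^+ 2]exprnP exprz_exp -eh.
rewrite [A ^+ (z * _)]exprnP [A ^+ (x * _ + _)]exprnP -expfzDr ?A_neq0 //.
by congr (_ ^ _); rewrite /E subrK.
Qed.

#[local] Opaque vertex jw vrec twist_coef.

Lemma admP x y z : admissible x y z -> exists2 q, (x + y = z + q.*2)%N & (q <= x)%N && (q <= y)%N.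
Proof. by rewrite /admissible => h; exists ((x + y - z)./2); lia. Qed.

Lemma adm_upto_excess i s m : adm_upto i s m.+1 -> exists p, (m.+1 * i = entry s m.+1 + p.*2)%N.
Proof.
elim: m => [|m IH] gs; first by exists 0; case: gs => ->; lia.
have [p ep] := IH (adm_upto_le (leqnSn _) gs); case: gs => _ /(_ m.+1) h.
have [|q eq _] := admP (h _); first lia.
by exists (p + q)%N; rewrite mulSnr ep addnAC eq; lia.
Qed.

Lemma cancel_xi (F : fieldType) (a b c d t : F) : b != 0 -> c != 0 ->
  a / b / c * t * (b * c * d) = a * (t * d).
Proof. by move=> b0 c0; field; rewrite b0 c0. Qed.

Lemma cancel_z (F : fieldType) (a b c d e : F) : d != 0 ->
  a / d * (b * c * (d * e)) = a * (b * c * e).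
Proof. by move=> d0; field. Qed.

(** After clearing denominators the exponents agree because m(m-1) + 3m = m(m+2) and x + i = z + 2q;
    the 3m terms account for the 6q. *)
Lemma wrap_coef x i z q p : (x + i = z + q.*2)%N -> (q <= x)%N -> (q <= i)%N ->
  A ^+ (6 * p) * A ^- (x * x.-1) * A ^- (i * i.-1) * twist_coef z x i ^+ 2 =
  A ^+ (6 * (p + q)) * A ^- (z * z.-1).
Proof.
move=> e qx qi; have ts := twist_coef_sq e qx qi.
have An m : A ^+ m != 0 by rewrite expf_neq0 ?A_neq0.
have sq m : (m * m.-1 + 3 * m = m * (m + 2))%N by case: m => // m; lia.
apply: (mulIf (An (x * x.-1 + i * i.-1 + z * (z + 2))%N)).
rewrite [A ^+ (_ + _ + z * _)]exprD [A ^+ (_ + i * _)]exprD; set t := twist_coef _ _ _ ^+ 2 in ts *.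
rewrite (cancel_xi _ _ _ (An _) (An _)).
rewrite ts -[(z * (z + 2))%N]sq [A ^+ (z * _ + _)]exprD.
rewrite (cancel_z _ _ _ _ (An _)).
rewrite -!exprD; congr (_ ^+ _).
by rewrite -(sq x) -(sq i); lia.
Qed.

Lemma vertex_full x i z n (v : TL n x) c : mulTL (jw x) v = v ->
  mulTL v (evT n (full n)) = c *: v ->
  mulTL (mulTL (vertex x i z) (tensTL v (idTL i)))
    (tensTL (evT n (full n)) (evT i (full i))) =
  (c * A ^- (i * i.-1)) *: mulTL (vertex x i z) (tensTL v (idTL i)).
Proof.
move=> jv ev; rewrite mulTLA mul_tensTL mul1TL ev.
have -> : tensTL (c *: v) (evT i (full i)) = c *: tensTL v (evT i (full i)) by rewrite tensTLZl.
rewrite mulTLZr; have <- := vertex_tens z (evT i (full i)) jv.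
have -> : tensTL v (mulTL (jw i) (evT i (full i))) = A ^- (i * i.-1) *: tensTL v (jw i).
  by rewrite jw_full tensTLZr.
by rewrite mulTLZr (vertex_tens1 i z jv) scalerA.
Qed.

Lemma evT_full_split n i : evT (n + i) (full (n + i)) =
  mulTL (tensTL (evT n (full n)) (evT i (full i)))
        (evT (n + i) (cross n i ++ cross i n)).
Proof.
rewrite evT_fullD evT_tensr; last exact: mem_full.
rewrite [evT (n + i) (full n)]evT_tensl; last exact: mem_full.
by rewrite mul_tensTL mul1TL mulTL1.
Qed.

Lemma vrec_full i s m p : adm_upto i s m.+1 -> (m.+1 * i = entry s m.+1 + p.*2)%N ->
  mulTL (vrec i s m.+1) (evT _ (full (m.+1 * i))) =
  (A ^+ (6 * p) * A ^- (entry s m.+1 * (entry s m.+1).-1)) *: vrec i s m.+1.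
Proof. by move=> gs e; have := twist_scalar (vrec i s m.+1) e; rewrite vrec_jw. Qed.

Lemma vrec_wrap i s m : adm_upto i s m.+2 ->
  mulTL (vrec i s m.+2) (evT (m.+2 * i) (cross (m.+1 * i) i ++ cross i (m.+1 * i))) =
  JM_scalar i s m.+2 *: vrec i s m.+2.
Proof.
move=> gs; have gs' := adm_upto_le (leqnSn _) gs; have [p ep] := adm_upto_excess gs'.
have adm : admissible (entry s m.+1) i (entry s m.+2) by case: gs => _; apply; lia.
have [q eq /andP[qx qi]] := admP adm.
have ev := vrec_full gs' ep; have jv := vrec_jw gs'.
rewrite vrecS mul_cast_evT -castTLZ; congr castTL.
rewrite /JM_scalar /=.
move: ev jv adm ep eq qx; move: (entry s m.+1) (entry s m.+2) (vrec i s m.+1) => x z v.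
move: (m.+1 * i)%N v => n v ev jv adm ep eq qx.
have fz : (n + i = z + (p + q).*2)%N by lia.
set W := mulTL (vertex _ _ _) _.
have hW : mulTL (jw z) W = W by rewrite /W -mulTLA vertex_jwl.
have := twist_scalar W fz; rewrite hW evT_full_split -mulTLA.
rewrite (vertex_full i z jv ev) -(wrap_coef p eq qx qi) mulTLZl -/W => h.
have a0 : A ^+ (6 * p) * A ^- (x * x.-1) * A ^- (i * i.-1) != 0.
  by rewrite !mulf_neq0 ?invr_eq0 ?expf_neq0 ?A_neq0.
apply: (scalerI a0); rewrite scalerA; exact: h.
Qed.

(** The winding stays within the first j + 1 groups of strands, so it passes the later vertices and
    acts on the prefix for which its group is the last one. *)
Lemma vrec_wrap_le i s j m : (0 < j < m)%N -> adm_upto i s m ->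
  mulTL (vrec i s m) (evT (m * i) (cross (j * i) i ++ cross i (j * i))) =
  JM_scalar i s j.+1 *: vrec i s m.
Proof.
elim: m => [|[|m] IH] jm gs; [lia | lia |].
have [->|lt_jm] : j = m.+1 \/ (j < m.+1)%N by lia.
  exact: vrec_wrap.
have gs' := adm_upto_le (leqnSn _) gs.
rewrite vrecS mul_cast_evT -castTLZ; congr castTL.
rewrite evT_tensl => [|a]; last first.
  have h : (j * i + i <= m.+1 * i)%N by rewrite -mulSnr leq_mul2r lt_jm orbT.
  by rewrite mem_cat => /orP[] /mem_cross; lia.
rewrite mulTLA mul_tensTL mulTL1 IH //; last by case/andP: jm => ->.
by rewrite tensTLZl mulTLZr.
Qed.

(** * JM-elements as braid words *)

Lemma prodTL1 n a (X : nat -> TL n n) : prodTL [:: a] X = X a.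
Proof. by rewrite /prodTL big_cons big_nil mulTL1. Qed.

Lemma prod_evT n (w : nat -> seq nat) r :
  prodTL r (fun a => evT n (w a)) = evT n (flatten (map w r)).
Proof.
elim: r => [|a r IH]; first by rewrite /prodTL big_nil evT_nil.
by rewrite /prodTL big_cons -/(prodTL _ _) IH -evT_cat.
Qed.

Lemma Sigma_evT k i a : Sigma k i a = evT (k * i) (map (addn (a.-1 * i)) (cross i i)).
Proof.
rewrite [LHS](prod_evT _ (fun b => rev (iota (a.-1 * i + b) i))).
by rewrite map_cross.
Qed.

Lemma prod_Sigma k i m : prodTL (iota 1 m) (Sigma k i) = evT (k * i) (cross i (m * i)).
Proof.
elim: m => [|m IH]; first by rewrite /prodTL big_nil evT_nil.
rewrite iota1S prodTL_cat IH prodTL1 Sigma_evT.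
by rewrite mulSnr crossD evT_cat.
Qed.

(** Crossing the groups one after another is crossing all their strands at once, by [cross_stack];
    [m < k] keeps the indices within the [k * i] strands. *)
Lemma prod_rev_Sigma k i m : (m < k)%N ->
  prodTL (rev (iota 1 m)) (Sigma k i) = evT (k * i) (cross (m * i) i).
Proof.
elim: m => [|m IH] lt_m.
  by rewrite mul0n cross0 evT_nil /prodTL big_nil.
rewrite iota1S rev_cat prodTL_cat IH; last lia.
rewrite prodTL1 Sigma_evT mulSnr /= evT_cross_stack //.
by rewrite -!mulSnr leq_mul2r lt_m orbT.
Qed.

Lemma JM_evT k i j : (0 < j < k)%N -> JM k i j.+1 = mulTL (Fki k i)
  (mulTL (evT (k * i) (cross (j * i) i ++ cross i (j * i))) (Fki k i)).
Proof.
move=> jk; rewrite /JM; have -> : (j.+1 == 1%N) = false by lia.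
by rewrite /= prod_rev_Sigma ?prod_Sigma ?evT_cat ?mulTLA //; lia.
Qed.

Lemma vrec_JM i s j k : (0 < j <= k)%N -> adm_upto i s k ->
  mulTL (vrec i s k) (JM k i j) = JM_scalar i s j *: vrec i s k.
Proof.
case: j => // j jk gs; case: k jk gs => [|k] jk gs; first lia.
have vF := vrec_F gs.
case: j jk => [|j] jk; first by rewrite /JM /JM_scalar /= vF scale1r.
rewrite JM_evT -?mulTLA ?vF; last lia.
by rewrite vrec_wrap_le ?mulTLZl ?vF //; lia.
Qed.

#[local] Opaque Fki JM eta theta Delta.

Lemma A_expI : injective (fun n => A ^+ n).
Proof.
move=> a b; rewrite /A -!tofracXn => /eqP; rewrite tofrac_eq => /eqP/(congr1 (fun p : {poly rat} => size p)).
by rewrite !size_polyXn => -[].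
Qed.

Lemma reflTLZ m n a (X : TL m n) : reflTL (a *: X) = a *: reflTL X.
Proof. exact: linearZ. Qed.

(** * Diagonal elements and matrix units *)

Section Tableaux.
Variables (k' i : nat).
Local Notation k := k'.+1.

Notation tab := {l : Lambda k i & T k i l}.

Lemma size_seqT l (s : T k i l) : size (seqT s) = k.
Proof. by rewrite size_map size_tuple. Qed.

Lemma seqT_good l (s : T k i l) : adm_upto i (seqT s) k.
Proof.
case: s => t ht; rewrite /seqT /=; case/andP: (ht) => /and3P[_ /eqP s1 /allP h] _.
split=> // j hj; have /h : j.+1 \in index_iota 2 (size (nats t)).+1.
  by rewrite mem_index_iota size_map size_tuple; lia.
by rewrite /= /admissible; lia.
Qed.

Lemma seqT_inj (u w : tab) : seqT (tagged u) = seqT (tagged w) -> u = w.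
Proof.
case: u w => [l s] [l' t] /= e.
have el : l = l' by apply: val_inj; rewrite /= -(entry_seqT s) -(entry_seqT t) e.
case: l' / el t e => t e; congr existT.
by apply/val_inj/val_inj/(inj_map (@ord_inj _)).
Qed.

Lemma tab_neq (u w : tab) : u <> w ->
  exists2 j, (0 < j <= k)%N & entry (seqT (tagged u)) j <> entry (seqT (tagged w)) j.
Proof.
move=> uw; apply: contrapT => h; apply: uw; apply: seqT_inj.
apply: (@eq_from_nth _ 0%N); rewrite !size_seqT // => j jk.
by apply: contrapT => ne; apply: h; exists j.+1.
Qed.

(** The bound on the entries comes from [i_admissible_le], and the weight lies in the index set
    because each vertex loses an even number of strands. *)
Lemma tab_of s : size s = k -> adm_upto i s k -> exists u : tab, seqT (tagged u) = s.
Proof.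
move=> sz gs.
have ad : i_admissible i s.
  rewrite /i_admissible sz; case: gs => -> h; rewrite eqxx /=.
  apply/allP => -[|[|j]]; rewrite mem_index_iota // => hj.
  by have := h j.+1; rewrite /admissible /=; lia.
pose t : k.-tuple 'I_(k * i).+1 := [tuple inord (entry s j.+1) | j < k].
have tE : nats t = s.
  apply: (@eq_from_nth _ 0%N); rewrite size_map size_tuple ?sz // => j jk.
  rewrite (nth_map ord0) ?size_tuple //.
  have := tnth_mktuple (fun j : 'I_k => inord (entry s j.+1) : 'I_(k * i).+1) (Ordinal jk).
  by rewrite (tnth_nth ord0) /= => ->; rewrite inordK // ltnS -sz i_admissible_le.
have wl : entry s k \in Lambda_seq k i.
  have [p ep] := adm_upto_excess gs.
  by apply/mapP; exists p; rewrite ?mem_iota; lia.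
have ht : i_admissible i (nats t) && (weight (nats t) == ssval (SeqSub wl)).
  by rewrite tE ad /weight sz /=.
by exists (Tagged (T k i) (exist _ t ht : T k i (SeqSub wl))).
Qed.

Definition v (u : tab) : TL (k * i) (ssval (tag u)) := vT (tagged u).

Lemma v_jw u : mulTL (jw (ssval (tag u))) (v u) = v u.
Proof.
case: u => l s; rewrite /v /vT /=; have gs := seqT_good s; move: (entry_seqT s).
case: (ssval l) /.
exact: vrec_jw.
Qed.

Lemma v_F u : mulTL (v u) (Fki k i) = v u.
Proof.
case: u => l s; rewrite /v /vT /=; have gs := seqT_good s; move: (entry_seqT s).
case: (ssval l) /.
exact: vrec_F.
Qed.

Lemma v_JM u j : (0 < j <= k)%N ->
  mulTL (v u) (JM k i j) = JM_scalar i (seqT (tagged u)) j *: v u.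
Proof.
move=> jk; case: u => l s; rewrite /v /vT /=; have gs := seqT_good s; move: (entry_seqT s).
by case: (ssval l) /; apply: vrec_JM.
Qed.

Lemma v_norm u : exists2 c, c != 0 & mulTL (v u) (reflTL (v u)) = c *: jw (ssval (tag u)).
Proof.
case: u => l s; rewrite /v /vT /=; have gs := seqT_good s; move: (entry_seqT s).
case: (ssval l) /.
exact: vrec_norm.
Qed.

Lemma v_orth u w : u <> w -> mulTL (v u) (reflTL (v w)) = 0.
Proof.
move=> /tab_neq; case: u w => [l s] [l' t]; rewrite /v /vT /=.
have gs := seqT_good s; have gt := seqT_good t; move: (entry_seqT s) (entry_seqT t).
case: (ssval l) /; case: (ssval l') /.
exact: vrec_orth.
Qed.

Lemma v_gram u : mulTL (reflTL (v u)) (v u) = gram_vec i k (seqT (tagged u)).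
Proof. by rewrite /v /vT mul_refl_castl. Qed.

Definition nrm u : K := sval (cid2 (v_norm u)).
Lemma nrm_neq0 u : nrm u != 0. Proof. by rewrite /nrm; case: cid2. Qed.
Lemma nrmE u : mulTL (v u) (reflTL (v u)) = nrm u *: jw (ssval (tag u)).
Proof. by rewrite /nrm; case: cid2. Qed.

Lemma v_neq0 u : v u != 0.
Proof.
apply: contraNneq (nrm_neq0 u) => v0; have := nrmE u; rewrite {1}v0 mulTL0l => /esym/eqP.
by rewrite scaler_eq0 (negPf (jw_neq0 _)) orbF.
Qed.

(** The diagonal matrix with entries [g] in terms of matrix units: dividing by [nrm] makes each Gram
    term an idempotent. *)
Definition diag (g : tab -> K) : TL (k * i) (k * i) :=
  \sum_u (g u / nrm u) *: mulTL (reflTL (v u)) (v u).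

Lemma diagE g : diag g = \sum_u (g u / nrm u) *: mulTL (reflTL (v u)) (v u).
Proof. exact: erefl. Qed.

Lemma eq_diag g h : g =1 h -> diag g = diag h.
Proof. by move=> gh; apply: eq_bigr => u _; rewrite gh. Qed.

#[local] Opaque diag.

Lemma v_gram_v u w : mulTL (v u) (mulTL (reflTL (v w)) (v w)) = (nrm u *+ (u == w)) *: v u.
Proof.
case: eqP => [<-|uw]; rewrite -mulTLA; last by rewrite v_orth // mulTL0l scale0r.
by rewrite nrmE mulTLZl v_jw.
Qed.

Lemma v_sum u (c : tab -> K) :
  mulTL (v u) (\sum_w c w *: mulTL (reflTL (v w)) (v w)) = (c u * nrm u) *: v u.
Proof.
rewrite mulTL_sumr (bigD1 u) //= big1 => [|w wu].
  by rewrite addr0 mulTLZr v_gram_v eqxx scalerA.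
by rewrite mulTLZr v_gram_v eq_sym (negPf wu) scale0r scaler0.
Qed.

Lemma v_diag u g : mulTL (v u) (diag g) = g u *: v u.
Proof. by rewrite diagE v_sum mulrVK // unitfE nrm_neq0. Qed.

Lemma diag_refl g : reflTL (diag g) = diag g.
Proof.
rewrite diagE (linear_sum (@reflTL _ _)); apply: eq_bigr => u _.
by rewrite /= reflTLZ reflTLM reflTLK.
Qed.

Lemma diag_v u g : mulTL (diag g) (reflTL (v u)) = g u *: reflTL (v u).
Proof. by rewrite -[diag g]diag_refl -reflTLM v_diag reflTLZ. Qed.

(** [Fki_gram] supplies an expansion with unknown coefficients; since [v u] is fixed by [F],
    orthogonality forces each of them to be the inverse of [nrm u]. *)
Lemma F_diag : Fki k i = diag (fun=> 1).
Proof.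
have [r [hr e]] := Fki_gram i k'.
have [c ec] : exists c : tab -> K, Fki k i = \sum_u c u *: mulTL (reflTL (v u)) (v u).
  rewrite e; elim: r hr {e} => [|p r IH] hr.
    exists (fun=> 0); rewrite big_nil big1 // => u _; exact: scale0r.
  have [|c ec] := IH; first by move=> q qr; apply: hr; rewrite in_cons qr orbT.
  have [sz gs] := hr p (mem_head _ _); have [u eu] := tab_of sz gs.
  exists (fun w => p.1 *+ (w == u) + c w); rewrite big_cons ec.
  transitivity (\sum_w (p.1 *+ (w == u)) *: mulTL (reflTL (v w)) (v w) +
                \sum_w c w *: mulTL (reflTL (v w)) (v w)).
    apply: eq_addl; rewrite (bigD1 u) //= big1 ?addr0 => [|w /negPf->]; last exact: scale0r.
    by rewrite eqxx v_gram eu.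
  by rewrite -big_split /=; apply: eq_bigr => w _; rewrite scalerDl.
rewrite ec diagE; apply: eq_bigr => u _; apply: (congr1 (fun a => a *: _)).
have := v_F u; rewrite ec v_sum -{2}[v u]scale1r => /eqP.
rewrite -subr_eq0 -scalerBl scaler_eq0 (negPf (v_neq0 u)) orbF subr_eq0 => /eqP cn.
by rewrite div1r; apply: (mulIf (nrm_neq0 u)); rewrite mulVf ?nrm_neq0.
Qed.

Lemma diagM g h : mulTL (diag g) (diag h) = diag (fun u => g u * h u).
Proof.
rewrite [diag h]diagE mulTL_sumr; apply: eq_bigr => u _.
by rewrite mulTLZr -mulTLA diag_v mulTLZl scalerA mulrAC [h u * _]mulrC.
Qed.

Lemma diagC g h : mulTL (diag g) (diag h) = mulTL (diag h) (diag g).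
Proof.
rewrite [LHS]diagM -[LHS]diag_refl -[X in reflTL X = _]diagM.
rewrite [LHS]reflTLM; exact: (congr2 (@mulTL _ _ _) (diag_refl h) (diag_refl g)).
Qed.

Lemma F_idem : mulTL (Fki k i) (Fki k i) = Fki k i.
Proof. by rewrite F_diag diagM; apply: eq_diag => u; rewrite mulr1. Qed.

Lemma TLkiP x : TLki k i x <-> mulTL (Fki k i) (mulTL x (Fki k i)) = x.
Proof.
split=> [[y ->]|<-]; last by exists x.
by rewrite -!mulTLA F_idem !mulTLA F_idem.
Qed.

Lemma TLki_mull x : TLki k i x -> mulTL (Fki k i) x = x.
Proof. by move=> /TLkiP <-; rewrite -!mulTLA F_idem. Qed.

Lemma TLki_mulr x : TLki k i x -> mulTL x (Fki k i) = x.
Proof. by move=> /TLkiP <-; rewrite !mulTLA F_idem. Qed.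

Lemma TLkiE x : mulTL (Fki k i) x = x -> mulTL x (Fki k i) = x -> TLki k i x.
Proof. by move=> l r; apply/TLkiP; rewrite r. Qed.

Lemma TLki_diag g : TLki k i (diag g).
Proof.
by apply: TLkiE; rewrite F_diag diagM; apply: eq_diag => u; rewrite (mul1r, mulr1).
Qed.

Lemma JM_left j : mulTL (Fki k i) (JM k i j) = JM k i j.
Proof. Transparent JM. by rewrite /JM; case: ifP => _; rewrite -?mulTLA F_idem. Qed.
#[local] Opaque JM.

Lemma JM_diag j : (0 < j <= k)%N ->
  JM k i j = diag (fun u => JM_scalar i (seqT (tagged u)) j).
Proof.
move=> jk; rewrite -JM_left {1}F_diag {1}diagE mulTL_suml; apply: eq_bigr => u _.
rewrite mulTLZl mulTLA (v_JM _ jk) mulTLZr scalerA div1r.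
by apply: (congr1 (fun a => a *: _)); apply: mulrC.
Qed.

(** * The cellular structure *)

Local Notation B := (TLki k i).
Local Notation tg := (Tagged (T k i)).

Definition etaT (u : tab) : K := eta i (seqT (tagged u)).

Lemma etaT_neq0 u : etaT u != 0.
Proof.
Transparent eta. rewrite /etaT /eta; have [_ h] := seqT_good (tagged u).
rewrite size_seqT prodf_seq_neq0; apply/allP => j; rewrite mem_index_iota => jk /=.
rewrite mulf_neq0 ?invr_eq0 ?Delta_neq0 //; apply: theta_neq0.
by have := h j jk; rewrite /admissible /entry /=; lia.
Qed.
#[local] Opaque eta.

Lemma F_refl : reflTL (Fki k i) = Fki k i.
Proof. by rewrite F_diag diag_refl. Qed.

Lemma F_v u : mulTL (Fki k i) (reflTL (v u)) = reflTL (v u).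
Proof. by rewrite -[Fki k i]F_refl -reflTLM v_F. Qed.

Lemma G_E l (s t : T k i l) :
  G k i l s t = (etaT (tg s))^-1 *: mulTL (reflTL (vT s)) (vT t).
Proof. exact: erefl. Qed.

Lemma TLki_G l (s t : T k i l) : B (G k i l s t).
Proof.
apply: TLkiE; rewrite G_E; first by rewrite mulTLZr -mulTLA (F_v (tg s)).
by rewrite mulTLZl mulTLA (v_F (tg t)).
Qed.

Lemma TLkiP_lin a x y : B x -> B y -> B (a *: x + y).
Proof.
move=> Bx By; apply: TLkiE.
  by rewrite mulTLDr mulTLZr !TLki_mull.
by rewrite mulTLDl mulTLZl !TLki_mulr.
Qed.

Lemma TLki_algebra : is_algebra (@mulTL _ _ _) B (Fki k i).
Proof.
have B0 : B 0 by apply: TLkiE; rewrite ?mulTL0 ?mulTL0l.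
split=> //.
- exact: TLkiP_lin.
- move=> x y Bx By; apply: TLkiE; rewrite ?mulTLA ?TLki_mulr // -mulTLA TLki_mull //.
- by move=> a x y z *; rewrite mulTLDl mulTLZl.
- by move=> a x y z *; rewrite mulTLDr mulTLZr.
- by move=> x y z *; rewrite mulTLA.
- by apply: TLkiE; rewrite F_idem.
- exact: TLki_mull.
- exact: TLki_mulr.
Qed.

Lemma tab_sum (V : nmodType) (F : tab -> V) : \sum_u F u = \sum_l \sum_(s : T k i l) F (tg s).
Proof.
rewrite (sig_big_dep _ (fun _ _ => true) (fun l s => F (tg s))) /=.
by apply: eq_bigr => -[l s].
Qed.

(** Expanding [F] on the left produces the coefficients v_u x v_s^*, which lie between two
    Jones-Wenzl idempotents: they vanish when the weights differ and are scalars otherwise. *)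
Lemma act_v x l (s : T k i l) : B x -> exists r : T k i l -> K,
  mulTL x (reflTL (vT s)) = \sum_u r u *: reflTL (vT u).
Proof.
move=> Bx; pose y := mulTL x (reflTL (vT s)).
have yj : mulTL y (jw (ssval l)) = y by rewrite /y mulTLA (reflTL_jwr (v_jw (tg s))).
exists (fun u => 1 / nrm (tg u) * coef (did (ssval l)) (mulTL (vT u) y)).
have Fy : y = mulTL (Fki k i) y by rewrite /y -mulTLA TLki_mull.
rewrite -/y {1}Fy F_diag {1}diagE mulTL_suml tab_sum (bigD1 l) //= [X in _ + X]big1 => [|l' l'l].
  rewrite addr0; apply: eq_bigr => u _; rewrite mulTLZl mulTLA.
  have e : mulTL (vT u) y = coef (did (ssval l)) (mulTL (vT u) y) *: jw (ssval l).
    by rewrite -jw_mull -mulTLA (v_jw (tg u)).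
  by rewrite {1}e mulTLZr (reflTL_jwr (v_jw (tg u))) scalerA.
apply: big1 => u _; rewrite mulTLZl mulTLA.
have -> : mulTL (vT u) y = 0; last by rewrite mulTL0 scaler0.
apply: (@jw_hom_neq (ssval l) (ssval l')).
- by move/eqP: l'l => nl e; apply: nl; apply: val_inj.
- by rewrite -mulTLA (v_jw (tg u)).
- by rewrite mulTLA yj.
Qed.

Lemma v_G_orth (u w : tab) l (s t : T k i l) : u <> tg s \/ w <> tg t ->
  mulTL (v u) (mulTL (G k i l s t) (reflTL (v w))) = 0.
Proof.
rewrite G_E mulTLZl mulTLZr mulTLA => -[us|wt].
  by rewrite -mulTLA (v_orth us) mulTL0l scaler0.
have -> : mulTL (vT t) (reflTL (v w)) = 0 by apply: (@v_orth (tg t) w) => e; apply: wt.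
by rewrite !mulTL0 scaler0.
Qed.

Lemma v_G l (s t : T k i l) : exists2 c, c != 0 &
  mulTL (vT s) (mulTL (G k i l s t) (reflTL (vT t))) = c *: jw (ssval l).
Proof.
exists ((etaT (tg s))^-1 * (nrm (tg s) * nrm (tg t))).
  by rewrite !mulf_neq0 ?invr_eq0 ?etaT_neq0 ?nrm_neq0.
rewrite G_E mulTLZl mulTLZr mulTLA -mulTLA (nrmE (tg s)) (nrmE (tg t)).
by rewrite mulTLZl mulTLZr jw_idem -!scalerA.
Qed.

Lemma Tagged_pair l l' (s t : T k i l) (s' t' : T k i l') : tg s = tg s' -> tg t = tg t' ->
  Tagged (fun l => T k i l * T k i l)%type (s, t) = Tagged _ (s', t').
Proof.
move=> es; have el : l = l' := congr1 tag es.
case: l' / el s' t' es => s' t' es et.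
by rewrite (eq_from_Tagged es) (eq_from_Tagged et).
Qed.

(** Sandwiching a linear relation between v_s and the reflection of v_t isolates the coefficient of
    G_{s,t}. *)
Lemma G_free : free (codom (cell_family (G k i))).
Proof.
suff : free (codom_tuple (cell_family (G k i))) by [].
apply/freeP => c c0 j.
have e n : (codom_tuple (cell_family (G k i)))`_n = nth 0 (codom (cell_family (G k i))) n by [].
case Ej : (enum_val j) => [l [s t]].
have [a a0 ea] := v_G s t.
have := congr1 (fun X => mulTL (vT s) (mulTL X (reflTL (vT t)))) c0.
rewrite mulTL0l mulTL0 mulTL_suml mulTL_sumr (bigD1 j) //= big1 => [|n nj].
  rewrite addr0 nth_codom Ej /cell_family /= mulTLZl mulTLZr ea scalerA => /eqP.
  by rewrite scaler_eq0 (negPf (jw_neq0 _)) orbF mulf_eq0 (negPf a0) orbF => /eqP.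
rewrite nth_codom mulTLZl mulTLZr.
case En : (enum_val n) => [l' [s' t']]; rewrite /cell_family /=.
rewrite (@v_G_orth (tg s) (tg t) l' s' t'); first exact: scaler0.
have [es|] := pselect (tg s = tg s'); last by left.
right=> et; move/eqP: nj; apply; apply: enum_val_inj; rewrite Ej En.
exact/esym/Tagged_pair.
Qed.

(** In x = x F each term contains x v_s^* v_s, and [act_v] expands its first part. *)
Lemma G_span x : B x <-> x \in <<codom (cell_family (G k i))>>%VS.
Proof.
split=> [Bx|xs]; last first.
  rewrite (coord_span (X := codom_tuple (cell_family (G k i))) xs).
  elim/big_ind: _ => [|y z By Bz|n _].
  - exact: alg_sub0 TLki_algebra.
  - by rewrite -[y]scale1r; apply: TLkiP_lin.
  rewrite -[X in B X]addr0; apply: TLkiP_lin; last exact: alg_sub0 TLki_algebra.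
  by rewrite nth_codom; case: (enum_val n) => l [s t]; apply: TLki_G.
rewrite -(TLki_mulr Bx) F_diag diagE mulTL_sumr; apply: memv_suml => -[l s] _.
rewrite mulTLZr memvZ // -mulTLA; have [r ->] := act_v s Bx.
rewrite mulTL_suml; apply: memv_suml => u _.
have -> : mulTL (r u *: reflTL (vT u)) (vT s) = (r u * etaT (tg u)) *: G k i l u s.
  by rewrite G_E mulTLZl scalerA mulfK ?etaT_neq0.
rewrite memvZ //; apply: memv_span.
by apply/codomP; exists (Tagged (fun l => T k i l * T k i l)%type (u, s)).
Qed.

(* The reflection maps G_{s,t} to (eta t / eta s) G_{t,s}; conjugating it by the
   diagonal element of the eta's removes this factor. *)
Definition star X : TL (k * i) (k * i) :=
  mulTL (diag (fun u => (etaT u)^-1)) (mulTL (reflTL X) (diag etaT)).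

Lemma star_G l (s t : T k i l) : star (G k i l s t) = G k i l t s.
Proof.
rewrite /star !G_E reflTLZ reflTLM reflTLK mulTLZl mulTLZr !mulTLA (v_diag (tg s)).
rewrite -mulTLA (diag_v (tg t)) mulTLZl mulTLZr scaler_swap.
by rewrite (scalerA (etaT (tg s))^-1) (mulVf (etaT_neq0 (tg s))) scale1r.
Qed.

Lemma star_diag g : star (diag g) = diag g.
Proof.
rewrite /star diag_refl (congr1 (mulTL _) (diagC g etaT)) -mulTLA.
have -> : mulTL (diag (fun u => (etaT u)^-1)) (diag etaT) = Fki k i.
  by rewrite diagM F_diag; apply: eq_diag => u; rewrite mulVf ?etaT_neq0.
by rewrite (TLki_mull (TLki_diag g)).
Qed.

Lemma G_cell_datum : is_cell_datum (@mulTL _ _ _) B (G k i) star.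
Proof.
split.
- exact: G_free.
- exact: G_span.
- move=> a x y _ _; rewrite /star reflTL_linear.
  by rewrite mulTLDl mulTLZl mulTLDr mulTLZr.
- move=> x y Bx By; rewrite /star reflTLM !mulTLA; apply: (congr1 (mulTL _)).
  (* The two diagonal elements used in [star] are inverse to each other in the algebra with unit
     [F], so their product may be inserted between the factors. *)
  have ey : reflTL y = mulTL (reflTL y) (mulTL (diag etaT) (diag (fun u => (etaT u)^-1))).
    have -> : mulTL (diag etaT) (diag (fun u => (etaT u)^-1)) = Fki k i.
      by rewrite diagM F_diag; apply: eq_diag => u; rewrite mulfV ?etaT_neq0.
    by rewrite -[Fki k i]F_refl -reflTLM TLki_mull.
  by rewrite {1}ey !mulTLA.
- exact: star_G.
move=> x l s Bx; have [r er] := act_v s Bx.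
(* The quotient of etas converts the coefficients of [act_v] to the normalisation of G; the
   resulting difference is exactly zero. *)
exists (fun u => (etaT (tg s))^-1 * r u * etaT (tg u)) => t.
rewrite G_E mulTLZr -mulTLA er mulTL_suml scaler_sumr -sumrB big1 ?mem0v // => u _.
by rewrite G_E mulTLZl !scalerA mulfK ?etaT_neq0 ?subrr.
Qed.

Lemma JM_family gt : is_JM_family (@mulTL _ _ _) B (G k i) star gt k (JM k i)
  (fun s => JM_scalar i (seqT (tagged s))).
Proof.
split.
- by move=> j jk; rewrite (JM_diag jk); apply: TLki_diag.
- move=> j j' jk jk'; rewrite (JM_diag jk) (JM_diag jk'); apply: diagC.
- by move=> j jk; rewrite (JM_diag jk) star_diag.
(* A diagonal element has G_{s,t} as an eigenvector with eigenvalue c_s(j), so all coefficients of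
   the triangular part are zero. *)
move=> j l jk; exists (fun _ _ => 0) => s t.
rewrite [\sum_(u | _) _]big1 => [|u _]; last exact: scale0r.
rewrite addr0 G_E (JM_diag jk) mulTLZr -mulTLA (diag_v (tg s)) mulTLZl scaler_swap.
by rewrite subrr mem0v.
Qed.

(** Induction along the sequence: once the previous entry is known, [twist_coef_sq] turns equal
    scalars into equal powers A^(z(z+2)), and z(z+2) is strictly increasing in z. *)
Lemma JM_scalar_inj (u w : tab) :
  (forall j, (1 <= j <= k)%N ->
     JM_scalar i (seqT (tagged u)) j = JM_scalar i (seqT (tagged w)) j) -> u = w.
Proof.
move=> h; apply: seqT_inj; have [u1 gu] := seqT_good (tagged u).
have [w1 gw] := seqT_good (tagged w).
have e j : (j < k)%N -> entry (seqT (tagged u)) j.+1 = entry (seqT (tagged w)) j.+1.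
  elim: j => [|j IH] jk; first by rewrite u1 w1.
  have [q eq /andP[q1 q2]] := admP (gu j.+1 jk).
  have [q' eq' /andP[q1' q2']] := admP (gw j.+1 jk).
  have := twist_coef_sq eq q1 q2; have := twist_coef_sq eq' q1' q2'.
  have := h j.+2 jk; rewrite /JM_scalar /= -IH; last exact: ltnW.
  move: (entry _ j.+2) (entry _ j.+2) {eq eq' q1 q2 q1' q2'} => z z' <- <-.
  have t0 : twist_coef z' (entry (seqT (tagged u)) j.+1) i ^+ 2 != 0.
    by apply: expf_neq0; apply: twist_coef_neq0.
  move=> ee; have /A_expI := mulfI t0 ee; nia.
by apply: (@eq_from_nth _ 0%N); rewrite !size_seqT.
Qed.
End Tableaux.

Theorem theorem5p10 (k i : nat) (hk : (0 < k)%N) (hi : (0 < i)%N)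
    (gt : rel (allTab (T k i))) (hgt : is_strict_order gt) :
  exists star : TL (k * i) (k * i) -> TL (k * i) (k * i),
    [/\ is_algebra (@mulTL _ _ _) (TLki k i) (Fki k i),
        is_cell_datum (@mulTL _ _ _) (TLki k i) (G k i) star,
        is_JM_family (@mulTL _ _ _) (TLki k i) (G k i) star gt k (JM k i)
          (fun s => JM_scalar i (seqT (tagged s))) &
        is_separating gt k (fun s => JM_scalar i (seqT (tagged s)))].
Proof.
case: k hk gt hgt => // k _ gt [irr _]; exists (@star k i); split.
- exact: TLki_algebra.
- exact: G_cell_datum.
- exact: JM_family.
(* By irreflexivity related tableaux are distinct, and distinct tableaux differ in some scalar. *)
move=> s t gt_st; apply: contrapT => h.
suff est : s = t by rewrite est irr in gt_st.
apply: JM_scalar_inj => j jk; apply: contrapT => ne; apply: h.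
by exists j.
Qed.
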